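(* Let $E/\mathbb{Q}$ be the elliptic curve $y^2=x^3+a_4x+a_6$ with $a_4,a_6\in\mathbb{Z}$, let $\mathcal{P}=\{P_1,\dots,P_r\}$ be a set of $r$ linearly independent points in $E(\mathbb{Q})$, and let $G$ be a subgroup of $E_{\mathrm{tor}}(\mathbb{Q})$. Fix $0<\varepsilon<\frac12$. If $(u,v)\in\mathbb{Z}^2$ is map-suitable for $E$ and $\varepsilon$-bound-suitable for $\mathcal{P}$, and $-D_E(u,v)$ is a negative fundamental discriminant, then $$h(-D_E(u,v))\ge c_G(\mathcal{P})\cdot\Big(T_E(u,v,\varepsilon)^{r/2}-r\sqrt{d(\mathcal{P})}\,T_E(u,v,\varepsilon)^{(r-1)/2}\Big).$$
   Context: $d_E(u,v):=v(u^3+a_4uv^2-a_6v^3)$, $D_E(u,v):=4d_E(u,v)$; $h(-D)$ is the class number of discriminant $-D$. Map-suitable: $u$, $v$, $3u^2+a_4v^2$, $D_E(u,v)$ all positive. Heights: for $x=m/n$ in lowest terms $h_W(x)=\log\max(|m|,|n|)$; for $P=(A/C^2,B/C^3)$ in lowest terms $h_W(P)=h_W(A/C^2)$; $\hat h(P)=\frac12\lim_n h_W(nP)/n^2$; $\langle P,Q\rangle=\frac12(\hat h(P+Q)-\hat h(P)-\hat h(Q))$. $R_{\mathbb{Q}}(\mathcal{P}):=\det(\langle P_i,P_j\rangle)$, $d(\mathcal{P}):=\max_{\delta_i\in\{0,\pm1\}}2\hat h(\sum\delta_iP_i)$, $\Omega_r=\pi^{r/2}/\Gamma(\frac r2+1)$,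 $c_G(\mathcal{P}):=\frac{|G|}{\sqrt{R_{\mathbb{Q}}(\mathcal{P})}}\Omega_r$, $\delta(E):=\frac18h_W(j(E))+\frac1{12}h_W(\Delta(E))+\frac53$ ($j$-invariant and discriminant of the given model), $T_E(u,v,\varepsilon):=\frac18\log\!\left(\frac{4d_E(u,v)^{1-\varepsilon}}{uv+v^2}\right)-\frac{\delta(E)}4$. With $\varepsilon':=\frac{\varepsilon}{1-\varepsilon}$, $(u,v)$ is $\varepsilon$-bound-suitable for $\mathcal{P}$ if $u,v>0$ and $$\Big(\tfrac14(uv+v^2)\Big)^{1+\varepsilon'}e^{2(1+\varepsilon')(\delta(E)+d(\mathcal{P}))}<d_E(u,v)<\big(v^2(uv+v^2)\big)^{1+\varepsilon'}.$$ *)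

(* Defs.v *)
From HB Require Import structures.
From mathcomp Require Import all_boot all_order all_algebra.
From mathcomp Require Import all_classical all_reals all_analysis.
Set Implicit Arguments. Unset Strict Implicit. Unset Printing Implicit Defensive.
Import Order.TTheory GRing.Theory Num.Theory.
Import numFieldTopology.Exports numFieldNormedType.Exports.
Local Open Scope ring_scope.

(* A point of the projective curve over Q: None = point at infinity O,
   Some (x, y) = affine point. *)
Definition ecpt := option (rat * rat).

Definition ec_disc (a4 a6 : int) : int := - 16 * (4 * a4 ^+ 3 + 27 * a6 ^+ 2).

Definition on_curve (a4 a6 : int) (P : ecpt) : bool :=
  match P with
  | None => true
  | Some (x, y) => y ^+ 2 == x ^+ 3 + a4%:~R * x + a6%:~R
  end.

Definition ec_neg (P : ecpt) : ecpt :=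
  match P with None => None | Some (x, y) => Some (x, - y) end.

Definition ec_add (a4 : int) (P Q : ecpt) : ecpt :=
  match P, Q with
  | None, _ => Q
  | _, None => P
  | Some (x1, y1), Some (x2, y2) =>
    if (x1 == x2) && (y1 == - y2) then None else
    let l := if x1 == x2 then (3 * x1 ^+ 2 + a4%:~R) / (2 * y1)
             else (y2 - y1) / (x2 - x1) in
    let x3 := l ^+ 2 - x1 - x2 in
    Some (x3, l * (x1 - x3) - y1)
  end.

Definition ec_muln (a4 : int) (n : nat) (P : ecpt) : ecpt :=
  iter n (ec_add a4 P) None.

Definition ec_mulz (a4 : int) (n : int) (P : ecpt) : ecpt :=
  match n with
  | Posz k => ec_muln a4 k P
  | Negz k => ec_neg (ec_muln a4 k.+1 P)
  end.

Definition ec_lincomb (a4 : int) (r : nat) (n : 'I_r -> int) (P : 'I_r -> ecpt)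
  : ecpt := \big[ec_add a4/None]_(i < r) ec_mulz a4 (n i) (P i).

Definition lin_indep (a4 : int) (r : nat) (P : 'I_r -> ecpt) : Prop :=
  forall n : 'I_r -> int, ec_lincomb a4 n P = None -> forall i, n i = 0.

Definition is_torsion (a4 : int) (P : ecpt) : Prop :=
  exists n : nat, (0 < n)%N /\ ec_muln a4 n P = None.

Definition torsion_subgroup (a4 a6 : int) (G : seq ecpt) : Prop :=
  [/\ uniq G, None \in G,
      (forall P, P \in G -> on_curve a4 a6 P /\ is_torsion a4 P),
      (forall P Q, P \in G -> Q \in G -> ec_add a4 P Q \in G) &
      (forall P, P \in G -> ec_neg P \in G)].

Section Heights.
Variable R : realType.

Definition hW_rat (x : rat) : R :=
  ln (Num.max (`|numq x|%:~R) ((denq x)%:~R)).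

Definition hW_pt (P : ecpt) : R :=
  match P with None => 0 | Some (x, _) => hW_rat x end.

Definition canon_height (a4 : int) (P : ecpt) : R :=
  2^-1 * limn (fun n : nat => (hW_pt (ec_muln a4 n P) / (n%:R ^+ 2) : R)).

Definition height_pairing (a4 : int) (P Q : ecpt) : R :=
  2^-1 * (canon_height a4 (ec_add a4 P Q) - canon_height a4 P
          - canon_height a4 Q).

Definition regulator (a4 : int) (r : nat) (P : 'I_r -> ecpt) : R :=
  \det (\matrix_(i < r, j < r) height_pairing a4 (P i) (P j)).

Definition sign3 (k : 'I_3) : int :=
  if val k == 0%N then 0 else if val k == 1%N then 1 else -1.

Definition dP (a4 : int) (r : nat) (P : 'I_r -> ecpt) : R :=
  \big[Num.max/0]_(s : {ffun 'I_r -> 'I_3})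
     (2 * canon_height a4 (ec_lincomb a4 (fun i => sign3 (s i)) P)).

Definition Gamma (s : R) : R :=
  Rintegral lebesgue_measure `]0, +oo[%classic
            (fun t => powR t (s - 1) * expR (- t)).

Definition Omega (r : nat) : R :=
  powR pi (r%:R / 2) / Gamma (r%:R / 2 + 1).

Definition cG (a4 : int) (r : nat) (P : 'I_r -> ecpt) (G : seq ecpt) : R :=
  (size G)%:R / Num.sqrt (regulator a4 P) * Omega r.

Definition j_inv (a4 a6 : int) : rat :=
  - 1728 * (4 * a4%:~R) ^+ 3 / (ec_disc a4 a6)%:~R.

Definition deltaE (a4 a6 : int) : R :=
  8^-1 * hW_rat (j_inv a4 a6) + 12^-1 * hW_rat ((ec_disc a4 a6)%:~R) + 5 / 3.

End Heights.

Definition dE (a4 a6 u v : int) : int :=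
  v * (u ^+ 3 + a4 * u * v ^+ 2 - a6 * v ^+ 3).
Definition DE (a4 a6 u v : int) : int := 4 * dE a4 a6 u v.

Definition map_suitable (a4 a6 u v : int) : Prop :=
  [/\ 0 < u, 0 < v, 0 < 3 * u ^+ 2 + a4 * v ^+ 2 & 0 < DE a4 a6 u v].

Definition TE (R : realType) (a4 a6 u v : int) (eps : R) : R :=
  8^-1 * ln (4 * powR (dE a4 a6 u v)%:~R (1 - eps) / (u * v + v ^+ 2)%:~R)
  - deltaE R a4 a6 / 4.

Definition bound_suitable (R : realType) (a4 a6 : int) (r : nat)
  (P : 'I_r -> ecpt) (eps : R) (u v : int) : Prop :=
  let eps' := eps / (1 - eps) in
  [/\ 0 < u, 0 < v,
      powR (4^-1 * (u * v + v ^+ 2)%:~R) (1 + eps')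
        * expR (2 * (1 + eps') * (deltaE R a4 a6 + dP R a4 P))
        < (dE a4 a6 u v)%:~R
    & (dE a4 a6 u v)%:~R < powR ((v ^+ 2 * (u * v + v ^+ 2))%:~R) (1 + eps')].

Definition sqfree_int (n : int) : Prop :=
  forall p : nat, prime p -> ~~ ((p ^ 2)%:Z %| n)%Z.

Definition fundamental_disc (D : int) : Prop :=
  D != 1 /\
  (((D %% 4)%Z = 1 /\ sqfree_int D) \/
   exists m : int, D = 4 * m /\ ((m %% 4)%Z = 2 \/ (m %% 4)%Z = 3) /\ sqfree_int m).

(* binary quadratic forms a x^2 + b x y + c y^2 as triples (a, b, c) *)
Definition bqf := (int * int * int)%type.

Definition bqf_disc (f : bqf) : int := let: (a, b, c) := f in b ^+ 2 - 4 * a * c.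

(* primitive positive definite form of discriminant D (< 0) *)
Definition ppd_form (D : int) (f : bqf) : Prop :=
  let: (a, b, c) := f in
  [/\ gcdz (gcdz a b) c = 1, 0 < a & bqf_disc f = D].

(* proper (SL_2(Z)) equivalence: g(x,y) = f(al x + be y, ga x + de y) *)
Definition bqf_equiv (f g : bqf) : Prop :=
  let: (a, b, c) := f in
  exists al be ga de : int, al * de - be * ga = 1 /\
    g = (a * al ^+ 2 + b * al * ga + c * ga ^+ 2,
         2 * a * al * be + b * (al * de + be * ga) + 2 * c * ga * de,
         a * be ^+ 2 + b * be * de + c * de ^+ 2).

Definition is_class_number (D : int) (h : nat) : Prop :=
  exists reps : seq bqf,
  [/\ size reps = h,
      (forall f, f \in reps -> ppd_form D f),
      (forall i j, (i < size reps)%N -> (j < size reps)%N -> i != j ->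
         ~ bqf_equiv (nth (0, 0, 0) reps i) (nth (0, 0, 0) reps j)) &
      (forall f, ppd_form D f -> exists2 g, g \in reps & bqf_equiv g f)].

(* Main.v *)
Require Import Defs.
From HB Require Import structures.
From mathcomp Require Import all_boot all_order all_algebra.
From mathcomp Require Import ring lra zify.
Set Implicit Arguments. Unset Strict Implicit. Unset Printing Implicit Defensive.
Import Order.TTheory GRing.Theory Num.Theory.
Local Open Scope ring_scope.

(** A rational point P = (A/C^2, B/C^3) gives an integer alpha = A v + u C^2
and, since (-uv, omega, v^2) with omega^2 = -d is a zero of Y^2 Z - X^3 -
a4 X Z^2 - a6 Z^3, an ideal of Z[omega] of norm alpha v / g^2, where
g = gcd(C, v); its class is a form f_P.  Multiplying the lines that meet the
curve in P, -Q and Q - P, evaluated at this zero, shows that f_P ~ f_Q with P <> Q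
produces an element whose norm is controlled by P - Q, and forces H(P - Q) to be at
least v^2 or d / (v (u + v)).

An explicit lower bound for the height of 2P, split into a p-adic and an
archimedean part, gives h_W <= 2 h^ + 2 (delta - ln 2).  Hence points with
h^ <= T have differences of height below both thresholds, and they define
distinct classes; this is how T is chosen.

It remains to count the points sum n_i P_i + g with h^ <= T, which is a count of
integer points in an ellipsoid.  The unit cubes centred at integer points which meet
the ellipsoid of radius sqrt T - rho all have their centre in the one of radius sqrt T when rho
bounds the form on the cube [-1/2, 1/2]^r, and convexity gives
rho^2 <= d(P) / 8.  The number of unit cubes meeting an ellipsoid is at least its
volume, by slicing along one coordinate and the mean value theorem in each slab. *)

(** * Associativity of the chord and tangent law *)

(** The constants dictate the shape of the proof. [TE] is such that [8 * TE + 2 * (deltaE - ln 2)]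
    is ln(d^(1-eps)/(uv + v^2)): points with h^ <= T have differences with h^ <= 4 T by the
    parallelogram law, so the comparison of heights is needed with exactly the constant 2 (delta -
    ln 2). The 5/3 inside [deltaE] leaves very little room. Cancellation in x(2P) is therefore
    measured prime by prime in units of gcd(a^3, b^2), with a special gain at 3, and three regimes
    are separated at the real place, one of them for nearly nodal curves. No ideal theory is set up:
    an ideal is a predicate on Z[omega] closed under sums and multiples, and inclusions between
    products of ideals are Bezout combinations of explicit identities. In the same spirit the volume
    of an ellipsoid is handled by primitives, not as a measure. Points are raw pairs, so the group
    law must be shown to be associative; the canonical height is a limit, so nothing can be read off
    from it before the sequence is known to converge. *)

(** Move the middle point to X = 0 and let c be its ordinate; the curve becomes Y^2 = X^3 + A X^2 +
    a X + c^2. The line of slope l1 through this point meets the curve again at X1 and X4, the line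
    of slope l2 at X3 and X5, and l3, l4 are the slopes of the outer chords of the two
    bracketings. *)
Lemma assoc_slopes (K : fieldType) (X1 X3 X4 X5 l1 l2 l3 l4 c A a : K) :
  X1 + X4 = l1 ^+ 2 - A -> X1 * X4 = a - 2 * c * l1 ->
  X3 + X5 = l2 ^+ 2 - A -> X3 * X5 = a - 2 * c * l2 ->
  l3 * (X3 - X4) = 2 * c + l2 * X3 + l1 * X4 ->
  l4 * (X5 - X1) = - (2 * c + l2 * X5 + l1 * X1) ->
  X3 != X4 -> X5 != X1 ->
  l3 - l4 = l2 - l1 /\ l3 ^+ 2 - X3 - X4 = l4 ^+ 2 - X1 - X5.
Proof.
move=> H1 H2 H3 H4 H5 H6; rewrite -subr_eq0 => n34; rewrite -subr_eq0 => n51.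
have S : l3 - l4 = l2 - l1.
  apply: (mulIf n34); apply: (mulIf n51).
  have EA : A = l1 ^+ 2 - X1 - X4 by rewrite -addrA -opprD H1; ring.
  have Ea : a = X1 * X4 + 2 * c * l1 by rewrite H2; ring.
  move: H3 H4; rewrite EA Ea => H3 H4.
  have -> : (l3 - l4) * (X3 - X4) * (X5 - X1) =
     (l3 * (X3 - X4)) * (X5 - X1) - (l4 * (X5 - X1)) * (X3 - X4) by ring.
  rewrite H5 H6.
  have E2 : X3 = l2 ^+ 2 - (l1 ^+ 2 - X1 - X4) - X5 by rewrite -H3; ring.
  apply/eqP; rewrite -subr_eq0; apply/eqP.
  have -> : (2 * c + l2 * X3 + l1 * X4) * (X5 - X1) - - (2 * c + l2 * X5 + l1 * X1) * (X3 - X4) -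
      (l2 - l1) * (X3 - X4) * (X5 - X1) =
    (2 * c) * ((X3 + X5) - (X1 + X4)) + (l1 - l2) * (X1 * X3 + X4 * X5) + 2 * l2 * (X3 * X5) - 2 * l1 * (X1 * X4)
      - (l2 - l1) * (X3 - X4) * (X5 - X1) by ring.
  rewrite H3.
  have -> : (2 * c) * ((l2 ^+ 2 - (l1 ^+ 2 - X1 - X4)) - (X1 + X4)) = (l2 + l1) * (2 * c * (l2 - l1)) by ring.
  have -> : 2 * c * (l2 - l1) = X1 * X4 - X3 * X5 by rewrite H4; ring.
  by ring.
split=> //.
apply/eqP; rewrite -subr_eq0; apply/eqP.
apply: (mulIf n34); apply: (mulIf n51); rewrite !mul0r.
have -> : l3 ^+ 2 - X3 - X4 - (l4 ^+ 2 - X1 - X5) = (l3 - l4) * (l3 + l4) - (X3 + X4 - X1 - X5) by ring.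
rewrite S.
have -> : ((l2 - l1) * (l3 + l4) - (X3 + X4 - X1 - X5)) * (X3 - X4) * (X5 - X1) =
  (l2 - l1) * ((l3 * (X3 - X4)) * (X5 - X1) + (l4 * (X5 - X1)) * (X3 - X4)) - (X3 + X4 - X1 - X5) * (X3 - X4) * (X5 - X1) by ring.
rewrite H5 H6.
have -> : (2 * c + l2 * X3 + l1 * X4) * (X5 - X1) + - (2 * c + l2 * X5 + l1 * X1) * (X3 - X4) =
  2 * c * (X5 - X1 - X3 + X4) + (l1 + l2) * (X4 * X5 - X1 * X3) by ring.
have E1 : 2 * c * (l2 - l1) = X1 * X4 - X3 * X5 by rewrite H2 H4; ring.
have E2 : l2 ^+ 2 - l1 ^+ 2 = (X3 + X5) - (X1 + X4) by rewrite H3 H1; ring.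
have -> : (l2 - l1) * (2 * c * (X5 - X1 - X3 + X4) + (l1 + l2) * (X4 * X5 - X1 * X3)) =
  2 * c * (l2 - l1) * (X5 - X1 - X3 + X4) + (l2 ^+ 2 - l1 ^+ 2) * (X4 * X5 - X1 * X3) by ring.
rewrite E1 E2; ring.
Qed.

(* the case where the two points of the second chord on one side coincide *)
Lemma assoc_slopes_tangent (K : fieldType) (X1 X3 X5 l1 l2 l4 c A a : K) :
  X1 + X3 = l1 ^+ 2 - A -> X1 * X3 = a - 2 * c * l1 ->
  X3 + X5 = l2 ^+ 2 - A -> X3 * X5 = a - 2 * c * l2 ->
  2 * c + l2 * X3 + l1 * X3 = 0 ->
  l4 * (X5 - X1) = - (2 * c + l2 * X5 + l1 * X1) ->
  X5 != X1 ->
  2 * (c + l2 * X3) * (l4 + l2 - l1) = 3 * X3 ^+ 2 + 2 * A * X3 + a /\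
  (l4 + l2 - l1) ^+ 2 - X3 - X3 = l4 ^+ 2 - X1 - X5.
Proof.
move=> H1 H2 H3 H4 H5 H6; rewrite -subr_eq0 => n51.
have E1 : 2 * c = - (l1 + l2) * X3 by apply/eqP; rewrite -subr_eq0 -H5; apply/eqP; ring.
have EA : A = l2 ^+ 2 - X3 - X5 by rewrite -addrA -opprD H3; ring.
have Ea : a = X3 * X5 + 2 * c * l2 by rewrite H4; ring.
have E2 : l2 ^+ 2 - l1 ^+ 2 = X5 - X1.
  have -> : X5 - X1 = (X3 + X5) - (X1 + X3) by ring.
  by rewrite H1 H3; ring.
have E3 : (l1 + l2) * (l2 - l1) = X5 - X1 by rewrite -E2; ring.
have E6 : l4 * (X5 - X1) = (l1 + l2) * X3 - l2 * X5 - l1 * X1 by rewrite H6 E1; ring.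
split; apply/eqP; rewrite -subr_eq0; apply/eqP; apply: (mulIf n51); rewrite mul0r.
- rewrite Ea EA.
  have -> : 2 * (c + l2 * X3) = (l2 - l1) * X3 by rewrite mulrDr E1; ring.
  rewrite [2 * c]E1.
  have -> : ((l2 - l1) * X3 * (l4 + l2 - l1) - (3 * X3 ^+ 2 + 2 * (l2 ^+ 2 - X3 - X5) * X3 + (X3 * X5 + - (l1 + l2) * X3 * l2))) *
    (X5 - X1) = (l2 - l1) * X3 * (l4 * (X5 - X1) + (l2 - l1) * (X5 - X1)) -
     (3 * X3 ^+ 2 + 2 * (l2 ^+ 2 - X3 - X5) * X3 + (X3 * X5 + - (l1 + l2) * X3 * l2)) * (X5 - X1) by ring.
  rewrite E6.
  have -> : X1 = X5 - (l1 + l2) * (l2 - l1) by rewrite E3; ring.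
  ring.
- have -> : ((l4 + l2 - l1) ^+ 2 - X3 - X3 - (l4 ^+ 2 - X1 - X5)) * (X5 - X1) =
     (l2 - l1) * (2 * (l4 * (X5 - X1)) + (l2 - l1) * (X5 - X1)) - (X3 + X3 - X1 - X5) * (X5 - X1) by ring.
  rewrite E6.
  have -> : X1 = X5 - (l1 + l2) * (l2 - l1) by rewrite E3; ring.
  ring.
Qed.

(** Vieta's relations for x^3 + a x + b - (l x + c)^2: the line y = l x + c meets the curve at x1,
    x2, x3 counted with multiplicity. Chords and tangents are thus treated alike. *)
Definition col (a b l c x1 x2 x3 : rat) : Prop :=
  [/\ x1 + x2 + x3 = l ^+ 2, x1 * x2 + x1 * x3 + x2 * x3 = a - 2 * l * c &
      x1 * x2 * x3 = c ^+ 2 - b].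

Lemma col_rot a b l c x1 x2 x3 : col a b l c x1 x2 x3 -> col a b l c x2 x3 x1.
Proof. by case=> H1 H2 H3; split; [rewrite -H1|rewrite -H2|rewrite -H3]; ring. Qed.

Lemma col_swap a b l c x1 x2 x3 : col a b l c x1 x2 x3 -> col a b l c x2 x1 x3.
Proof. by case=> H1 H2 H3; split; [rewrite -H1|rewrite -H2|rewrite -H3]; ring. Qed.

Lemma col_neg a b l c x1 x2 x3 : col a b l c x1 x2 x3 -> col a b (- l) (- c) x1 x2 x3.
Proof. by case=> H1 H2 H3; split; rewrite ?H1 ?H2 ?H3; ring. Qed.

Lemma col_cubic a b l c x1 x2 x3 x : col a b l c x1 x2 x3 ->
  x ^+ 3 + a * x + b - (l * x + c) ^+ 2 = (x - x1) * (x - x2) * (x - x3).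
Proof.
case=> H1 H2 H3.
have -> : (x - x1) * (x - x2) * (x - x3) = x ^+ 3 - (x1 + x2 + x3) * x ^+ 2 +
  (x1 * x2 + x1 * x3 + x2 * x3) * x - x1 * x2 * x3 by ring.
by rewrite H1 H2 H3; ring.
Qed.

Section Curve.
Variables a4 a6 : int.
Hypothesis disc0 : ec_disc a4 a6 != 0.
Let a : rat := a4%:~R.
Let b : rat := a6%:~R.

Lemma disc_rat_neq0 : 4 * a ^+ 3 + 27 * b ^+ 2 != 0.
Proof.
move: disc0; rewrite /ec_disc mulf_eq0 negb_or => /andP[_ h].
have -> : 4 * a ^+ 3 + 27 * b ^+ 2 = (4 * a4 ^+ 3 + 27 * a6 ^+ 2)%:~R.
  by rewrite /a /b !(rmorphD, rmorphM, rmorphXn) /=.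
by rewrite intr_eq0.
Qed.

Lemma smooth_y0 x : x ^+ 3 + a * x + b = 0 -> 3 * x ^+ 2 + a != 0.
Proof.
move=> h; apply/eqP => h2; move/eqP: disc_rat_neq0; apply.
have Ea : a = - 3 * x ^+ 2 by apply/eqP; rewrite -subr_eq0 -h2; apply/eqP; ring.
have Eb : b = 2 * x ^+ 3 by apply/eqP; rewrite -subr_eq0 -h Ea; apply/eqP; ring.
by rewrite Eb Ea; ring.
Qed.

Lemma on_curve_some x y : on_curve a4 a6 (Some (x, y)) = (y ^+ 2 == x ^+ 3 + a * x + b).
Proof. by []. Qed.

Lemma ec_add_col x1 y1 x2 y2 :
  on_curve a4 a6 (Some (x1, y1)) -> on_curve a4 a6 (Some (x2, y2)) ->
  Some (x1, y1) != ec_neg (Some (x2, y2)) ->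
  exists l c x3, [/\ ec_add a4 (Some (x1, y1)) (Some (x2, y2)) = Some (x3, - (l * x3 + c)),
    y1 = l * x1 + c, y2 = l * x2 + c & col a b l c x1 x2 x3].
Proof.
rewrite !on_curve_some => /eqP h1 /eqP h2 hn.
have hn' : (x1 == x2) && (y1 == - y2) = false.
  by apply/negbTE; apply: contra hn => /andP[/eqP-> /eqP->].
rewrite /ec_add hn'.
case: (eqVneq x1 x2) hn' => [e|n] /=; last first.
  move=> _; set l := (y2 - y1) / (x2 - x1); rewrite -/a.
  have n21 : x2 - x1 != 0 by rewrite subr_eq0 eq_sym.
  have El : l * (x2 - x1) = y2 - y1 by rewrite divfK.
  exists l, (y1 - l * x1), (l ^+ 2 - x1 - x2); split => //.
  - by congr (Some (_, _)); ring.
  - by ring.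
  - by apply/eqP; rewrite -subr_eq0; apply/eqP; rewrite -[y2](subrK y1) -El; ring.
  have K : (y1 + y2) * l = x2 ^+ 2 + x1 * x2 + x1 ^+ 2 + a.
    apply: (mulIf n21).
    have -> : (y1 + y2) * l * (x2 - x1) = (y1 + y2) * (l * (x2 - x1)) by ring.
    rewrite El; have -> : (y1 + y2) * (y2 - y1) = y2 ^+ 2 - y1 ^+ 2 by ring.
    by rewrite h1 h2; ring.
  have Y2 : y2 = y1 + l * (x2 - x1) by rewrite El; ring.
  have Ea : a = (y1 + y2) * l - (x2 ^+ 2 + x1 * x2 + x1 ^+ 2) by rewrite K; ring.
  split; first by ring.
    by rewrite Ea Y2; ring.
  have -> : b = y1 ^+ 2 - x1 ^+ 3 - a * x1 by rewrite h1; ring.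
  by rewrite Ea Y2; ring.
move=> hy.
have y12 : y1 = y2.
  move: h2; rewrite -e -h1 => /eqP; rewrite eqf_sqr => /orP[/eqP//|/eqP E].
  by rewrite E opprK eqxx in hy.
have y0 : 2 * y1 != 0.
  rewrite mulf_neq0 //; apply/eqP => y0; move: hy; rewrite -y12 y0 oppr0 eqxx //.
rewrite -/a; set l := (3 * x1 ^+ 2 + a) / (2 * y1).
have El : l * (2 * y1) = 3 * x1 ^+ 2 + a by rewrite divfK.
subst x2 y2.
exists l, (y1 - l * x1), (l ^+ 2 - x1 - x1); split => //.
- by congr (Some (_, _)); ring.
- by ring.
- by ring.
have Ea : a = l * (2 * y1) - 3 * x1 ^+ 2 by rewrite El; ring.
split; [by ring|by rewrite Ea; ring|].
have -> : b = y1 ^+ 2 - x1 ^+ 3 - a * x1 by rewrite h1; ring.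
by rewrite Ea; ring.
Qed.

Lemma col_on_curve l c x1 x2 x3 : col a b l c x1 x2 x3 -> on_curve a4 a6 (Some (x1, l * x1 + c)).
Proof.
move=> h; rewrite on_curve_some eq_sym -subr_eq0 (col_cubic x1 h); apply/eqP; ring.
Qed.

Lemma on_curve_opp x y : on_curve a4 a6 (Some (x, - y)) = on_curve a4 a6 (Some (x, y)).
Proof. by rewrite !on_curve_some sqrrN. Qed.

Lemma on_curve_neg P : on_curve a4 a6 (ec_neg P) = on_curve a4 a6 P.
Proof. by case: P => [[x y]|//]; rewrite on_curve_opp. Qed.

(** The tangent case relies on smoothness: a double intersection with ordinate 0 would make the
    cubic and its derivative vanish together, against [disc0]. *)
Lemma ec_add_of_col l c x1 x2 x3 : col a b l c x1 x2 x3 ->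
  ec_add a4 (Some (x1, l * x1 + c)) (Some (x2, l * x2 + c)) = Some (x3, - (l * x3 + c)).
Proof.
move=> h; have h1 := col_on_curve h; have h2 := col_on_curve (col_swap h).
case: (h) => e1 e2 e3.
rewrite /ec_add -/a; case: (eqVneq x1 x2) => [e|n] /=; last first.
  have n21 : x2 - x1 != 0 by rewrite subr_eq0 eq_sym.
  have -> : (l * x2 + c - (l * x1 + c)) / (x2 - x1) = l.
    by apply: (mulIf n21); rewrite divfK //; ring.
  have -> : x3 = l ^+ 2 - x1 - x2 by rewrite -e1; ring.
  by congr (Some (_, _)); ring.
subst x2.
have Ed : 3 * x1 ^+ 2 + a = l * (2 * (l * x1 + c)).
  apply/eqP; rewrite -subr_eq0; apply/eqP.
  have -> : a = x1 * x1 + x1 * x3 + x1 * x3 + 2 * l * c by rewrite e2; ring.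
  have -> : x3 = l ^+ 2 - x1 - x1 by rewrite -e1; ring.
  ring.
have y0 : l * x1 + c != 0.
  apply/eqP => y0; move: h1; rewrite on_curve_some y0 => /eqP.
  rewrite expr0n /= => /esym /smooth_y0; rewrite Ed y0 !mulr0; by move/eqP.
have y20 : 2 * (l * x1 + c) != 0 by rewrite mulf_neq0.
rewrite ifF; last first.
  apply/negbTE; rewrite -addr_eq0; have -> : l * x1 + c + (l * x1 + c) = 2 * (l * x1 + c) by ring.
  by [].
have -> : (3 * x1 ^+ 2 + a) / (2 * (l * x1 + c)) = l by rewrite Ed mulfK.
have -> : x3 = l ^+ 2 - x1 - x1 by rewrite -e1; ring.
by congr (Some (_, _)); ring.
Qed.

Lemma ec_addNP P : ec_add a4 (ec_neg P) P = None.
Proof. by case: P => [[x y]|//]; rewrite /= !eqxx. Qed.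

Lemma ec_addPN P : ec_add a4 P (ec_neg P) = None.
Proof. by case: P => [[x y]|//]; rewrite /= opprK !eqxx. Qed.

Lemma ec_negK P : ec_neg (ec_neg P) = P.
Proof. by case: P => [[x y]|//] /=; rewrite opprK. Qed.

Lemma ec_addP0 P : ec_add a4 P None = P. Proof. by case: P => [[]|]. Qed.
Lemma ec_add_on P Q : on_curve a4 a6 P -> on_curve a4 a6 Q -> on_curve a4 a6 (ec_add a4 P Q).
Proof.
move=> hP hQ; case: (eqVneq P (ec_neg Q)) => [->|n]; first by rewrite ec_addNP.
move: P Q hP hQ n => [[x1 y1]|] [[x2 y2]|] hP hQ n //.
have [l [c [x3 [-> _ _ h]]]] := ec_add_col hP hQ n.
rewrite on_curve_opp; exact: (col_on_curve (col_rot (col_rot h))).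
Qed.

Lemma ec_addC P Q : on_curve a4 a6 P -> on_curve a4 a6 Q -> ec_add a4 P Q = ec_add a4 Q P.
Proof.
move=> hP hQ; case: (eqVneq P (ec_neg Q)) => [->|n].
  by rewrite ec_addNP ec_addPN.
move: P Q hP hQ n => [[x1 y1]|] [[x2 y2]|] hP hQ n //.
have [l [c [x3 [-> -> -> h]]]] := ec_add_col hP hQ n.
by rewrite (ec_add_of_col (col_swap h)).
Qed.

Lemma ec_negD P Q : on_curve a4 a6 P -> on_curve a4 a6 Q ->
  ec_neg (ec_add a4 P Q) = ec_add a4 (ec_neg P) (ec_neg Q).
Proof.
move=> hP hQ; case: (eqVneq P (ec_neg Q)) => [->|n].
  by rewrite ec_addNP ec_negK ec_addPN.
move: P Q hP hQ n => [[x1 y1]|] [[x2 y2]|] hP hQ n //.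
have [l [c [x3 [-> -> -> h]]]] := ec_add_col hP hQ n.
have := ec_add_of_col (col_neg h).
have E x : - l * x + - c = - (l * x + c) by ring.
by rewrite !E /= => ->.
Qed.

(** Reflecting the line through P, Q and -(P + Q) gives a line through -P, -Q and P + Q. This
    cancellation law settles the degenerate cases of associativity. *)
Lemma ec_addKl P Q : on_curve a4 a6 P -> on_curve a4 a6 Q ->
  ec_add a4 (ec_neg P) (ec_add a4 P Q) = Q.
Proof.
move=> hP hQ; case: (eqVneq P (ec_neg Q)) => [->|n].
  by rewrite ec_addNP ec_negK ec_addP0.
move: P Q hP hQ n => [[x1 y1]|] [[x2 y2]|] hP hQ n; rewrite ?ec_addP0 ?ec_addNP //.
have [l [c [x3 [-> -> -> h]]]] := ec_add_col hP hQ n.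
have := ec_add_of_col (col_neg (col_swap (col_rot (col_rot h)))).
have E x : - l * x + - c = - (l * x + c) by ring.
rewrite !E opprK /= => ->; by [].
Qed.

End Curve.

Lemma sub0E (V : zmodType) (x y : V) : x - y = 0 -> x = y.
Proof. by move/eqP; rewrite subr_eq0 => /eqP. Qed.

Section Assoc.
Variables a4 a6 : int.
Hypothesis disc0 : ec_disc a4 a6 != 0.
Let a : rat := a4%:~R.
Let b : rat := a6%:~R.
Local Notation "P '∔' Q" := (ec_add a4 P Q) (at level 50).
Local Notation on := (on_curve a4 a6).

Lemma col_double l c x1 x3 : col a b l c x1 x1 x3 -> 3 * x1 ^+ 2 + a = 2 * (l * x1 + c) * l.
Proof.
case=> e1 e2 _; apply: sub0E.
have -> : a = x1 * x1 + x1 * x3 + x1 * x3 + 2 * l * c by rewrite e2; ring.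
have -> : x3 = l ^+ 2 - x1 - x1 by rewrite -e1; ring.
ring.
Qed.

Lemma col_shift l c x1 x2 x4 : col a b l c x1 x2 x4 ->
  (x1 - x2) + (x4 - x2) = l ^+ 2 - 3 * x2 /\
  (x1 - x2) * (x4 - x2) = 3 * x2 ^+ 2 + a - 2 * (l * x2 + c) * l.
Proof.
case=> e1 e2 _; split; first by rewrite -e1; ring.
apply: sub0E.
have -> : a = x1 * x2 + x1 * x4 + x2 * x4 + 2 * l * c by rewrite e2; ring.
have -> : x4 = l ^+ 2 - x1 - x2 by rewrite -e1; ring.
ring.
Qed.

(** The middle point x2 lies on both lines. Translating abscissae by x2 reduces the claim to
    [assoc_slopes], or to its tangent version when the sum of the first two points has the abscissa
    of the third. *)
Lemma ec_assoc_gen l1 c1 l2 c2 x1 x2 x3 x4 x5 :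
  col a b l1 c1 x1 x2 x4 -> col a b l2 c2 x2 x3 x5 -> l1 * x2 + c1 = l2 * x2 + c2 ->
  Some (x4, - (l1 * x4 + c1)) != ec_neg (Some (x3, l2 * x3 + c2)) -> x5 != x1 ->
  Some (x4, - (l1 * x4 + c1)) ∔ Some (x3, l2 * x3 + c2) =
  Some (x1, l1 * x1 + c1) ∔ Some (x5, - (l2 * x5 + c2)).
Proof.
move=> k1 k2 h2 hS n51.
have on3 := col_on_curve (col_rot k2).
have on4 : on (Some (x4, - (l1 * x4 + c1))).
  rewrite on_curve_opp; exact: col_on_curve (col_rot (col_rot k1)).
have on1 := col_on_curve k1.
have on5 : on (Some (x5, - (l2 * x5 + c2))).
  rewrite on_curve_opp; exact: col_on_curve (col_rot (col_rot k2)).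
have [l3 [c3 [x6 [-> y4E y3E k3]]]] := ec_add_col on4 on3 hS.
have nW : Some (x1, l1 * x1 + c1) != ec_neg (Some (x5, - (l2 * x5 + c2))).
  by apply: contraNneq n51 => -[-> _].
have [l4 [c4 [x7 [-> y1E y5E k4]]]] := ec_add_col on1 on5 nW.
have [H1 H2] := col_shift k1; have [H3 H4] := col_shift (col_swap k2).
rewrite -h2 in H4.
set X1 := x1 - x2 in H1 H2; set X4 := x4 - x2 in H1 H2.
set X3 := x3 - x2 in H3 H4; set X5 := x5 - x2 in H3 H4.
set c := l1 * x2 + c1 in H2 H4 h2.
have n51' : X5 != X1 by rewrite /X5 /X1 (inj_eq (addIr _)).
have E3 : l3 * (X3 - X4) = 2 * c + l2 * X3 + l1 * X4.
  have -> : l3 * (X3 - X4) = (l3 * x3 + c3) - (l3 * x4 + c3) by rewrite /X3 /X4; ring.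
  rewrite -y3E -y4E.
  have -> : 2 * c = (l1 * x2 + c1) + (l2 * x2 + c2) by rewrite -h2 /c; ring.
  by rewrite /X3 /X4; ring.
have E4 : l4 * (X5 - X1) = - (2 * c + l2 * X5 + l1 * X1).
  have -> : l4 * (X5 - X1) = (l4 * x5 + c4) - (l4 * x1 + c4) by rewrite /X5 /X1; ring.
  rewrite -y5E -y1E.
  have -> : 2 * c = (l1 * x2 + c1) + (l2 * x2 + c2) by rewrite -h2 /c; ring.
  by rewrite /X5 /X1; ring.
have [S1 S2] : l3 - l4 = l2 - l1 /\ l3 ^+ 2 - X3 - X4 = l4 ^+ 2 - X1 - X5.
  case: (eqVneq X3 X4) => [e|n34]; last exact: (assoc_slopes H1 H2 H3 H4 E3 E4 n34 n51').
  have ex : x3 = x4 by apply: (addIr (- x2)).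
  move: H1 H2 E3; rewrite -e subrr mulr0 => H1 H2 /esym E3.
  have [T1 T2] := assoc_slopes_tangent H1 H2 H3 H4 E3 E4 n51'.
  rewrite ex in y3E k3 hS.
  have D := col_double k3; rewrite -y4E in D.
  have y3y4 : l2 * x4 + c2 = - (l1 * x4 + c1) by rewrite y3E y4E.
  have Y : c + l2 * X3 = - (l1 * x4 + c1).
    by rewrite h2 -y3y4 /X3 ex; ring.
  have y40 : - (l1 * x4 + c1) != 0.
    apply: contra hS => /eqP y0; rewrite /= y3y4 y0; apply/eqP; congr (Some (_, _)); ring.
  have y420 : 2 * (- (l1 * x4 + c1)) != 0 by rewrite mulf_neq0.
  rewrite Y in T1.
  have L : l3 = l4 + l2 - l1.
    apply: (mulfI y420); rewrite -D T1 /X3 ex; ring.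
  by rewrite L; split; [ring|exact: T2].
(* This relation turns the abscissa of the triple sum into a polynomial in the slopes, after which
   the ordinates can be compared by ring identities. *)
have K : (l2 - l1) * (l1 - l4) = X5 - X4.
  have n0 : X5 - X1 != 0 by rewrite subr_eq0.
  apply: (mulIf n0).
  have -> : (l2 - l1) * (l1 - l4) * (X5 - X1) = (l2 - l1) * (l1 * (X5 - X1) - l4 * (X5 - X1)) by ring.
  rewrite E4.
  have -> : (l2 - l1) * (l1 * (X5 - X1) - - (2 * c + l2 * X5 + l1 * X1)) =
    2 * c * (l2 - l1) + (l2 ^+ 2 - l1 ^+ 2) * X5 by ring.
  have -> : 2 * c * (l2 - l1) = X1 * X4 - X3 * X5 by rewrite H2 H4; ring.
  have -> : l2 ^+ 2 - l1 ^+ 2 = (X3 + X5) - (X1 + X4) by rewrite H3 H1; ring.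
  ring.
have X7E : x7 - x2 = (l1 - l4) * ((l1 - l4) - l1 - l2).
  have -> : (l1 - l4) * ((l1 - l4) - l1 - l2) = l4 ^+ 2 - l1 ^+ 2 - (l2 - l1) * (l1 - l4) by ring.
  case: k4 => <- _ _; rewrite K.
  have -> : l1 ^+ 2 = X1 + X4 + 3 * x2 by rewrite H1; ring.
  by rewrite /X1 /X4 /X5; ring.
have x67 : x6 = x7.
  case: k3 => F1 _ _; case: k4 => F2 _ _.
  have -> : x6 = (l3 ^+ 2 - X3 - X4) - 2 * x2 by rewrite -F1 /X3 /X4; ring.
  by rewrite S2 -F2 /X1 /X5; ring.
rewrite x67; congr (Some (_, - _)).
have C3 : c3 = l2 * x3 + c2 - l3 * x3 by rewrite y3E; ring.
have C4 : c4 = l1 * x1 + c1 - l4 * x1 by rewrite y1E; ring.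
apply: sub0E; rewrite C3 C4.
have L3 : l3 = l4 + l2 - l1 by rewrite -(subrK l4 l3) S1; ring.
have -> : c2 = l1 * x2 + c1 - l2 * x2 by rewrite -/c h2; ring.
have -> : x7 = x2 + (l1 - l4) * ((l1 - l4) - l1 - l2) by rewrite -X7E; ring.
rewrite L3.
have E2 : l2 ^+ 2 - l1 ^+ 2 = (X3 + X5) - (X1 + X4) by rewrite H3 H1; ring.
transitivity ((l1 - l4) * ((l2 - l1) * (l1 - l4) - (l2 ^+ 2 - l1 ^+ 2) + (x3 - x1))); first by ring.
by rewrite K E2 /X1 /X3 /X4 /X5; ring.
Qed.

(** Here the middle point Q has order 2 and the claim reads 2 (P + Q) = 2 P. It is the configuration
    that the generic argument misses from both sides. *)
Lemma ec_assoc_special l1 c1 x1 x2 x4 :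
  col a b l1 c1 x1 x2 x4 -> l1 * x2 + c1 = 0 ->
  Some (x4, - (l1 * x4 + c1)) != ec_neg (Some (x4, - (l1 * x4 + c1))) ->
  Some (x1, l1 * x1 + c1) != ec_neg (Some (x1, l1 * x1 + c1)) ->
  Some (x4, - (l1 * x4 + c1)) ∔ Some (x4, - (l1 * x4 + c1)) =
  Some (x1, l1 * x1 + c1) ∔ Some (x1, l1 * x1 + c1).
Proof.
move=> k1 y20 nR nP.
have on4 : on (Some (x4, - (l1 * x4 + c1))).
  rewrite on_curve_opp; exact: col_on_curve (col_rot (col_rot k1)).
have on1 := col_on_curve k1.
have [l3 [c3 [x6 [-> y4E _ k3]]]] := ec_add_col on4 on4 nR.
have [l4 [c4 [x7 [-> y1E _ k4]]]] := ec_add_col on1 on1 nP.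
have [H1 H2] := col_shift k1; rewrite y20 mulr0 mul0r subr0 in H2.
have D3 := col_double k3; have D4 := col_double k4; rewrite -y4E in D3; rewrite -y1E in D4.
have C1 : c1 = - l1 * x2 by apply: sub0E; rewrite -y20; ring.
set X1 := x1 - x2 in H1 H2; set X4 := x4 - x2 in H1 H2.
have Y1 : l1 * x1 + c1 = l1 * X1 by rewrite C1 /X1; ring.
have Y4 : l1 * x4 + c1 = l1 * X4 by rewrite C1 /X4; ring.
rewrite Y1 in D4 y1E nP; rewrite Y4 in D3 y4E nR.
have n1 : l1 * X1 != 0.
  by apply: contra nP => /eqP e; rewrite /= e oppr0.
have n4 : l1 * X4 != 0.
  by apply: contra nR => /eqP e; rewrite /= e !oppr0.
have l10 : l1 != 0 by apply: contra n1 => /eqP->; rewrite mul0r.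
have X10 : X1 != 0 by apply: contra n1 => /eqP->; rewrite mulr0.
have X40 : X4 != 0 by apply: contra n4 => /eqP->; rewrite mulr0.
have L : l1 ^+ 2 = X1 + X4 + 3 * x2 by rewrite H1; ring.
have Ea : a = X1 * X4 - 3 * x2 ^+ 2 by rewrite H2; ring.
have E4 : 2 * l1 * (l4 - l1) = X1 - X4.
  apply: (mulIf X10); have -> : 2 * l1 * (l4 - l1) * X1 = 2 * (l1 * X1) * l4 - 2 * l1 ^+ 2 * X1 by ring.
  by rewrite -D4 Ea L /X1; ring.
have E3 : 2 * l1 * (l3 + l1) = X1 - X4.
  apply: (mulIf X40).
  have -> : 2 * l1 * (l3 + l1) * X4 = 2 * l1 ^+ 2 * X4 - 2 * (- (l1 * X4)) * l3 by ring.
  by rewrite -D3 Ea L /X4; ring.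
have n2l : 2 * l1 != 0 by rewrite mulf_neq0.
have L3 : l3 = l4 - 2 * l1.
  by apply: sub0E; apply: (mulfI n2l); rewrite mulr0 -(subrr (X1 - X4)) -{1}E3 -E4; ring.
have x67 : x6 = x7.
  case: k3 => F1 _ _; case: k4 => F2 _ _.
  have -> : x6 = l3 ^+ 2 - 2 * x4 by rewrite -F1; ring.
  have -> : x7 = l4 ^+ 2 - 2 * x1 by rewrite -F2; ring.
  apply: sub0E; rewrite L3.
  transitivity (2 * (x1 - x4) - 2 * (2 * l1 * (l4 - l1))); first by ring.
  by rewrite E4 /X1 /X4; ring.
rewrite x67; congr (Some (_, - _)).
have C3 : c3 = - (l1 * X4) - l3 * x4 by rewrite y4E; ring.
have C4 : c4 = l1 * X1 - l4 * x1 by rewrite y1E; ring.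
apply: sub0E; rewrite C3 C4 L3.
have -> : x7 = l4 ^+ 2 - 2 * x1 by case: k4 => <- _ _; ring.
have X1E : X1 = X4 + 2 * l1 * (l4 - l1) by rewrite E4; ring.
have x1E : x1 = x4 + 2 * l1 * (l4 - l1) by rewrite E4 /X1 /X4; ring.
have Lx : l1 ^+ 2 = X1 + 2 * x2 + x4 by rewrite L /X4; ring.
have X4E : X4 = x4 - x2 by [].
have x2E : x2 = l1 ^+ 2 - x1 - x4 by rewrite L /X1 /X4; ring.
by rewrite X1E X4E x2E x1E; ring.
Qed.

Lemma ec_addA P Q R : on P -> on Q -> on R -> P ∔ (Q ∔ R) = (P ∔ Q) ∔ R.
Proof.
move=> hP hQ hR.
have C := ec_addC disc0; have N := on_curve_neg a4 a6.
case: (eqVneq P (ec_neg Q)) => [->|nPQ].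
  by rewrite ec_addNP (ec_addKl disc0).
have CR X Y : on X -> on Y -> (X ∔ Y) ∔ ec_neg Y = X.
  move=> hX hY; have onYX := ec_add_on hY hX; rewrite (C X Y hX hY) (C _ _ onYX) ?N //; exact: (ec_addKl disc0).
case: (eqVneq R (ec_neg Q)) => [->|nQR].
  by rewrite ec_addPN CR // ec_addP0.
move: P Q R hP hQ hR nPQ nQR => [[x1 y1]|] [[x2 y2]|] [[x3 y3]|] hP hQ hR nPQ nQR //; rewrite ?ec_addP0 //.
have nQR' : Some (x2, y2) != ec_neg (Some (x3, y3)).
  by apply: contra nQR => /eqP->; rewrite ec_negK.
have [l1 [c1 [x4 [S1 y1E y2E k1]]]] := ec_add_col hP hQ nPQ.
have [l2 [c2 [x5 [W1 y2E' y3E k2]]]] := ec_add_col hQ hR nQR'.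
have onS := ec_add_on hP hQ; have onW := ec_add_on hQ hR.
case: (eqVneq (Some (x1, y1) ∔ Some (x2, y2)) (ec_neg (Some (x3, y3)))) => [eS|nS].
  have eR : Some (x3, y3) = ec_neg (Some (x1, y1) ∔ Some (x2, y2)) by rewrite eS ec_negK.
  rewrite eS ec_addNP eR (ec_negD disc0) // (C (ec_neg _)) ?N //.
  have := ec_addKl disc0 (P := ec_neg (Some (x2, y2))) (Q := ec_neg (Some (x1, y1))).
  by rewrite ec_negK => ->; rewrite ?N // ec_addPN.
case: (eqVneq (Some (x2, y2) ∔ Some (x3, y3)) (ec_neg (Some (x1, y1)))) => [eW|nW].
  have eP : Some (x1, y1) = ec_neg (Some (x2, y2) ∔ Some (x3, y3)) by rewrite eW ec_negK.
  rewrite eW ec_addPN eP (ec_negD disc0) // (C (ec_neg (Some (x2, y2)))) ?N //.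
  rewrite -{2}(ec_negK (Some (x2, y2))) CR ?N //; exact: esym (ec_addNP _ _).
have y2E2 : l1 * x2 + c1 = l2 * x2 + c2 by rewrite -y2E -y2E'.
rewrite S1 W1; rewrite S1 in nS onS; rewrite W1 in nW onW.
rewrite y3E in nS hR W1 *; rewrite y1E in nW hP S1 *.
(* The generic lemma excludes x5 = x1, its mirror image excludes x3 = x4. If both equalities hold
   then R = P + Q and P = Q + R, which forces Q = -Q. *)
case: (eqVneq x5 x1) => [e51|n51]; last by rewrite (ec_assoc_gen k1 k2).
case: (eqVneq x3 x4) => [e34|n34]; last first.
  rewrite C // (C (Some (x4, _))) //.
  by rewrite -(ec_assoc_gen (col_swap k2) (col_swap k1) (esym y2E2) nW) // eq_sym.
have same u v v' : on (Some (u, v)) -> on (Some (u, v')) -> Some (u, v) != ec_neg (Some (u, v')) -> v = v'.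
  rewrite !on_curve_some => /eqP h1 /eqP h2 n; apply/eqP.
  have /eqP := etrans h1 (esym h2); rewrite eqf_sqr => /orP[//|/eqP e].
  by rewrite e /= eqxx in n.
subst x3 x5.
have e3 := same _ _ _ onS hR nS; have e1 := same _ _ _ onW hP nW.
rewrite e1 -e3; rewrite -e3 in nS W1; rewrite e1 in nW W1.
have y20 : y2 = - y2.
  have K1 : Some (x2, y2) = ec_neg (Some (x1, l1 * x1 + c1)) ∔ Some (x4, - (l1 * x4 + c1)).
    by rewrite -S1 (ec_addKl disc0).
  have K2 : Some (x4, - (l1 * x4 + c1)) = ec_neg (Some (x2, y2)) ∔ Some (x1, l1 * x1 + c1).
    by rewrite -W1 (ec_addKl disc0).
  move: K1; rewrite K2 (C (ec_neg (Some (x2, y2)))) ?N // (ec_addKl disc0) ?N //.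
  by case.
have y200 : l1 * x2 + c1 = 0.
  rewrite -y2E; have /eqP : 2 * y2 = 0 by rewrite [2 * _]mulr_natl mulr2n {1}y20 addNr.
  by rewrite mulf_eq0 => /orP[//|/eqP].
exact: esym (ec_assoc_special k1 y200 nS nW).
Qed.

(** The proof of nonsingularity is a parameter of the type, so that the group structure, which
    depends on it, can be attached to the type itself. *)
Definition ept (H : ec_disc a4 a6 != 0) : Type := {P : ecpt | on P}.
End Assoc.

(** * The group of rational points *)

HB.instance Definition _ a4 a6 H := [isSub of @ept a4 a6 H for @sval _ _].
HB.instance Definition _ a4 a6 H := [Choice of @ept a4 a6 H by <:].

Section Zmod.
Variables (a4 a6 : int) (H : ec_disc a4 a6 != 0).
Local Notation E := (@ept a4 a6 H).

Definition ept0 : E := exist _ None isT.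
Definition ept_opp (P : E) : E :=
  exist _ (ec_neg (val P)) (etrans (on_curve_neg a4 a6 _) (valP P)).
Definition ept_add (P Q : E) : E :=
  exist _ (ec_add a4 (val P) (val Q)) (ec_add_on (valP P) (valP Q)).

Lemma ept_addA : associative ept_add.
Proof. by move=> P Q R; apply: val_inj; apply: (ec_addA H); apply: valP. Qed.
Lemma ept_addC : commutative ept_add.
Proof. by move=> P Q; apply: val_inj; apply: (ec_addC H); apply: valP. Qed.
Lemma ept_add0 : left_id ept0 ept_add.
Proof. by move=> P; apply: val_inj. Qed.
Lemma ept_addN : left_inverse ept0 ept_opp ept_add.
Proof. by move=> P; apply: val_inj; apply: ec_addNP. Qed.

HB.instance Definition _ := GRing.isZmodule.Build E ept_addA ept_addC ept_add0 ept_addN.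

Lemma eptD (P Q : E) : val (P + Q) = ec_add a4 (val P) (val Q). Proof. by []. Qed.
Lemma eptN (P : E) : val (- P) = ec_neg (val P). Proof. by []. Qed.
Lemma eptMn (P : E) n : val (P *+ n) = ec_muln a4 n (val P).
Proof. by elim: n => [|n IH]; rewrite ?mulr0n // mulrS eptD IH. Qed.

Lemma eptMz (P : E) (n : int) : val (P *~ n) = ec_mulz a4 n (val P).
Proof. by case: n => n; rewrite /ec_mulz -eptMn // NegzE mulrNz. Qed.

Lemma ept_lincomb r (n : 'I_r -> int) (P : 'I_r -> E) :
  ec_lincomb a4 n (fun i => val (P i)) = val (\sum_i P i *~ n i).
Proof.
rewrite /ec_lincomb; apply: (big_rec2 (fun A (B : E) => A = val B)) => // i A B _ ->.
by rewrite eptD eptMz.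
Qed.
End Zmod.

(** * Ideal classes attached to points *)

Lemma pdvdzM (p : nat) (x y : int) : prime p -> (p%:Z %| x * y)%Z = (p%:Z %| x)%Z || (p%:Z %| y)%Z.
Proof. by move=> hp; rewrite !dvdzE abszM Euclid_dvdM. Qed.

Lemma pdvdzX (p : nat) (x : int) n : prime p -> (p%:Z %| x ^+ n.+1)%Z = (p%:Z %| x)%Z.
Proof. by move=> hp; rewrite !dvdzE abszX Euclid_dvdX // andbT. Qed.

Lemma pdvdz1 (p : nat) : prime p -> ~~ (p%:Z %| 1%R)%Z.
Proof. by move=> hp; rewrite dvdzE /= dvdn1; apply: contraTneq hp => ->. Qed.

Lemma coprimez_pP (x y : int) :
  reflect (forall p : nat, prime p -> (p%:Z %| x)%Z -> (p%:Z %| y)%Z -> False) (coprimez x y).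
Proof.
apply: (iffP idP) => [c p hp hx hy|h].
  by have := pdvdz1 hp; move/eqP: c => <-; rewrite dvdz_gcd hx hy.
rewrite /coprimez; case: (eqVneq (gcdz x y) 1) => // n.
have [g0|g0] := eqVneq (gcdz x y) 0.
  move/eqP: g0; rewrite gcdz_eq0 => /andP[/eqP x0 /eqP y0].
  by case: (h 2 isT); rewrite ?x0 ?y0 dvdz0.
have hg : (1 < `|gcdz x y|)%N.
  move: n g0; rewrite /gcdz /=; case: (gcdn _ _) => [|[|k]] //.
case: (h (pdiv `|gcdz x y|%N) (pdiv_prime hg)).
  by rewrite dvdzE (dvdn_trans (pdiv_dvd _)) // -dvdzE dvdz_gcdl.
by rewrite dvdzE (dvdn_trans (pdiv_dvd _)) // -dvdzE dvdz_gcdr.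
Qed.

Lemma bezout3 (x y z : int) :
  (forall p : nat, prime p -> (p%:Z %| x)%Z -> (p%:Z %| y)%Z -> (p%:Z %| z)%Z -> False) ->
  exists r s t : int, r * x + s * y + t * z = 1.
Proof.
move=> h; have c : coprimez (gcdz x y) z.
  by apply/coprimez_pP => p hp; rewrite dvdz_gcd => /andP[]; exact: h.
have [m [n E]] := Bezoutz (gcdz x y) z; have [s [t E']] := Bezoutz x y.
have e : gcdz (gcdz x y) z = 1%R := eqP c.
have e' : m * s * x + m * t * y + n * z = 1; last by exists (m * s), (m * t), n.
rewrite -[RHS]e -E -E'; ring.
Qed.

Lemma coprimez_mul_eq (x y s t : int) : coprimez x y -> s * x = t * y ->
  exists k, s = k * y /\ t = k * x.
Proof.
move=> c E; have : (y %| s * x)%Z by rewrite E dvdz_mull.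
rewrite Gauss_dvdzl; last by rewrite coprimez_sym.
case/dvdzP=> k sE.
have [y0|y0] := eqVneq y 0; last first.
  by exists k; split=> //; apply: (mulIf y0); rewrite -E sE; ring.
have /eqP hx : `|x|%N == 1%N by move: c; rewrite y0 /coprimez gcdz0.
have x2 : x * x = 1 by case: x hx {c sE E} => [] [|[|n]].
by exists (t * x); rewrite y0 sE y0 !mulr0 -mulrA x2 mulr1.
Qed.

(* the order Z[omega], omega^2 = -d, as pairs (s, t) = s + t omega *)
Definition zq (d : int) : Type := (int * int)%type.
Arguments zq d : simpl never.

Section Zq.
Variable d : int.
HB.instance Definition _ := Equality.on (zq d).
HB.instance Definition _ := Choice.on (zq d).
HB.instance Definition _ := GRing.Zmodule.copy (zq d) (int * int)%type.
Definition zq_mul (x y : zq d) : zq d := (x.1 * y.1 - d * (x.2 * y.2), x.1 * y.2 + x.2 * y.1).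
Definition zq_one : zq d := (1, 0).
Lemma zqD (x y : zq d) : x + y = (x.1 + y.1, x.2 + y.2). Proof. by []. Qed.
Fact zq_mulA : associative zq_mul.
Proof. by move=> [x1 x2] [y1 y2] [z1 z2]; rewrite /zq_mul /=; congr pair; ring. Qed.
Fact zq_mulC : commutative zq_mul.
Proof. by move=> [x1 x2] [y1 y2]; rewrite /zq_mul /=; congr pair; ring. Qed.
Fact zq_mul1 : left_id zq_one zq_mul.
Proof. by move=> [x1 x2]; rewrite /zq_mul /=; congr pair; ring. Qed.
Fact zq_mulDl : left_distributive zq_mul +%R.
Proof. by move=> [x1 x2] [y1 y2] [z1 z2]; rewrite /zq_mul !zqD /=; congr pair; ring. Qed.
Fact zq_1neq0 : zq_one != 0. Proof. by []. Qed.
HB.instance Definition _ := GRing.Zmodule_isComNzRing.Build (zq d) zq_mulA zq_mulC zq_mul1 zq_mulDl zq_1neq0.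

Definition om : zq d := (0, 1).
Lemma zqM (x y : zq d) : x * y = (x.1 * y.1 - d * (x.2 * y.2), x.1 * y.2 + x.2 * y.1). Proof. by []. Qed.
Lemma zqN (x : zq d) : - x = (- x.1, - x.2). Proof. by []. Qed.
Lemma zq_nat (n : nat) : n%:R = (n%:Z, 0) :> zq d.
Proof. elim: n => [//|n IH]; rewrite -addn1 natrD IH zqD /=; by rewrite PoszD. Qed.
Lemma zqz (n : int) : n%:~R = (n, 0) :> zq d.
Proof. by case: n => n; rewrite ?NegzE ?mulrNz -?pmulrn zq_nat ?zqN //= oppr0. Qed.
Lemma omK : om ^+ 2 = - d%:~R.
Proof. by rewrite expr2 zqM zqz zqN /=; congr pair; ring. Qed.

Lemma zq_intreg (m : int) (x y : zq d) : m != 0 -> m%:~R * x = m%:~R * y -> x = y.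
Proof.
move=> m0; rewrite zqz !zqM /= !mul0r !addr0 !mulr0 !subr0 => -[h1 h2].
by case: x y h1 h2 => [x1 x2] [y1 y2] /= /(mulfI m0)-> /(mulfI m0)->.
Qed.

Definition zqc (x : zq d) : zq d := (x.1, - x.2).
Definition nrm (x : zq d) : int := x.1 ^+ 2 + d * x.2 ^+ 2.
Lemma nrmE x : x * zqc x = (nrm x)%:~R.
Proof. by case: x => s t; rewrite zqz zqM /nrm /=; congr pair; ring. Qed.
Lemma nrmM x y : nrm (x * y) = nrm x * nrm y.
Proof. by case: x y => [x1 x2] [y1 y2]; rewrite zqM /nrm /=; ring. Qed.
Lemma zq_reg (z x y : zq d) : nrm z != 0 -> z * x = z * y -> x = y.
Proof.
move=> n0 E; apply: (zq_intreg n0); rewrite -nrmE.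
by rewrite ![z * zqc z]mulrC -!mulrA E.
Qed.
End Zq.

Lemma sub0E' (V : zmodType) (x y : V) : x - y = 0 -> x = y.
Proof. by move/eqP; rewrite subr_eq0 => /eqP. Qed.

(** * Products of lines evaluated at (-uv : omega : v^2) *)

Section LineProducts.
Variables (a b u v d : int).
Hypothesis dE : d = v * (u ^+ 3 + a * u * v ^+ 2 - b * v ^+ 3).
Local Notation O := (zq d).
Local Notation ic n := (intmul (1 : O) n).
Let X0 : O := ic (- (u * v)).
Let Y0 : O := om d.
Let Z0 : O := ic (v ^+ 2).

(* the ideal (v, omega), whose square is contained in (v) as v divides d *)
Definition inW (z : O) := exists x y : O, z = ic v * x + om d * y.

Lemma inWD x y : inW x -> inW y -> inW (x + y).
Proof. by move=> [x1 [x2 ->]] [y1 [y2 ->]]; exists (x1 + y1), (x2 + y2); ring. Qed.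
Lemma inWM x y : inW y -> inW (x * y).
Proof. by move=> [y1 [y2 ->]]; exists (x * y1), (x * y2); ring. Qed.
Lemma inWX : inW X0. Proof. by exists (- ic u), 0; rewrite /X0 rmorphN rmorphM /=; ring. Qed.
Lemma inWY : inW Y0. Proof. by exists 0, 1; rewrite /Y0; ring. Qed.
Lemma inWZ : inW Z0. Proof. by exists (ic v), 0; rewrite /Z0 rmorphXn /=; ring. Qed.
Lemma ic_d : ic d = ic v * ic (u ^+ 3 + a * u * v ^+ 2 - b * v ^+ 3).
Proof. by rewrite -intrM -dE. Qed.

Lemma inWW x y : inW x -> inW y -> exists w, x * y = ic v * w.
Proof.
move=> [x1 [x2 ->]] [y1 [y2 ->]].
exists (ic v * x1 * y1 + om d * x1 * y2 + om d * x2 * y1 - ic (u ^+ 3 + a * u * v ^+ 2 - b * v ^+ 3) * x2 * y2).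
have E : om d * om d = - ic v * ic (u ^+ 3 + a * u * v ^+ 2 - b * v ^+ 3).
  by rewrite -expr2 omK ic_d; ring.
transitivity (ic v * ic v * x1 * y1 + ic v * om d * (x1 * y2 + x2 * y1) + (om d * om d) * x2 * y2); first by ring.
by rewrite E; ring.
Qed.

Lemma base_on_curve : Y0 ^+ 2 * Z0 = X0 ^+ 3 + ic a * X0 * Z0 ^+ 2 + ic b * Z0 ^+ 3.
Proof.
by rewrite /Y0 omK ic_d /X0 /Z0 !(rmorphN, rmorphM, rmorphD, rmorphB, rmorphXn) /=; ring.
Qed.

(** In the expansion every term except the last contains l times a product of two elements of W =
    (v, omega), hence is divisible by v l; the last one, t1 t2 t3, is covered by the hypothesis. *)
Lemma inW_prod3 (l s1 s2 s3 m1 m2 m3 k1 k2 k3 t1 t2 t3 y : O) :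
  inW l -> inW t1 -> inW t2 -> inW t3 ->
  s1 = m1 * l + k1 * t1 -> s2 = m2 * l + k2 * t2 -> s3 = m3 * l + k3 * t3 ->
  t1 * t2 * t3 = l * (ic v * y) ->
  exists w, s1 * s2 * s3 = ic v * l * w.
Proof.
move=> Wl W1 W2 W3 -> -> -> E.
have [w1 E1] := inWW Wl Wl; have [w2 E2] := inWW Wl W1; have [w3 E3] := inWW Wl W2.
have [w4 E4] := inWW Wl W3; have [w5 E5] := inWW W1 W2; have [w6 E6] := inWW W1 W3.
have [w7 E7] := inWW W2 W3.
exists (m1 * m2 * m3 * w1 + m1 * m2 * k3 * w4 + m1 * m3 * k2 * w3 + m2 * m3 * k1 * w2
  + m1 * k2 * k3 * w7 + m2 * k1 * k3 * w6 + m3 * k1 * k2 * w5 + k1 * k2 * k3 * y).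
transitivity (l * (m1 * m2 * m3 * (l * l) + m1 * m2 * k3 * (l * t3) + m1 * m3 * k2 * (l * t2) + m2 * m3 * k1 * (l * t1)
  + m1 * k2 * k3 * (t2 * t3) + m2 * k1 * k3 * (t1 * t3) + m3 * k1 * k2 * (t1 * t2)) + k1 * k2 * k3 * (t1 * t2 * t3)); first by ring.
by rewrite E E1 E2 E3 E4 E5 E6 E7; ring.
Qed.

Section Line.
Variables (A1 A2 A3 B1 B2 B3 C1 C2 C3 l n : int).
Let m := C1 * C2 * C3.
Hypothesis m0 : m != 0.
Hypothesis (cA1 : coprimez A1 C1) (cA2 : coprimez A2 C2) (cA3 : coprimez A3 C3).
Hypothesis (cB1 : coprimez B1 C1) (cB2 : coprimez B2 C2) (cB3 : coprimez B3 C3).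
Hypothesis L1 : l * (A1 * C1) + m * B1 + n * C1 ^+ 3 = 0.
Hypothesis L2 : l * (A2 * C2) + m * B2 + n * C2 ^+ 3 = 0.
Hypothesis L3 : l * (A3 * C3) + m * B3 + n * C3 ^+ 3 = 0.
Hypothesis R1 : l ^+ 2 = A1 * (C2 * C3) ^+ 2 + A2 * (C1 * C3) ^+ 2 + A3 * (C1 * C2) ^+ 2.
Hypothesis R2 : a * m ^+ 2 - 2 * l * n = A1 * A2 * C3 ^+ 2 + A1 * A3 * C2 ^+ 2 + A2 * A3 * C1 ^+ 2.
Hypothesis R3 : n ^+ 2 = b * m ^+ 2 + A1 * A2 * A3.

Definition line_val (l m n : int) : O := ic l * X0 + ic m * Y0 + ic n * Z0.

Lemma inW_line l' m' n' : inW (line_val l' m' n').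
Proof. by do ?apply: inWD; apply: inWM; [exact: inWX|exact: inWY|exact: inWZ]. Qed.

Let C10 : C1 != 0. Proof. by move: m0; rewrite /m !mulf_eq0 !negb_or -andbA => /and3P[]. Qed.
Let C20 : C2 != 0. Proof. by move: m0; rewrite /m !mulf_eq0 !negb_or -andbA => /and3P[]. Qed.
Let C30 : C3 != 0. Proof. by move: m0; rewrite /m !mulf_eq0 !negb_or -andbA => /and3P[]. Qed.

(* elimination of Y, X, Z respectively between the line and a line through a point *)
Lemma elimY A B C l' m' n' : C != 0 -> coprimez A C -> l * (A * C) + m * B + n * C ^+ 3 = 0 ->
  l' * (A * C) + m' * B + n' * C ^+ 3 = 0 ->
  exists k, ic m * line_val l' m' n' = ic m' * line_val l m n + ic k * (ic (C ^+ 2) * X0 - ic A * Z0).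
Proof.
move=> C0 cA E E'.
have K : (m * l' - m' * l) * A = (- (m * n' - m' * n)) * C ^+ 2.
  apply: (mulIf C0); apply/eqP; rewrite -subr_eq0; apply/eqP.
  transitivity (m * (l' * (A * C) + m' * B + n' * C ^+ 3) - m' * (l * (A * C) + m * B + n * C ^+ 3)); first by ring.
  by rewrite E E' !mulr0 subr0.
have cA2' : coprimez A (C ^+ 2) by rewrite coprimezXr.
have [k [k1 k2]] := coprimez_mul_eq cA2' K.
exists k; rewrite /line_val.
have -> : ic k * (ic (C ^+ 2) * X0 - ic A * Z0) = ic (k * C ^+ 2) * X0 + ic (- (k * A)) * Z0.
  by rewrite !(rmorphN, rmorphM) /=; ring.
rewrite -k1 -k2 opprK !(rmorphB, rmorphM) /=; ring.
Qed.

Lemma elimX A B C l' m' n' : C != 0 -> coprimez B C -> l * (A * C) + m * B + n * C ^+ 3 = 0 ->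
  l' * (A * C) + m' * B + n' * C ^+ 3 = 0 ->
  exists k, ic l * line_val l' m' n' = ic l' * line_val l m n + ic k * (ic (C ^+ 3) * Y0 - ic B * Z0).
Proof.
move=> C0 cB E E'.
have K : (l * m' - l' * m) * B = (- (l * n' - l' * n)) * C ^+ 3.
  apply/eqP; rewrite -subr_eq0; apply/eqP.
  transitivity (l * (l' * (A * C) + m' * B + n' * C ^+ 3) - l' * (l * (A * C) + m * B + n * C ^+ 3)); first by ring.
  by rewrite E E' !mulr0 subr0.
have cB2' : coprimez B (C ^+ 3) by rewrite coprimezXr.
have [k [k1 k2]] := coprimez_mul_eq cB2' K.
exists k; rewrite /line_val.
have -> : ic k * (ic (C ^+ 3) * Y0 - ic B * Z0) = ic (k * C ^+ 3) * Y0 + ic (- (k * B)) * Z0.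
  by rewrite !(rmorphN, rmorphM) /=; ring.
rewrite -k1 -k2 opprK !(rmorphB, rmorphM) /=; ring.
Qed.

Lemma elimZ A B C l' m' n' : C != 0 -> coprimez B C -> (C %| m)%Z ->
  l * (A * C) + m * B + n * C ^+ 3 = 0 ->
  l' * (A * C) + m' * B + n' * C ^+ 3 = 0 ->
  exists k, ic (A * n) * line_val l' m' n' = ic (A * n') * line_val l m n + ic k * (ic B * X0 - ic (A * C) * Y0).
Proof.
move=> C0 cB Cm E E'.
have Cm' : (C %| m')%Z.
  have : (C %| m' * B)%Z.
    have -> : m' * B = - ((l' * A + n' * C ^+ 2) * C).
      by apply/eqP; rewrite -subr_eq0; apply/eqP; rewrite -E'; ring.
    by rewrite rpredN dvdz_mull.
  by rewrite Gauss_dvdzl // coprimez_sym.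
have /dvdzP[k kE] : (C %| n * m' - n' * m)%Z by rewrite rpredB // dvdz_mull.
have kE2 : A * (n * l' - n' * l) = - (k * B).
  apply: (mulIf C0); apply/eqP; rewrite -subr_eq0; apply/eqP.
  transitivity (n * (l' * (A * C) + m' * B + n' * C ^+ 3) - n' * (l * (A * C) + m * B + n * C ^+ 3)
     - (n * m' - n' * m - k * C) * B); first by ring.
  by rewrite E E' kE !mulr0 !subrr mul0r subr0.
exists (- k); rewrite /line_val.
have -> : ic (- k) * (ic B * X0 - ic (A * C) * Y0) = ic (- (k * B)) * X0 + ic (A * (k * C)) * Y0.
  by rewrite !(rmorphN, rmorphM) /=; ring.
rewrite -kE2 -kE !(rmorphB, rmorphM) /=; ring.
Qed.

Let lq := line_val l m n.

(** The product of the x - x_i is the cubic minus the square of the line, and this difference splits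
    into the line and its reflection in the x-axis; the statement is the homogeneous form of that
    factorisation. *)
Lemma prod_elimY :
  (ic (C1 ^+ 2) * X0 - ic A1 * Z0) * (ic (C2 ^+ 2) * X0 - ic A2 * Z0) * (ic (C3 ^+ 2) * X0 - ic A3 * Z0) =
  lq * (Z0 * line_val (- l) m (- n)).
Proof.
have E : line_val l m n * (Z0 * line_val (- l) m (- n)) = Z0 * Y0 ^+ 2 * ic (m ^+ 2) -
  Z0 * (ic (l ^+ 2) * X0 ^+ 2 + ic (2 * l * n) * X0 * Z0 + ic (n ^+ 2) * Z0 ^+ 2).
  by rewrite /line_val !(rmorphN, rmorphM, rmorphXn) /=; ring.
rewrite /lq E [Z0 * Y0 ^+ 2]mulrC base_on_curve.
have -> : 2 * l * n = a * m ^+ 2 - (A1 * A2 * C3 ^+ 2 + A1 * A3 * C2 ^+ 2 + A2 * A3 * C1 ^+ 2).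
  by rewrite -R2; ring.
rewrite R1 R3 /m !(rmorphN, rmorphM, rmorphXn, rmorphD, rmorphB) /=; ring.
Qed.

Lemma prod_elimX :
  (ic (C1 ^+ 3) * Y0 - ic B1 * Z0) * (ic (C2 ^+ 3) * Y0 - ic B2 * Z0) * (ic (C3 ^+ 3) * Y0 - ic B3 * Z0) =
  lq * ((ic m * Y0 + ic n * Z0) ^+ 2 - (ic m * Y0 + ic n * Z0) * (ic l * X0) + (ic l * X0) ^+ 2
        + ic (a * l ^+ 2) * Z0 ^+ 2).
Proof.
have m30 : m ^+ 3 != 0 by rewrite expf_neq0.
(* After multiplication by m^3 the equations of the line eliminate the B_i. Only the symmetric
   functions of the A_i / C_i^2 remain, and [R1], [R2], [R3] give their values. *)
apply: (zq_intreg m30).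
pose T := ic m * Y0 + ic n * Z0.
have F A B C : l * (A * C) + m * B + n * C ^+ 3 = 0 ->
    ic m * (ic (C ^+ 3) * Y0 - ic B * Z0) = ic C * (ic (C ^+ 2) * T + ic (l * A) * Z0).
  move=> E; have mB : m * B = - (l * (A * C) + n * C ^+ 3).
    by apply/eqP; rewrite -subr_eq0; apply/eqP; rewrite -E; ring.
  transitivity (ic (C ^+ 3) * (ic m * Y0) - ic (m * B) * Z0); first by rewrite [ic (m * B)]rmorphM /=; ring.
  by rewrite mB /T !(rmorphN, rmorphM, rmorphXn, rmorphD, rmorphB) /=; ring.
transitivity ((ic m * (ic (C1 ^+ 3) * Y0 - ic B1 * Z0)) * (ic m * (ic (C2 ^+ 3) * Y0 - ic B2 * Z0)) *
   (ic m * (ic (C3 ^+ 3) * Y0 - ic B3 * Z0))); first by rewrite rmorphXn /=; ring.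
rewrite (F _ _ _ L1) (F _ _ _ L2) (F _ _ _ L3).
transitivity (ic m * (ic (m ^+ 2) * T ^+ 3 + ic (l * l ^+ 2) * T ^+ 2 * Z0 +
   ic (l ^+ 2 * (a * m ^+ 2 - 2 * l * n)) * T * Z0 ^+ 2 + ic (l ^+ 3 * (n ^+ 2 - b * m ^+ 2)) * Z0 ^+ 3)).
  have -> : n ^+ 2 - b * m ^+ 2 = A1 * A2 * A3 by rewrite R3; ring.
  rewrite R2 (_ : l * l ^+ 2 = l * (A1 * (C2 * C3) ^+ 2 + A2 * (C1 * C3) ^+ 2 + A3 * (C1 * C2) ^+ 2)); last by rewrite R1.
  by rewrite /m !(rmorphN, rmorphM, rmorphXn, rmorphD, rmorphB) /=; ring.
have E : T ^+ 2 - 2 * ic n * Z0 * T + ic (n ^+ 2) * Z0 ^+ 2 = ic (m ^+ 2) * Y0 ^+ 2.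
  by rewrite /T !rmorphXn /=; ring.
have G : Z0 * (T ^+ 2 - 2 * ic n * Z0 * T + ic (n ^+ 2) * Z0 ^+ 2) =
  ic (m ^+ 2) * (X0 ^+ 3 + ic a * X0 * Z0 ^+ 2 + ic b * Z0 ^+ 3).
  by rewrite E -base_on_curve; ring.
have -> : lq = T + ic l * X0 by rewrite /lq /line_val /T; ring.
rewrite -/T.
apply: sub0E'.
transitivity (ic (m * l ^+ 3) * (Z0 * (T ^+ 2 - 2 * ic n * Z0 * T + ic (n ^+ 2) * Z0 ^+ 2) -
  ic (m ^+ 2) * (X0 ^+ 3 + ic a * X0 * Z0 ^+ 2 + ic b * Z0 ^+ 3))).
  by rewrite !(rmorphN, rmorphM, rmorphXn, rmorphD, rmorphB) /=; ring.
by rewrite G subrr mulr0.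
Qed.

Lemma prod_elimZ :
  (ic B1 * X0 - ic (A1 * C1) * Y0) * (ic B2 * X0 - ic (A2 * C2) * Y0) * (ic B3 * X0 - ic (A3 * C3) * Y0) =
  lq * (- ic (n ^+ 2) * Y0 ^+ 2 - ic (a * n) * X0 * (ic m * Y0 + ic l * X0 - ic n * Z0)
     + ic b * ((ic m * Y0 + ic l * X0) ^+ 2 - (ic m * Y0 + ic l * X0) * (ic n * Z0) + (ic n * Z0) ^+ 2)).
Proof.
have m30 : m ^+ 3 != 0 by rewrite expf_neq0.
apply: (zq_intreg m30).
pose T := ic m * Y0 + ic l * X0.
have F A B C : l * (A * C) + m * B + n * C ^+ 3 = 0 ->
    ic m * (ic B * X0 - ic (A * C) * Y0) = - ic C * (ic (n * C ^+ 2) * X0 + ic A * T).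
  move=> E; have mB : m * B = - (l * (A * C) + n * C ^+ 3).
    by apply/eqP; rewrite -subr_eq0; apply/eqP; rewrite -E; ring.
  transitivity (ic (m * B) * X0 - ic (A * C) * (ic m * Y0)); first by rewrite [ic (m * B)]rmorphM /=; ring.
  by rewrite mB /T !(rmorphN, rmorphM, rmorphXn, rmorphD, rmorphB) /=; ring.
transitivity ((ic m * (ic B1 * X0 - ic (A1 * C1) * Y0)) * (ic m * (ic B2 * X0 - ic (A2 * C2) * Y0)) *
   (ic m * (ic B3 * X0 - ic (A3 * C3) * Y0))); first by rewrite rmorphXn /=; ring.
rewrite (F _ _ _ L1) (F _ _ _ L2) (F _ _ _ L3).
transitivity (- ic m * (ic (m ^+ 2 * n ^+ 3) * X0 ^+ 3 + ic (n ^+ 2 * l ^+ 2) * X0 ^+ 2 * T +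
   ic (n * (a * m ^+ 2 - 2 * l * n)) * X0 * T ^+ 2 + ic (n ^+ 2 - b * m ^+ 2) * T ^+ 3)).
  have -> : n ^+ 2 - b * m ^+ 2 = A1 * A2 * A3 by rewrite R3; ring.
  by rewrite R1 R2 /m !(rmorphN, rmorphM, rmorphXn, rmorphD, rmorphB) /=; ring.
have E : T ^+ 2 - 2 * ic l * X0 * T + ic (l ^+ 2) * X0 ^+ 2 = ic (m ^+ 2) * Y0 ^+ 2.
  by rewrite /T !rmorphXn /=; ring.
have G : Z0 * (T ^+ 2 - 2 * ic l * X0 * T + ic (l ^+ 2) * X0 ^+ 2) =
  ic (m ^+ 2) * (X0 ^+ 3 + ic a * X0 * Z0 ^+ 2 + ic b * Z0 ^+ 3).
  by rewrite E -base_on_curve; ring.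
have -> : lq = T + ic n * Z0 by rewrite /lq /line_val /T; ring.
rewrite -/T.
apply: sub0E'.
transitivity (- ic (n ^+ 2 * m) * (T + ic n * Z0) * ((T ^+ 2 - 2 * ic l * X0 * T + ic (l ^+ 2) * X0 ^+ 2) - ic (m ^+ 2) * Y0 ^+ 2)
  + ic (m * n ^+ 3) * (Z0 * (T ^+ 2 - 2 * ic l * X0 * T + ic (l ^+ 2) * X0 ^+ 2) -
  ic (m ^+ 2) * (X0 ^+ 3 + ic a * X0 * Z0 ^+ 2 + ic b * Z0 ^+ 3))).
  by rewrite !(rmorphN, rmorphM, rmorphXn, rmorphD, rmorphB) /=; ring.
by rewrite G E !subrr !mulr0 addr0.
Qed.

(** For such a p the homogenised symmetric functions of the A_i / C_i^2 all vanish mod p, while p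
    divides some C_i and never divides A_i and C_i together. So the factors m^3, l^3 and A1 A2 A3
    n^3 lost in the three eliminations have no common prime. *)
Lemma line_common_prime (p : nat) : prime p -> (p%:Z %| l)%Z -> (p%:Z %| m)%Z ->
  (p%:Z %| n * (A1 * A2 * A3))%Z -> False.
Proof.
move=> hp hl hm hn.
have h1 : (p%:Z %| A1 * (C2 * C3) ^+ 2 + A2 * (C1 * C3) ^+ 2 + A3 * (C1 * C2) ^+ 2)%Z.
  by rewrite -R1 expr2 dvdz_mull.
have h2 : (p%:Z %| A1 * A2 * C3 ^+ 2 + A1 * A3 * C2 ^+ 2 + A2 * A3 * C1 ^+ 2)%Z.
  by rewrite -R2; apply: rpredB; [rewrite expr2 mulrA dvdz_mull|rewrite dvdz_mulr // dvdz_mull].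
have h3 : (p%:Z %| A1 * A2 * A3)%Z.
  move: hn; rewrite pdvdzM // => /orP[hn|//].
  have -> : A1 * A2 * A3 = n ^+ 2 - b * m ^+ 2 by rewrite R3; ring.
  by apply: rpredB; [rewrite expr2 dvdz_mull|rewrite expr2 mulrA dvdz_mull].
have cop A C : coprimez A C -> ~~ ((p%:Z %| A)%Z && (p%:Z %| C)%Z).
  by move=> c; apply/negP => /andP[hA hC]; exact: (elimT (coprimez_pP A C) c p hp hA hC).
have d3 x y z : (p%:Z %| x + y + z)%Z ->
    [&& (p%:Z %| x)%Z && (p%:Z %| y)%Z ==> (p%:Z %| z)%Z,
        (p%:Z %| x)%Z && (p%:Z %| z)%Z ==> (p%:Z %| y)%Z &
        (p%:Z %| y)%Z && (p%:Z %| z)%Z ==> (p%:Z %| x)%Z].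
  move=> h; apply/and3P; split; apply/implyP => /andP[h4 h5].
  - by move: h; rewrite rpredDl // rpredD.
  - by move: h; rewrite rpredDr // rpredDl.
  - by move: h; rewrite rpredDr // rpredDr.
move: (cop _ _ cA1) (cop _ _ cA2) (cop _ _ cA3) (d3 _ _ _ h1) (d3 _ _ _ h2) h3 hm.
rewrite /m !(pdvdzM, pdvdzX) //.
by do 6!case: (_ %| _)%Z.
Qed.

(** If I_i is the ideal generated by the values of the lines through the i-th point, this is the
    inclusion of I_1 I_2 I_3 in (v lq), where lq comes from the line through all three points. Each
    elimination proves it up to a factor m^3, l^3 or A1 A2 A3 n^3, and a Bezout relation removes the
    factors. *)
Theorem line_products l1 m1 n1 l2 m2 n2 l3 m3 n3 :
  l1 * (A1 * C1) + m1 * B1 + n1 * C1 ^+ 3 = 0 ->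
  l2 * (A2 * C2) + m2 * B2 + n2 * C2 ^+ 3 = 0 ->
  l3 * (A3 * C3) + m3 * B3 + n3 * C3 ^+ 3 = 0 ->
  exists w, line_val l1 m1 n1 * line_val l2 m2 n2 * line_val l3 m3 n3 = ic v * lq * w.
Proof.
move=> E1 E2 E3.
have [r [s [t E]]] : exists r s t, r * m ^+ 3 + s * l ^+ 3 + t * ((A1 * n) * (A2 * n) * (A3 * n)) = 1.
  apply: bezout3 => p hp; rewrite !pdvdzX // => hm hl hn.
  apply: (line_common_prime hp hl hm); move: hn; rewrite !pdvdzM //.
  by do 4!case: (_ %| _)%Z => //.
have [w1 W1] : exists w, (ic m * line_val l1 m1 n1) * (ic m * line_val l2 m2 n2) * (ic m * line_val l3 m3 n3) = ic v * lq * w.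
  have [k1 K1] := elimY C10 cA1 L1 E1; have [k2 K2] := elimY C20 cA2 L2 E2.
  have [k3 K3] := elimY C30 cA3 L3 E3.
  apply: (inW_prod3 (y := ic v * line_val (- l) m (- n)) _ _ _ _ K1 K2 K3).
  - exact: inW_line.
  - by rewrite -mulNr; apply: inWD; apply: inWM; [exact: inWX|exact: inWZ].
  - by rewrite -mulNr; apply: inWD; apply: inWM; [exact: inWX|exact: inWZ].
  - by rewrite -mulNr; apply: inWD; apply: inWM; [exact: inWX|exact: inWZ].
  - by rewrite prod_elimY /Z0 -/lq; congr (_ * _); rewrite rmorphXn /=; ring.
have [w2 W2] : exists w, (ic l * line_val l1 m1 n1) * (ic l * line_val l2 m2 n2) * (ic l * line_val l3 m3 n3) = ic v * lq * w.
  have [k1 K1] := elimX C10 cB1 L1 E1; have [k2 K2] := elimX C20 cB2 L2 E2.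
  have [k3 K3] := elimX C30 cB3 L3 E3.
  have WT : inW (ic m * Y0 + ic n * Z0) by apply: inWD; apply: inWM; [exact: inWY|exact: inWZ].
  have WS : inW (ic l * X0) by apply: inWM; exact: inWX.
  have [y1 Y1] := inWW WT WT; have [y2 Y2] := inWW WT WS; have [y3 Y3] := inWW WS WS.
  have [y4 Y4] := inWW inWZ inWZ.
  apply: (inW_prod3 (y := y1 - y2 + y3 + ic (a * l ^+ 2) * y4) _ _ _ _ K1 K2 K3).
  - exact: inW_line.
  - by rewrite -mulNr; apply: inWD; apply: inWM; [exact: inWY|exact: inWZ].
  - by rewrite -mulNr; apply: inWD; apply: inWM; [exact: inWY|exact: inWZ].
  - by rewrite -mulNr; apply: inWD; apply: inWM; [exact: inWY|exact: inWZ].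
  - by rewrite prod_elimX -/lq; congr (_ * _); rewrite !expr2 Y1 Y2 Y3 Y4; ring.
have [w3 W3] : exists w, (ic (A1 * n) * line_val l1 m1 n1) * (ic (A2 * n) * line_val l2 m2 n2) * (ic (A3 * n) * line_val l3 m3 n3) = ic v * lq * w.
  have [k1 K1] := elimZ C10 cB1 (dvdz_mulr _ (dvdz_mulr _ (dvdzz _))) L1 E1.
  have [k2 K2] := elimZ C20 cB2 (dvdz_mulr _ (dvdz_mull _ (dvdzz _))) L2 E2.
  have [k3 K3] := elimZ C30 cB3 (dvdz_mull _ (dvdzz _)) L3 E3.
  have WT : inW (ic m * Y0 + ic l * X0) by apply: inWD; apply: inWM; [exact: inWY|exact: inWX].
  have WS : inW (ic n * Z0) by apply: inWM; exact: inWZ.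
  have [y1 Y1] := inWW WT WT; have [y2 Y2] := inWW WT WS; have [y3 Y3] := inWW WS WS.
  have [y4 Y4] := inWW inWY inWY; have [y5 Y5] := inWW inWX WT; have [y6 Y6] := inWW inWX WS.
  apply: (inW_prod3 (y := - ic (n ^+ 2) * y4 - ic (a * n) * (y5 - y6) + ic b * (y1 - y2 + y3)) _ _ _ _ K1 K2 K3).
  - exact: inW_line.
  - by rewrite -mulNr; apply: inWD; apply: inWM; [exact: inWX|exact: inWY].
  - by rewrite -mulNr; apply: inWD; apply: inWM; [exact: inWX|exact: inWY].
  - by rewrite -mulNr; apply: inWD; apply: inWM; [exact: inWX|exact: inWY].
  - rewrite prod_elimZ -/lq; congr (_ * _); rewrite !expr2 Y1 Y2 Y3 Y4.
    rewrite -[ic (a * n) * X0 * _]mulrA mulrBr Y5 Y6; ring.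
exists (ic r * w1 + ic s * w2 + ic t * w3).
transitivity (ic (r * m ^+ 3 + s * l ^+ 3 + t * ((A1 * n) * (A2 * n) * (A3 * n))) *
  (line_val l1 m1 n1 * line_val l2 m2 n2 * line_val l3 m3 n3)); first by rewrite E mul1r.
set P1 := line_val l1 m1 n1 in W1 W2 W3 *; set P2 := line_val l2 m2 n2 in W1 W2 W3 *.
set P3 := line_val l3 m3 n3 in W1 W2 W3 *.
transitivity (ic r * (ic m * P1 * (ic m * P2) * (ic m * P3)) + ic s * (ic l * P1 * (ic l * P2) * (ic l * P3)) +
  ic t * (ic (A1 * n) * P1 * (ic (A2 * n) * P2) * (ic (A3 * n) * P3))).
  by rewrite !(rmorphM, rmorphD, rmorphXn) /=; ring.
by rewrite W1 W2 W3; ring.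
Qed.

Lemma nrm_line : v != 0 ->
  nrm lq = v * ((A1 * v + u * C1 ^+ 2) * (A2 * v + u * C2 ^+ 2) * (A3 * v + u * C3 ^+ 2)).
Proof.
move=> v0; have c : zqc lq = - line_val (- l) m (- n).
  rewrite /lq /line_val /X0 /Y0 /Z0 /om /zqc !zqz !zqM zqN !zqD /=; congr pair; ring.
have T A C : ic (C ^+ 2) * X0 - ic A * Z0 = ic (- (v * (A * v + u * C ^+ 2))).
  by rewrite /X0 /Z0 !(rmorphN, rmorphM, rmorphD, rmorphXn) /=; ring.
have := prod_elimY; rewrite !T -!rmorphM /= => E.
have : ic (v ^+ 2 * nrm lq) = ic (v ^+ 2 * (v * ((A1 * v + u * C1 ^+ 2) * (A2 * v + u * C2 ^+ 2) * (A3 * v + u * C3 ^+ 2)))).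
  have -> : ic (v ^+ 2 * nrm lq) = - (lq * (Z0 * line_val (- l) m (- n))).
    by rewrite rmorphM /= -nrmE c /Z0; ring.
  by rewrite -E -rmorphN /=; congr (_%:~R); ring.
rewrite !zqz => -[]; apply: mulfI; by rewrite expf_neq0.
Qed.
End Line.
End LineProducts.

Definition sqfreez (n : int) := forall p : nat, prime p -> ~~ ((p ^ 2)%:Z %| n)%Z.

Lemma dvd_sqr (p : nat) (x y : int) : (p%:Z %| x)%Z -> (p%:Z %| y)%Z -> ((p ^ 2)%N%:Z %| x * y)%Z.
Proof. by move=> h1 h2; rewrite -mulnn PoszM dvdz_mul. Qed.

Lemma sqr_add_mod4 (y d : int) : (d %% 4)%Z = 1 \/ (d %% 4)%Z = 2 -> ~~ (4 %| y ^+ 2 + d)%Z.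
Proof.
move=> hd; apply/negP => /dvdzP[k kE].
have := divz_eq d 4; set e := (d %/ 4)%Z => dE.
have [q [r [yE hr]]] : exists q r, y = q * 2 + r /\ (r = 0 \/ r = 1).
  exists (y %/ 2)%Z, (y %% 2)%Z; split; first exact: divz_eq.
  have : 0 <= (y %% 2)%Z < 2 by rewrite modz_ge0 // ltz_pmod.
  by case: (y %% 2)%Z => [] [|[|]] //; [left|right].
have y2 : y ^+ 2 = 4 * (q * q + q * r) + r by rewrite yE; case: hr => ->; ring.
move: kE; rewrite y2 dE; move: (q * q + q * r) => z.
by case: hd hr => -> [] ->; clear; lia.
Qed.

(** * The quadratic form of a point *)

Section Forms.
Variables (a b u v d : int).
Hypothesis dE : d = v * (u ^+ 3 + a * u * v ^+ 2 - b * v ^+ 3).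
Hypothesis (u0 : 0 < u) (v0 : 0 < v) (d0 : 0 < d).
Hypothesis dsf : sqfreez d.
Hypothesis d4 : (d %% 4)%Z = 1 \/ (d %% 4)%Z = 2.
Local Notation O := (zq d).
Local Notation ic n := (intmul (1 : O) n).

Lemma vsf : sqfreez v.
Proof. by move=> p hp; apply: contra (dsf hp) => h; rewrite dE dvdz_mulr. Qed.

Lemma cuv : coprimez u v.
Proof.
apply/coprimez_pP => p hp hu hv; apply/negP: (dsf hp); rewrite negbK dE dvd_sqr //.
have -> : u ^+ 3 + a * u * v ^+ 2 - b * v ^+ 3 = (u ^+ 2 + a * v ^+ 2) * u - (b * v ^+ 2) * v by ring.
by rewrite rpredB // dvdz_mull.
Qed.

Definition alpha (A C : int) := A * v + u * C ^+ 2.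
Definition gP (C : int) := gcdz C v.
(** This is alpha v / g^2, written with two exact quotients: g divides v and C, hence also alpha. *)
Definition aP (A C : int) := ((alpha A C) %/ gP C)%Z * (v %/ gP C)%Z.

Section Point.
Variables (A B C : int).
Hypothesis (C0 : C != 0) (cA : coprimez A C) (cB : coprimez B C).
Hypothesis crv : B ^+ 2 = A ^+ 3 + a * A * C ^+ 4 + b * C ^+ 6.
Hypothesis al0 : 0 < alpha A C.
Let al := alpha A C.
Let g := gP C.
Let w := (v %/ g)%Z.
Let a1 := (al %/ g)%Z.

Lemma gP_gt0 : 0 < g.
Proof. by rewrite /g /gP lt0r gcdz_eq0 negb_and C0 /=; rewrite /gcdz. Qed.

Lemma gP_C : (g %| C)%Z. Proof. exact: dvdz_gcdl. Qed.
Lemma gP_v : (g %| v)%Z. Proof. exact: dvdz_gcdr. Qed.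
Lemma vE : v = w * g. Proof. by rewrite /w divzK // gP_v. Qed.
Lemma alE : al = a1 * g.
Proof.
symmetry; apply: divzK; apply: rpredD; first by rewrite dvdz_mull // gP_v.
by rewrite expr2 mulrA dvdz_mull // gP_C.
Qed.
Lemma alvE : al * v = g ^+ 2 * aP A C.
Proof. by rewrite /aP -/g -/al -/w -/a1 {1}alE {1}vE; ring. Qed.

Lemma aP_gt0 : 0 < aP A C.
Proof.
have h : 0 < g ^+ 2 * aP A C by rewrite -alvE mulr_gt0.
by move: h; rewrite pmulr_rgt0 // exprn_gt0 // gP_gt0.
Qed.

(** If p divides C and alpha / g, then p divides v and g, so p^2 divides alpha and A v, although p
    does not divide A and v is squarefree. Hence C can be inverted modulo [aP]. *)
Lemma coprime_C_aP : coprimez C (aP A C).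
Proof.
have cw (p : nat) : prime p -> (p%:Z %| C)%Z -> (p%:Z %| v)%Z -> (p%:Z %| w)%Z -> False.
  move=> hp hC hv hw; apply/negP: (vsf hp); rewrite negbK vE dvd_sqr //.
  by rewrite /g /gP dvdz_gcd hC.
apply/coprimez_pP => p hp hC; rewrite /aP -/g -/al -/w -/a1 pdvdzM // => /orP[h1|hw].
  have hA : ~~ (p%:Z %| A)%Z by apply/negP => hA; exact: (elimT (coprimez_pP A C) cA p hp).
  have hv : (p%:Z %| v)%Z.
    have : (p%:Z %| A * v)%Z.
      have -> : A * v = a1 * g - u * C ^+ 2 by rewrite -alE /al /alpha; ring.
      apply: rpredB; first by rewrite dvdz_mulr.
      by rewrite expr2 mulrA dvdz_mull.
    by rewrite pdvdzM // (negbTE hA).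
  have hg : (p%:Z %| g)%Z by rewrite dvdz_gcd hC.
  have : ((p ^ 2)%N%:Z %| A * v)%Z.
    have -> : A * v = a1 * g - u * C ^+ 2 by rewrite -alE /al /alpha; ring.
    by apply: rpredB; [exact: dvd_sqr|rewrite expr2 mulrA -mulrA dvdz_mull // dvd_sqr].
  rewrite Gauss_dvdzr ?(negbTE (vsf hp)) //.
  rewrite -mulnn PoszM coprimezMl andbb; apply/coprimez_pP => q hq hq1 hq2.
  move: hA; suff -> : p%:Z = q%:Z by rewrite hq2.
  by move: hq1; rewrite dvdzE /= dvdn_prime2 // => /eqP->.
by apply: (cw p) => //; rewrite vE dvdz_mulr.
Qed.

(** Modulo the ideal of P the zero (-uv : omega : v^2) should reduce to (A C : B : C^3). Comparing
    Y/Z gives omega C^3 = v^2 B, which for omega = -b is the divisibility required of b. *)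
Lemma bP_exists : exists bP, (aP A C %| C ^+ 3 * bP + v ^+ 2 * B)%Z.
Proof.
have [r [s E]] := Bezoutz (C ^+ 3) (aP A C).
exists (- (r * v ^+ 2 * B)).
have c : coprimez (C ^+ 3) (aP A C) by rewrite coprimezXl // coprime_C_aP.
have e : gcdz (C ^+ 3) (aP A C) = 1%R := eqP c.
have -> : C ^+ 3 * - (r * v ^+ 2 * B) + v ^+ 2 * B = v ^+ 2 * B * (1 - r * C ^+ 3) by ring.
rewrite -[X in X - _]e -E addrAC subrr add0r dvdz_mull // dvdz_mull //.
Qed.

(** Let f be the cubic of the curve. Since d = -v^4 f(-u/v), the left-hand side is f(A/C^2) -
    f(-u/v) up to denominators, which is divisible by A/C^2 + u/v. *)
Lemma point_norm : v ^+ 4 * B ^+ 2 + C ^+ 6 * d =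
  al * v * (v ^+ 2 * A ^+ 2 - u * v * A * C ^+ 2 + u ^+ 2 * C ^+ 4 + a * v ^+ 2 * C ^+ 4).
Proof. by rewrite crv dE /al /alpha; ring. Qed.

Variable bP : int.
Hypothesis bPE : (aP A C %| C ^+ 3 * bP + v ^+ 2 * B)%Z.

Lemma aP_dvd : (aP A C %| bP ^+ 2 + d)%Z.
Proof.
have c : coprimez (aP A C) (C ^+ 6) by rewrite coprimezXr // coprimez_sym coprime_C_aP.
rewrite -(Gauss_dvdzr _ c).
have -> : C ^+ 6 * (bP ^+ 2 + d) = (C ^+ 3 * bP + v ^+ 2 * B) * (C ^+ 3 * bP - v ^+ 2 * B)
   + (v ^+ 4 * B ^+ 2 + C ^+ 6 * d) by ring.
rewrite point_norm alvE; apply: rpredD; first by rewrite dvdz_mulr.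
by rewrite dvdz_mulr // dvdz_mull.
Qed.

(** An ideal is an arbitrary predicate [J] closed under the ideal operations. The lines z1, z2, z3
    through P, in which Y, X and Z respectively are missing, already generate g (aP, b + omega). *)
Lemma idealP (J : O -> Prop) :
  (forall x y, J x -> J y -> J (x + y)) -> (forall x y, J y -> J (x * y)) ->
  (forall l m n, l * (A * C) + m * B + n * C ^+ 3 = 0 -> J (@line_val u v d l m n)) ->
  J (ic g * ic (aP A C)) /\ J (ic g * (ic bP + om d)).
Proof.
move=> JD JM JL.
pose z1 : O := @line_val u v d (C ^+ 2) 0 (- A).
pose z2 : O := @line_val u v d 0 (C ^+ 3) (- B).
pose z3 : O := @line_val u v d B (- (A * C)) 0.
have J1 : J z1 by apply: JL; ring.
have J2 : J z2 by apply: JL; ring.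
have J3 : J z3 by apply: JL; ring.
pose C' := (C %/ g)%Z.
have CE : C = C' * g by rewrite /C' divzK // gP_C.
pose z' : O := - ic (u * w * B) - ic (A * C') * om d.
have z3E : z3 = ic g * z'.
  rewrite /z3 /z' /line_val [in LHS]vE [in LHS]CE !(rmorphN, rmorphM, rmorphXn) /=; ring.
have z1E : z1 = - (ic (g ^+ 2) * ic (aP A C)).
  rewrite -intrM -alvE /z1 /line_val /al /alpha !(rmorphN, rmorphM, rmorphXn, rmorphD, rmorph0) /=; ring.
have z2E : z2 = ic (C ^+ 3) * om d - ic (v ^+ 2 * B).
  rewrite /z2 /line_val !(rmorphN, rmorphM, rmorphXn, rmorphD, rmorph0) /=; ring.
(* A prime dividing all three numbers divides C, then v by the second one, hence g. The third one
   then makes it divide u or w, against gcd(u, v) = 1 or against v being squarefree. *)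
have [r [s [t E]]] : exists r s t, r * (g * C ^+ 3) + s * nrm z2 + t * nrm z' = 1.
  have n2 : nrm z2 = v ^+ 4 * B ^+ 2 + C ^+ 6 * d.
    by rewrite z2E !zqz !zqM zqN zqD /nrm /=; ring.
  have n3 : nrm z' = (u * w * B) ^+ 2 + d * (A * C') ^+ 2.
    by rewrite /z' !zqz !zqM !zqN zqD /nrm /=; ring.
  rewrite n2 n3; apply: bezout3 => p hp h1 h2 h3.
  have hC : (p%:Z %| C)%Z.
    move: h1; rewrite pdvdzM // pdvdzX // => /orP[h|//].
    exact: dvdz_trans h gP_C.
  have nB : (p%:Z %| B)%Z = false by apply/negP => hB; exact: (elimT (coprimez_pP B C) cB p hp).
  have hv : (p%:Z %| v)%Z.
    move: h2; rewrite rpredDr; last by rewrite dvdz_mulr // pdvdzX.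
    by rewrite pdvdzM // !pdvdzX // nB orbF.
  have hg : (p%:Z %| g)%Z by rewrite dvdz_gcd hC.
  move: h3; rewrite rpredDr; last by rewrite dvdz_mulr // dE dvdz_mulr.
  rewrite pdvdzX // !pdvdzM // nB orbF => /orP[hu|hw].
    exact: (elimT (coprimez_pP u v) cuv p hp).
  by apply/negP: (vsf hp); rewrite negbK vE dvd_sqr.
have gen (m : O) : J (ic (g * C ^+ 3) * (ic g * m)) -> J (ic g * m).
  move=> h; have -> : ic g * m = ic r * (ic (g * C ^+ 3) * (ic g * m)) +
      (ic s * ic g * m * zqc z2) * z2 + (ic t * m * zqc z') * z3.
    rewrite z3E; transitivity (ic (r * (g * C ^+ 3) + s * nrm z2 + t * nrm z') * (ic g * m)).
      by rewrite E mul1r.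
    by rewrite !rmorphD /= !(rmorphM _ s) !(rmorphM _ t) !(rmorphM _ r) /= -!nrmE; ring.
  by apply: (JD); [apply: (JD)|]; apply: JM.
split; apply: gen.
  have -> : ic (g * C ^+ 3) * (ic g * ic (aP A C)) = - ic (C ^+ 3) * z1.
    by rewrite z1E !(rmorphM, rmorphXn) /=; ring.
  exact: JM.
have /dvdzP[k kE] := bPE.
have -> : ic (g * C ^+ 3) * (ic g * (ic bP + om d)) = - ic k * z1 + ic (g ^+ 2) * z2.
  rewrite z1E z2E.
  transitivity (ic (g ^+ 2) * (ic (k * aP A C) + (ic (C ^+ 3) * om d - ic (v ^+ 2 * B)))).
    by rewrite -kE !(rmorphM, rmorphXn, rmorphD) /=; ring.
  by rewrite !(rmorphM, rmorphXn) /=; ring.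
by apply: JD; apply: JM.
Qed.
End Point.

(** A common prime p gives p^2 | y^2 + d. An odd p divides y, so p^2 | d; for p = 2 the residue of d
    modulo 4 rules it out. *)
Lemma form_primitive (x y z : int) : x * z = y ^+ 2 + d -> gcdz (gcdz x (2 * y)) z = 1.
Proof.
move=> E; apply/eqP; apply/coprimez_pP => p hp; rewrite dvdz_gcd => /andP[hx h2y] hz.
have hd : ((p ^ 2)%N%:Z %| y ^+ 2 + d)%Z by rewrite -E dvd_sqr.
case: (eqVneq p 2) => [p2|np2].
  by move: hd; rewrite p2; apply/negP/sqr_add_mod4.
have hy : (p%:Z %| y)%Z.
  move: h2y; rewrite pdvdzM // => /orP[|//]; rewrite dvdzE /= dvdn_prime2 // => /eqP e.
  by rewrite e eqxx in np2.
by move: hd; rewrite rpredDl ?expr2 ?dvd_sqr // (negbTE (dsf hp)).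
Qed.

(** A proper equivalence becomes multiplication by an element: e1 and e2 form another basis of the
    ideal (x1, y1 + omega), and e1 times (x2, y2 + omega) is x2 times that ideal. *)
Lemma equiv_gen (x1 y1 z1 x2 y2 z2 al be ga de : int) :
  x1 * z1 = y1 ^+ 2 + d -> x2 * z2 = y2 ^+ 2 + d -> al * de - be * ga = 1 ->
  (x2, 2 * y2, z2) = (x1 * al ^+ 2 + 2 * y1 * al * ga + z1 * ga ^+ 2,
         2 * x1 * al * be + 2 * y1 * (al * de + be * ga) + 2 * z1 * ga * de,
         x1 * be ^+ 2 + 2 * y1 * be * de + z1 * de ^+ 2) ->
  let e1 := ic al * ic x1 + ic ga * (ic y1 + om d) in
  let e2 := ic be * ic x1 + ic de * (ic y1 + om d) in
  nrm e1 = x1 * x2 /\ e1 * (ic y2 + om d) = ic x2 * e2.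
Proof.
move=> E1 E2 det [X Y Z] e1 e2.
have Y' : y2 = x1 * al * be + y1 * (al * de + be * ga) + z1 * ga * de.
  by apply: (@mulfI _ 2) => //; rewrite Y; ring.
have dE' : d = x1 * z1 - y1 ^+ 2 by rewrite E1; ring.
have F1 : e1 = (al * x1 + ga * y1, ga) by rewrite /e1 !zqz !(zqM, zqD) /=; congr pair; ring.
have F2 : e2 = (be * x1 + de * y1, de) by rewrite /e2 !zqz !(zqM, zqD) /=; congr pair; ring.
split.
  by rewrite F1 /nrm /= {1}dE' X; ring.
rewrite F1 F2 !zqz !(zqM, zqD) /=.
congr pair.
  transitivity ((al * x1 + ga * y1) * y2 - (x1 * z1 - y1 ^+ 2) * ga); first by rewrite -dE'; ring.
  rewrite X Y'; apply: sub0E'.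
  transitivity ((al * de - be * ga - 1) * (ga * (x1 * z1 - y1 ^+ 2))); first by ring.
  by rewrite det subrr mul0r.
rewrite X Y'; apply: sub0E'.
transitivity ((1 - (al * de - be * ga)) * (al * x1 + ga * y1)); first by ring.
by rewrite det subrr mul0r.
Qed.

(** Here P3 = P1 - P2, so P1, -P2 and -P3 are collinear. Equivalence puts e1 into the product of the
    first ideal with the conjugate of the second; dividing by v lq leaves an element w = x + y omega
    of norm [aP A3 C3]. If y is nonzero this norm is at least d; if y = 0 then x is 1 or -1. *)
Theorem equiv_kernel (A1 B1 C1 A2 B2 C2 A3 B3 C3 l n b1 b2 b3 z1 z2 : int) (al be ga de : int) :
  let m := C1 * C2 * C3 in
  C1 != 0 -> C2 != 0 -> C3 != 0 ->
  coprimez A1 C1 -> coprimez A2 C2 -> coprimez A3 C3 ->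
  coprimez B1 C1 -> coprimez B2 C2 -> coprimez B3 C3 ->
  B1 ^+ 2 = A1 ^+ 3 + a * A1 * C1 ^+ 4 + b * C1 ^+ 6 ->
  B2 ^+ 2 = A2 ^+ 3 + a * A2 * C2 ^+ 4 + b * C2 ^+ 6 ->
  B3 ^+ 2 = A3 ^+ 3 + a * A3 * C3 ^+ 4 + b * C3 ^+ 6 ->
  0 < alpha A1 C1 -> 0 < alpha A2 C2 -> 0 < alpha A3 C3 ->
  l * (A1 * C1) + m * B1 + n * C1 ^+ 3 = 0 ->
  l * (A2 * C2) + m * (- B2) + n * C2 ^+ 3 = 0 ->
  l * (A3 * C3) + m * (- B3) + n * C3 ^+ 3 = 0 ->
  l ^+ 2 = A1 * (C2 * C3) ^+ 2 + A2 * (C1 * C3) ^+ 2 + A3 * (C1 * C2) ^+ 2 ->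
  a * m ^+ 2 - 2 * l * n = A1 * A2 * C3 ^+ 2 + A1 * A3 * C2 ^+ 2 + A2 * A3 * C1 ^+ 2 ->
  n ^+ 2 = b * m ^+ 2 + A1 * A2 * A3 ->
  (aP A1 C1 %| C1 ^+ 3 * b1 + v ^+ 2 * B1)%Z ->
  (aP A2 C2 %| C2 ^+ 3 * b2 + v ^+ 2 * B2)%Z ->
  (aP A3 C3 %| C3 ^+ 3 * b3 + v ^+ 2 * B3)%Z ->
  aP A1 C1 * z1 = b1 ^+ 2 + d -> aP A2 C2 * z2 = b2 ^+ 2 + d ->
  al * de - be * ga = 1 ->
  (aP A2 C2, 2 * b2, z2) = (aP A1 C1 * al ^+ 2 + 2 * b1 * al * ga + z1 * ga ^+ 2,
         2 * aP A1 C1 * al * be + 2 * b1 * (al * de + be * ga) + 2 * z1 * ga * de,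
         aP A1 C1 * be ^+ 2 + 2 * b1 * be * de + z1 * de ^+ 2) ->
  aP A3 C3 = 1 \/ d <= aP A3 C3.
Proof.
move=> m C10 C20 C30 cA1 cA2 cA3 cB1 cB2 cB3 cr1 cr2 cr3 p1 p2 p3 L1 L2 L3 R1 R2 R3 D1 D2 D3 F1 F2 det EQ.
have m0 : m != 0 by rewrite !mulf_neq0.
have cB2' : coprimez (- B2) C2 by rewrite coprimeNz.
have cB3' : coprimez (- B3) C3 by rewrite coprimeNz.
have cr2' : (- B2) ^+ 2 = A2 ^+ 3 + a * A2 * C2 ^+ 4 + b * C2 ^+ 6 by rewrite sqrrN.
have cr3' : (- B3) ^+ 2 = A3 ^+ 3 + a * A3 * C3 ^+ 4 + b * C3 ^+ 6 by rewrite sqrrN.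
have D2' : (aP A2 C2 %| C2 ^+ 3 * (- b2) + v ^+ 2 * (- B2))%Z by rewrite !mulrN -opprD rpredN.
have D3' : (aP A3 C3 %| C3 ^+ 3 * (- b3) + v ^+ 2 * (- B3))%Z by rewrite !mulrN -opprD rpredN.
pose lq : O := @line_val u v d l m n.
pose J0 (z : O) := exists w, z = ic v * lq * w.
have JD y x1 x2 : J0 (x1 * y) -> J0 (x2 * y) -> J0 ((x1 + x2) * y).
  by rewrite /J0 => -[w1 E1] [w2 E2]; exists (w1 + w2); rewrite mulrDl E1 E2; ring.
have JM y x1 x2 : J0 (x2 * y) -> J0 (x1 * x2 * y).
  by rewrite /J0 => -[w1 E1]; exists (x1 * w1); rewrite -mulrA E1; ring.
pose S1 x := x = ic (gP C1) * ic (aP A1 C1) \/ x = ic (gP C1) * (ic b1 + om d).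
pose S2 x := x = ic (gP C2) * ic (aP A2 C2) \/ x = ic (gP C2) * (ic (- b2) + om d).
pose S3 x := x = ic (gP C3) * ic (aP A3 C3) \/ x = ic (gP C3) * (ic (- b3) + om d).
have step1 x l2 m2 n2 l3 m3 n3 : S1 x -> l2 * (A2 * C2) + m2 * (- B2) + n2 * C2 ^+ 3 = 0 ->
    l3 * (A3 * C3) + m3 * (- B3) + n3 * C3 ^+ 3 = 0 ->
    J0 (x * (@line_val u v d l2 m2 n2 * @line_val u v d l3 m3 n3)).
  move=> hx h2 h3; pose J z := J0 (z * (@line_val u v d l2 m2 n2 * @line_val u v d l3 m3 n3)).
  have [|x1 x2|l1 m1 n1 h1|K1 K2] := idealP cB1 D1 (J := J); first exact: JD.
  - exact: JM.
  - rewrite /J mulrA /J0 /lq; apply: (line_products dE m0 cA1 cA2 cA3 cB1 cB2' cB3' L1 L2 L3 R1 R2 R3 h1 h2 h3).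
  - by case: hx => ->.
have step2 x y l3 m3 n3 : S1 x -> S2 y -> l3 * (A3 * C3) + m3 * (- B3) + n3 * C3 ^+ 3 = 0 ->
    J0 (y * (x * @line_val u v d l3 m3 n3)).
  move=> hx hy h3; pose J z := J0 (z * (x * @line_val u v d l3 m3 n3)).
  have [|x1 x2|l2 m2 n2 h2|K1 K2] := idealP cB2' D2' (J := J); first exact: JD.
  - exact: JM.
  - by rewrite /J mulrCA; exact: step1.
  - by case: hy => ->.
have step3 x y z : S1 x -> S2 y -> S3 z -> J0 (z * (x * y)).
  move=> hx hy hz; pose J z := J0 (z * (x * y)).
  have [|x1 x2|l3 m3 n3 h3|K1 K2] := idealP cB3' D3' (J := J); first exact: JD.
  - exact: JM.
  - have -> : J (@line_val u v d l3 m3 n3) = J0 (y * (x * @line_val u v d l3 m3 n3)) by rewrite /J; congr J0; ring.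
    exact: step2.
  - by case: hz => ->.
have [N1 E1] := equiv_gen F1 F2 det EQ; set e1 := _ + _ in N1 E1.
(* Primitivity of the second form means that its ideal times the conjugate ideal is generated by
   [aP A2 C2]. This is why e1 itself, and not just a multiple, is a combination of the four products
   in [e1E]. *)
have [r [s [t E]]] : exists r s t, r * aP A2 C2 + s * (2 * b2) + t * z2 = 1.
  have c := form_primitive F2.
  have [x [y E]] := Bezoutz (gcdz (aP A2 C2) (2 * b2)) z2.
  have [x' [y' E']] := Bezoutz (aP A2 C2) (2 * b2).
  by exists (x * x'), (x * y'), y; rewrite -[RHS]c -E -E'; ring.
pose a1' : O := ic (aP A1 C1); pose a2' : O := ic (aP A2 C2).
pose be1 : O := ic b1 + om d; pose be2 : O := ic (- b2) + om d.
pose e2 := ic be * a1' + ic de * be1; rewrite -/a1' -/be1 -/a2' -/e2 in E1.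
have a20 : aP A2 C2 != 0 by rewrite gt_eqF // aP_gt0.
have z2e : ic z2 * e1 = - be2 * e2.
  apply: (zq_intreg a20).
  transitivity (ic (aP A2 C2 * z2) * e1); first by rewrite (intrM _ (aP A2 C2) z2); ring.
  rewrite F2; transitivity (- be2 * (e1 * (ic b2 + om d))); last by rewrite E1 /a2'; ring.
  have O2 : ic d = - om d ^+ 2 by rewrite omK opprK.
  have -> : ic (b2 ^+ 2 + d) = ic b2 ^+ 2 - om d ^+ 2 by rewrite omK opprK -rmorphXn -rmorphD.
  by rewrite /be2 (_ : ic (- b2) = - ic b2) ?rmorphN //; ring.
have e1E : e1 = (ic (r * al) + ic (s * be)) * (a1' * a2') + (ic (r * ga) + ic (s * de)) * (be1 * a2')
   - (ic (s * al) + ic (t * be)) * (a1' * be2) - (ic (s * ga) + ic (t * de)) * (be1 * be2).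
  transitivity (ic (r * aP A2 C2 + s * (2 * b2) + t * z2) * e1); first by rewrite E mul1r.
  transitivity (ic r * (a2' * e1) + ic s * (e1 * (ic b2 + om d) - e1 * be2) + ic t * (ic z2 * e1)).
    by rewrite /be2 /a2'; ring.
  by rewrite (_ : a2' * e1 = al%:~R * (a1' * a2') + ga%:~R * (be1 * a2')) ?E1 ?z2e /e2 1?{1}/e1 -/a1' -/be1; ring.
pose Ga : int := gP C1 * gP C2 * gP C3.
have fin m3 : S3 (ic (gP C3) * m3) -> J0 (ic Ga * e1 * m3).
  move=> h3; have [w1 W1] := step3 _ _ _ (or_introl erefl) (or_introl erefl) h3.
  have [w2 W2] := step3 _ _ _ (or_intror erefl) (or_introl erefl) h3.
  have [w3 W3] := step3 _ _ _ (or_introl erefl) (or_intror erefl) h3.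
  have [w4 W4] := step3 _ _ _ (or_intror erefl) (or_intror erefl) h3.
  exists ((ic (r * al) + ic (s * be)) * w1 + (ic (r * ga) + ic (s * de)) * w2
   - (ic (s * al) + ic (t * be)) * w3 - (ic (s * ga) + ic (t * de)) * w4).
  transitivity ((ic (r * al) + ic (s * be)) * (ic v * lq * w1) + (ic (r * ga) + ic (s * de)) * (ic v * lq * w2)
   - (ic (s * al) + ic (t * be)) * (ic v * lq * w3) - (ic (s * ga) + ic (t * de)) * (ic v * lq * w4)); last by ring.
  by rewrite -W1 -W2 -W3 -W4 e1E /Ga -/a1' -/a2' -/be1 -/be2; ring.
have [w W] := fin _ (or_introl erefl); have [w' W'] := fin _ (or_intror erefl).
have Nl : nrm lq = v * (alpha A1 C1 * alpha A2 C2 * alpha A3 C3).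
  by apply: (nrm_line dE R1 R2 R3); rewrite gt_eqF.
have a10 := aP_gt0 C10 p1; have a30 := aP_gt0 C30 p3; have a20' := aP_gt0 C20 p2.
have v3 : v ^+ 3 != 0 by rewrite expf_neq0 // gt_eqF.
have Gv : v ^+ 3 * (alpha A1 C1 * alpha A2 C2 * alpha A3 C3) = Ga ^+ 2 * (aP A1 C1 * aP A2 C2 * aP A3 C3).
  transitivity ((alpha A1 C1 * v) * (alpha A2 C2 * v) * (alpha A3 C3 * v)); first by ring.
  by rewrite !alvE /Ga; ring.
have nl0 : v ^+ 2 * nrm lq != 0.
  by rewrite Nl !mulf_neq0 ?gt_eqF.
have nint (k : int) : nrm (ic k) = k ^+ 2 by rewrite zqz /nrm /=; ring.
(* Since every alpha v is g^2 times the matching [aP], the norms of v lq and of [Ga] cancel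
   completely. *)
have Nw : nrm w = aP A3 C3.
  apply: (mulfI nl0).
  have -> : v ^+ 2 * nrm lq * nrm w = nrm (ic v * lq * w) by rewrite !nrmM nint.
  rewrite -W !nrmM !nint N1 Nl.
  transitivity (Ga ^+ 2 * (aP A1 C1 * aP A2 C2 * aP A3 C3) * aP A3 C3); first by ring.
  by rewrite -Gv; ring.
have tau0 : nrm (ic v * lq) != 0 by rewrite nrmM nint.
have ww : ic (aP A3 C3) * w' = (ic (- b3) + om d) * w.
  apply: (zq_reg tau0).
  transitivity (ic (aP A3 C3) * (ic v * lq * w')); first by ring.
  by rewrite -W'; transitivity ((ic (- b3) + om d) * (ic v * lq * w)); [rewrite -W; ring|ring].
move: Nw ww; case: w {W} => x y; case: w' {W'} => x' y'; rewrite /nrm /= => Nw.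
rewrite !zqz !(zqM, zqD) /= => -[_ E4].
(* When w is an integer x, [aP A3 C3] is x^2 and the omega-component of [ww] reads x^2 y' = x, so x
   is a unit. *)
case: (eqVneq y 0) E4 Nw => [->|y0] E4 Nw; [left|right].
  move: Nw E4; rewrite !mulr0 !mul0r !add0r mul1r ?addr0 => Nw; rewrite ?addr0 ?add0r => E4.
  have x0 : x != 0 by apply: contraTneq a30 => x0; rewrite -Nw x0 expr0n.
  move: E4; rewrite -Nw => E4.
  have E5 : x * y' = 1 by apply: (mulfI x0); rewrite mulr1 -[RHS]E4; ring.
  have : (x %| 1)%Z by apply/dvdzP; exists y'; rewrite mulrC E5.
  by rewrite dvdzE /= dvdn1 => /eqP h; rewrite expr2; case: x h {E5 x0 Nw E4} => [] [|[|]].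
rewrite -Nw -[leLHS]mulr1; apply: le_trans (_ : d * y ^+ 2 <= _); last by rewrite lerDr sqr_ge0.
rewrite ler_pM2l //; have : 0 < y ^+ 2 by rewrite exprn_even_gt0.
by [].
Qed.
End Forms.

(** * Reduced coordinates of points and lines *)

Lemma rat_sqr_int (r : rat) (k : int) : r ^+ 2 = k%:~R -> exists m : int, r = m%:~R.
Proof.
move=> E; exists (numq r); rewrite -[LHS]divq_num_den.
suff -> : denq r = 1 by rewrite divr1.
have E2 : numq r ^+ 2 = k * denq r ^+ 2.
  apply/eqP; rewrite -(eqr_int rat) !(rmorphM, rmorphXn) /= -E numqE; apply/eqP; ring.
have c : coprimez (denq r) (numq r ^+ 2).
  by rewrite coprimezXr // coprimez_sym; exact: coprime_num_den.
have : (denq r %| 1)%Z.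
  have : (denq r %| numq r ^+ 2 * 1)%Z by rewrite mulr1 E2 expr2 !dvdz_mull.
  by rewrite Gauss_dvdzr.
rewrite dvdzE /= dvdn1 => /eqP h; have := denq_gt0 r.
by rewrite -[denq r]gez0_abs ?h // denq_ge0.
Qed.

Lemma gcdn_sqr_mul (m D N : nat) : (m ^ 2 = D * N)%N -> coprime D N -> (gcdn m D ^ 2 = D)%N.
Proof.
move=> E c.
have expg (x y : nat) : (gcdn x y ^ 2 = gcdn (x ^ 2) (y ^ 2))%N.
  case: (posnP (gcdn x y)) => [g0|g0].
    by move/eqP: (g0); rewrite eqn0Ngt gcdn_gt0 negb_or -!eqn0Ngt => /andP[/eqP-> /eqP->].
  set g := gcdn x y in g0 *; have [x' xE] := dvdnP (dvdn_gcdl x y); have [y' yE] := dvdnP (dvdn_gcdr x y).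
  have c' : coprime x' y'.
    by rewrite /coprime -(eqn_pmul2r g0) mul1n muln_gcdl -xE -yE.
  rewrite -/g in xE yE; rewrite xE yE !expnMn -muln_gcdl.
  have /eqP-> : coprime (x' ^ 2) (y' ^ 2) by rewrite coprimeXl // coprimeXr.
  by rewrite mul1n.
rewrite expg E -mulnn -muln_gcdr (eqP (_ : coprime N D)) ?muln1 //.
by rewrite coprime_sym.
Qed.

Section Points.
Variables (a4 a6 : int).

Record point_data (x y : rat) (A B C : int) : Prop := PointData {
  pd_C : 0 < C; pd_cA : coprimez A C; pd_cB : coprimez B C;
  pd_crv : B ^+ 2 = A ^+ 3 + a4 * A * C ^+ 4 + a6 * C ^+ 6;
  pd_num : numq x = A; pd_den : denq x = C ^+ 2;
  pd_x : x = A%:~R / (C%:~R) ^+ 2; pd_y : y = B%:~R / (C%:~R) ^+ 3 }.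

(** With D the denominator of x, (y D^2)^2 = D N where N is congruent modulo D to the cube of the
    numerator. So D and N are coprime, and D is a square because D N is. *)
Lemma point_dataP x y : on_curve a4 a6 (Some (x, y)) -> exists A B C, point_data x y A B C.
Proof.
rewrite on_curve_some => /eqP E.
set A := numq x; set D := denq x.
have D0 : D%:~R != 0 :> rat by rewrite intr_eq0 denq_neq0.
have Dg : 0 < D := denq_gt0 x.
have xE : x = A%:~R / D%:~R by rewrite divq_num_den.
set N := A ^+ 3 + a4 * A * D ^+ 2 + a6 * D ^+ 3.
have [m mE] : exists m : int, y * D%:~R ^+ 2 = m%:~R.
  apply: (@rat_sqr_int _ (D * N)).
  rewrite exprMn E xE /N !(rmorphM, rmorphXn, rmorphD) /=; field.
  by [].
have m2 : m ^+ 2 = D * N.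
  apply/eqP; rewrite -(eqr_int rat) rmorphXn /= -mE exprMn E xE /N !(rmorphM, rmorphXn, rmorphD) /=.
  by apply/eqP; field.
have cDA : coprimez D A by rewrite coprimez_sym; exact: coprime_num_den.
have cDN : coprimez D N.
  apply/coprimez_pP => p hp hD; rewrite /N rpredDr; last by rewrite dvdz_mull // exprS dvdz_mulr.
  rewrite rpredDr; last by rewrite dvdz_mull // exprS dvdz_mulr.
  by rewrite pdvdzX // => hA; exact: (elimT (coprimez_pP D A) cDA p hp).
pose C : int := gcdz m D.
have CE : C ^+ 2 = D.
  have : (`|m| ^ 2 = `|D| * `|N|)%N by rewrite -abszX -abszM m2.
  move/gcdn_sqr_mul => /(_ cDN) h.
  have -> : C ^+ 2 = (gcdn `|m| `|D| ^ 2)%N%:Z by rewrite /C /gcdz -mulnn PoszM expr2.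
  by rewrite h gez0_abs // ltW.
have C0 : 0 < C.
  have : C != 0 by apply: contraTneq Dg => h; rewrite -CE h expr0n.
  by rewrite lt0r => ->; rewrite /C /gcdz.
have [B BE] : exists B, m = B * C by apply/dvdzP; rewrite dvdz_gcdl.
have C0' : C%:~R != 0 :> rat by rewrite intr_eq0 gt_eqF.
have CE' : D%:~R = C%:~R ^+ 2 :> rat by rewrite -CE rmorphXn.
have yE : y = B%:~R / C%:~R ^+ 3.
  have : y * D%:~R ^+ 2 = B%:~R * C%:~R by rewrite mE BE rmorphM.
  rewrite CE' => h; apply: (mulIf (expf_neq0 4 C0')).
  have -> : y * C%:~R ^+ 4 = y * (C%:~R ^+ 2) ^+ 2 by ring.
  by rewrite h; field.
have crv : B ^+ 2 = A ^+ 3 + a4 * A * C ^+ 4 + a6 * C ^+ 6.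
  have h : m ^+ 2 = C ^+ 2 * (A ^+ 3 + a4 * A * C ^+ 4 + a6 * C ^+ 6) by rewrite m2 /N -CE; ring.
  apply: (@mulfI _ (C ^+ 2)); first by rewrite expf_neq0 // gt_eqF.
  by rewrite -h BE; ring.
have cAC : coprimez A C.
  by move: cDA; rewrite -CE coprimez_sym coprimez_pexpr.
exists A, B, C; split=> //; last by rewrite -CE'.
apply/coprimez_pP => p hp hB hC; apply: (elimT (coprimez_pP A C) cAC p hp) => //.
rewrite -(pdvdzX A 2 hp).
have -> : A ^+ 3 = B ^+ 2 - (a4 * A * C ^+ 4 + a6 * C ^+ 6) by rewrite crv; ring.
apply: rpredB; first by rewrite pdvdzX.
by apply: rpredD; rewrite dvdz_mull // exprS dvdz_mulr.
Qed.

Lemma pd_opp x y A B C : point_data x y A B C -> point_data x (- y) A (- B) C.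
Proof.
case=> h1 h2 h3 h4 h5 h6 h7 h8; split=> //; first by rewrite coprimeNz.
  by rewrite sqrrN.
by rewrite h8 rmorphN /= mulNr.
Qed.

(** The coefficients are l = -mu m and n = -c m. Vieta's relations show that their squares are
    integers, and a rational number with integral square is an integer. *)
Lemma line_data mu c x1 y1 A1 B1 C1 x2 y2 A2 B2 C2 x3 y3 A3 B3 C3 :
  col a4%:~R a6%:~R mu c x1 x2 x3 ->
  y1 = mu * x1 + c -> y2 = mu * x2 + c -> y3 = mu * x3 + c ->
  point_data x1 y1 A1 B1 C1 -> point_data x2 y2 A2 B2 C2 -> point_data x3 y3 A3 B3 C3 ->
  let m := C1 * C2 * C3 in
  exists l n : int, [/\ l * (A1 * C1) + m * B1 + n * C1 ^+ 3 = 0,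
    l * (A2 * C2) + m * B2 + n * C2 ^+ 3 = 0, l * (A3 * C3) + m * B3 + n * C3 ^+ 3 = 0,
    l ^+ 2 = A1 * (C2 * C3) ^+ 2 + A2 * (C1 * C3) ^+ 2 + A3 * (C1 * C2) ^+ 2 &
    a4 * m ^+ 2 - 2 * l * n = A1 * A2 * C3 ^+ 2 + A1 * A3 * C2 ^+ 2 + A2 * A3 * C1 ^+ 2 /\
    n ^+ 2 = a6 * m ^+ 2 + A1 * A2 * A3].
Proof.
move=> [e1 e2 e3] l1 l2 l3 p1 p2 p3 m.
have nz x y A B C : point_data x y A B C -> C%:~R != 0 :> rat.
  by case=> h _ _ _ _ _ _ _; rewrite intr_eq0 gt_eqF.
have n1 := nz _ _ _ _ _ p1; have n2 := nz _ _ _ _ _ p2; have n3 := nz _ _ _ _ _ p3.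
have X1 := pd_x p1; have X2 := pd_x p2; have X3 := pd_x p3.
have Y1 := pd_y p1; have Y2 := pd_y p2; have Y3 := pd_y p3.
have mE : m%:~R = C1%:~R * C2%:~R * C3%:~R :> rat by rewrite !rmorphM.
have [l lE] : exists l : int, - mu * m%:~R = l%:~R.
  apply: (@rat_sqr_int _ (A1 * (C2 * C3) ^+ 2 + A2 * (C1 * C3) ^+ 2 + A3 * (C1 * C2) ^+ 2)).
  rewrite exprMn sqrrN -e1 X1 X2 X3 mE !(rmorphM, rmorphXn, rmorphD) /=; field.
  by rewrite n1 n2 n3.
have [n nE] : exists n : int, - c * m%:~R = n%:~R.
  apply: (@rat_sqr_int _ (a6 * m ^+ 2 + A1 * A2 * A3)).
  have c2 : c ^+ 2 = x1 * x2 * x3 + a6%:~R by rewrite e3; ring.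
  rewrite exprMn sqrrN c2 X1 X2 X3 !(rmorphM, rmorphXn, rmorphD) /= ?mE; field.
  by rewrite n1 n2 n3.
have L x y A B C : point_data x y A B C -> y = mu * x + c -> l * (A * C) + m * B + n * C ^+ 3 = 0.
  move=> p yE; have nC := nz _ _ _ _ _ p; apply/eqP; rewrite -(eqr_int rat); apply/eqP.
  have -> : (l * (A * C) + m * B + n * C ^+ 3)%:~R = l%:~R * (A%:~R * C%:~R) + m%:~R * B%:~R + n%:~R * C%:~R ^+ 3 :> rat.
    by rewrite !(rmorphM, rmorphXn, rmorphD).
  rewrite -lE -nE.
  have -> : B%:~R = y * C%:~R ^+ 3 by rewrite (pd_y p) divfK // expf_neq0.
  have -> : A%:~R = x * C%:~R ^+ 2 by rewrite (pd_x p) divfK // expf_neq0.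
  by rewrite yE rmorph0; ring.
exists l, n; split; [exact: L l1|exact: L l2|exact: L l3| |split].
- apply/eqP; rewrite -(eqr_int rat); apply/eqP; rewrite rmorphXn /= -lE.
  rewrite exprMn sqrrN -e1 X1 X2 X3 mE !(rmorphM, rmorphXn, rmorphD) /=; field.
  by rewrite n1 n2 n3.
- apply/eqP; rewrite -(eqr_int rat); apply/eqP; rewrite !(rmorphB, rmorphM, rmorphXn, rmorphD) /= -lE -nE ?mE.
  transitivity ((x1 * x2 + x1 * x3 + x2 * x3) * (C1%:~R * C2%:~R * C3%:~R) ^+ 2); first by rewrite e2; ring.
  by rewrite X1 X2 X3; field; rewrite n1 n2 n3.
- apply/eqP; rewrite -(eqr_int rat); apply/eqP; rewrite !(rmorphB, rmorphM, rmorphXn, rmorphD) /= -nE ?mE.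
  transitivity ((a6%:~R + x1 * x2 * x3) * (C1%:~R * C2%:~R * C3%:~R) ^+ 2); first by rewrite e3; ring.
  by rewrite X1 X2 X3; field; rewrite n1 n2 n3.
Qed.
End Points.

(** * Equivalent forms and the height of a difference *)

Section Class.
Variables (a4 a6 u v : int).
Hypothesis disc0 : ec_disc a4 a6 != 0.
Hypothesis msuit : map_suitable a4 a6 u v.
Hypothesis fund : fundamental_disc (- DE a4 a6 u v).
Let d := dE a4 a6 u v.

Let u0 : 0 < u. Proof. by case: msuit. Qed.
Let v0 : 0 < v. Proof. by case: msuit. Qed.

Lemma dE_gt0 : 0 < d.
Proof. by case: msuit => _ _ _; rewrite /DE -/d pmulr_rgt0. Qed.

Lemma dE_factor : d = v * (u ^+ 3 + a4 * u * v ^+ 2 - a6 * v ^+ 3). Proof. by []. Qed.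

Lemma dE_fundamental : sqfreez d /\ ((d %% 4)%Z = 1 \/ (d %% 4)%Z = 2).
Proof.
case: fund => _ [[h _]|[m [mE [m4 sf]]]].
  have := divz_eq (- DE a4 a6 u v) 4; rewrite h /DE -/d; set q := (_ %/ _)%Z.
  by move=> e; exfalso; move: e; clear; lia.
have md : m = - d by move: mE; rewrite /DE -/d; clear; lia.
split; first by move=> p hp; have := sf p hp; rewrite md dvdzE abszN.
have := divz_eq d 4; have := divz_eq (- d) 4; rewrite -md.
have : 0 <= (d %% 4)%Z < 4 by rewrite modz_ge0 // ltz_pmod.
rewrite {1 2}md; move: ((d %% 4)%Z) ((d %/ 4)%Z) ((m %/ 4)%Z) m4 => r q q' m4.
by case: m4 => ->; clear; lia.
Qed.

Let dsf := dE_fundamental.1.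
Let d4 := dE_fundamental.2.
Let d0 := dE_gt0.

(** If A/C^2 <= -u/v, the last factor in [point_norm] is at least (3 u^2 + a4 v^2) C^4, which
    map-suitability makes nonnegative; the right-hand side would then be at most 0 while the
    left-hand side is positive. *)
Lemma alpha_gt0 A B C : 0 < C -> B ^+ 2 = A ^+ 3 + a4 * A * C ^+ 4 + a6 * C ^+ 6 ->
  0 < alpha u v A C.
Proof.
move=> C0 crv; rewrite ltNge; apply/negP => al0.
have hN := point_norm dE_factor crv.
have pos : 0 < v ^+ 4 * B ^+ 2 + C ^+ 6 * d.
  apply: ltr_wpDl; first by rewrite mulr_ge0 ?sqr_ge0 // exprn_ge0 // ltW.
  by rewrite mulr_gt0 // exprn_gt0.
move: pos; rewrite hN ltNge => /negP; apply.
rewrite mulr_le0_ge0 //; first by rewrite mulr_le0_ge0 // ltW.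
have hA : v * A <= - (u * C ^+ 2) by move: al0; rewrite /alpha [A * v]mulrC; lra.
have uC : 0 < u * C ^+ 2 by rewrite mulr_gt0 // exprn_gt0.
have k0 : 0 <= (3 * u ^+ 2 + a4 * v ^+ 2) * C ^+ 4.
  by case: msuit => _ _ h _; rewrite mulr_ge0 ?exprn_ge0 ?ltW.
apply: le_trans k0 _; rewrite -subr_ge0.
set x := v * A in hA *; set y := u * C ^+ 2 in hA uC *.
have -> : v ^+ 2 * A ^+ 2 - u * v * A * C ^+ 2 + u ^+ 2 * C ^+ 4 + a4 * v ^+ 2 * C ^+ 4 -
  (3 * u ^+ 2 + a4 * v ^+ 2) * C ^+ 4 = (- x - y) * (- x + 2 * y) by rewrite /x /y; ring.
by apply: mulr_ge0; lra.
Qed.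

(** A relation and not a function, because b is determined only modulo [aP]. The point at infinity
    corresponds to the principal form. *)
Definition form_of (P : ecpt) (f : bqf) : Prop :=
  match P with
  | None => f = (1, 0, d)
  | Some (x, y) => exists A B C b c, [/\ point_data a4 a6 x y A B C,
      (aP u v A C %| C ^+ 3 * b + v ^+ 2 * B)%Z, aP u v A C * c = b ^+ 2 + d &
      f = (aP u v A C, 2 * b, c)]
  end.

Lemma form_of_exists P : on_curve a4 a6 P -> exists f, form_of P f.
Proof.
case: P => [[x y]|_] /=; last by eexists.
move=> /point_dataP [A [B [C p]]].
have [b bE] := bP_exists dE_factor dsf B (pd_cA p).
have /dvdzP[c cE] := aP_dvd dE_factor dsf (pd_cA p) (pd_crv p) bE.
by exists (aP u v A C, 2 * b, c), A, B, C, b, c; split=> //; rewrite cE mulrC.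
Qed.

Lemma form_of_ppd P f : form_of P f -> ppd_form (- DE a4 a6 u v) f.
Proof.
case: P => [[x y]|] /= => [[A [B [C [b [c [p _ E ->]]]]]]|->]; split=> //.
- exact: form_primitive dsf d4 _ _ _ E.
- by apply: aP_gt0 => //; rewrite ?gt_eqF ?(alpha_gt0 (pd_C p) (pd_crv p)) ?(pd_C p).
- rewrite /bqf_disc /DE -/d; transitivity ((2 * b) ^+ 2 - 4 * (aP u v A C * c)); first by rewrite mulrA.
  by rewrite E; ring.
- by rewrite gcd1z gcd1z.
- by rewrite /bqf_disc /DE -/d; ring.
Qed.

Lemma repr_trivial (x y z al ga : int) : x * z = y ^+ 2 + d -> 0 < x ->
  x * al ^+ 2 + 2 * y * al * ga + z * ga ^+ 2 = 1 -> x = 1 \/ d <= x.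
Proof.
move=> E x0 E1; have h : x = (x * al + y * ga) ^+ 2 + d * ga ^+ 2.
  have -> : d = x * z - y ^+ 2 by rewrite E; ring.
  by rewrite -[LHS]mulr1 -E1; ring.
case: (eqVneq ga 0) => [g0|g0]; [left|right].
  move: E1; rewrite g0 mulr0 expr0n /= mulr0 !addr0 => E1.
  have : (x %| 1%R)%Z by rewrite -E1 dvdz_mulr.
  by rewrite dvdzE /= dvdn1 => /eqP; case: (x) x0 => [] [|[|]].
rewrite h -[leLHS]mulr1; apply: le_trans (_ : d * ga ^+ 2 <= _); last by rewrite lerDr sqr_ge0.
by rewrite ler_pM2l //; have : 0 < ga ^+ 2 by rewrite exprn_even_gt0.
Qed.

(** If aP = 1 then v = g divides C, and the denominator C^2 is at least v^2. If aP >= d then alpha v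
    >= d, while alpha is at most u + v times the larger of |numerator| and denominator. *)
Lemma aP_bound x y A B C : point_data a4 a6 x y A B C -> aP u v A C = 1 \/ d <= aP u v A C ->
  v ^+ 2 <= denq x \/ d <= v * (u + v) * Num.max `|numq x| (denq x).
Proof.
move=> p; have C0 := pd_C p; have al0 := alpha_gt0 C0 (pd_crv p).
have Cn : C != 0 by rewrite gt_eqF.
have g0 := gP_gt0 v Cn; have aE := alvE u v A C; have a0 := aP_gt0 v0 Cn al0.
rewrite (pd_num p) (pd_den p); case=> h; [left|right].
  have w1 : (v %/ gP v C)%Z = 1.
    have : ((v %/ gP v C)%Z %| 1%R)%Z by rewrite -h /aP dvdz_mull.
    rewrite dvdzE /= dvdn1 => /eqP.
    have : 0 <= (v %/ gP v C)%Z by rewrite divz_ge0 // ltW.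
    by case: (_ %/ _)%Z => [] [|[|]].
  have vC : (v %| C)%Z.
    by rewrite -(divzK (dvdz_gcdr C v)) -/(gP v C) w1 mul1r dvdz_gcdl.
  rewrite ler_pXn2r ?nnegrE //; [|exact: ltW|exact: ltW].
  have /dvdzP[k kE] := vC; rewrite kE ler_peMl //; first exact: ltW.
  have : 0 < k by move: C0; rewrite kE pmulr_lgt0.
  by [].
apply: le_trans h _; set H := Num.max _ _.
have H0 : 0 <= H by rewrite le_max normr_ge0.
have h1 : aP u v A C <= alpha u v A C * v.
  rewrite aE ler_peMl //; first exact: ltW.
  have : 0 < gP v C ^+ 2 by rewrite exprn_gt0.
  by [].
apply: le_trans h1 _; rewrite mulrC -mulrA ler_pM2l // /alpha.
have -> : (u + v) * H = H * v + u * H by ring.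
apply: lerD.
  rewrite ler_wpM2r //; first exact: ltW.
  by apply: le_trans (ler_norm _) _; rewrite le_max lexx.
rewrite ler_wpM2l //; first exact: ltW.
by rewrite le_max lexx orbT.
Qed.

Theorem class_kernel P Q f g : on_curve a4 a6 P -> on_curve a4 a6 Q -> P != Q ->
  form_of P f -> form_of Q g -> bqf_equiv f g ->
  forall x y, ec_add a4 P (ec_neg Q) = Some (x, y) ->
  v ^+ 2 <= denq x \/ d <= v * (u + v) * Num.max `|numq x| (denq x).
Proof.
move=> hP hQ nPQ.
have hN := on_curve_neg a4 a6.
case: P Q hP hQ nPQ => [[x1 y1]|] [[x2 y2]|] hP hQ nPQ //; last 2 first.
(* If Q = O, equivalence makes the form of P represent 1. If P = O, treated next, it makes [aP] a
   value al^2 + d ga^2 of the principal form. *)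
- move=> /= [A [B [C [b [c [p D E ->]]]]]] -> [al [be [ga [de [det [E1 _ _]]]]]] x y [<- _].
  apply: (aP_bound p); apply: (repr_trivial E _ (esym E1)).
  by apply: aP_gt0 => //; rewrite ?gt_eqF ?(alpha_gt0 (pd_C p) (pd_crv p)) ?(pd_C p).
- move=> /= -> [A [B [C [b [c [p D E ->]]]]]] [al [be [ga [de [det [E1 _ _]]]]]] x y [<- _].
  apply: (aP_bound p).
  rewrite E1 mul1r !mul0r addr0; case: (eqVneq ga 0) => [g0|g0]; [left|right].
    rewrite g0 expr0n /= mulr0 addr0; move: det; rewrite g0 mulr0 subr0 => det.
    have : (al %| 1%R)%Z by apply/dvdzP; exists de; rewrite mulrC.
    by rewrite dvdzE /= dvdn1 => /eqP; rewrite expr2; case: (al) => [] [|[|]].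
  rewrite -[leLHS]mulr1; apply: le_trans (_ : d * ga ^+ 2 <= _); last by rewrite lerDr sqr_ge0.
  by rewrite ler_pM2l //; have : 0 < ga ^+ 2 by rewrite exprn_even_gt0.
move=> [A1 [B1 [C1 [b1 [c1 [p1 D1 F1 ->]]]]]] [A2 [B2 [C2 [b2 [c2 [p2 D2 F2 ->]]]]]] equ x3 y3 S3.
have hQ' : on_curve a4 a6 (Some (x2, - y2)) by rewrite on_curve_opp.
have hS : on_curve a4 a6 (Some (x3, y3)) by rewrite -S3 ec_add_on // hN.
have nn : Some (x1, y1) != ec_neg (Some (x2, - y2)) by rewrite /= opprK.
have [mu [c [x3' [S3' e1 e2 k]]]] := ec_add_col hP hQ' nn.
move: S3' S3; rewrite /= => -> [ex e3]; rewrite ex in k e3.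
have [A3 [B3 [C3 p3]]] := point_dataP hS.
have [b3 D3] := bP_exists dE_factor dsf B3 (pd_cA p3).
have e3' : - y3 = mu * x3 + c.
  by rewrite -e3 opprK.
have q2 := pd_opp p2; have q3 := pd_opp p3.
have [l [n [L1 L2 L3 R1 [R2 R3]]]] := line_data k e1 e2 e3' p1 q2 q3.
case: equ => al [be [ga [de [det EQ]]]].
have p1' := alpha_gt0 (pd_C p1) (pd_crv p1); have p2' := alpha_gt0 (pd_C p2) (pd_crv p2).
have p3' := alpha_gt0 (pd_C p3) (pd_crv p3).
apply: (aP_bound p3).
have nz x y A B C : point_data a4 a6 x y A B C -> C != 0 by move=> p; rewrite gt_eqF ?(pd_C p).
exact: (equiv_kernel dE_factor v0 d0 dsf d4 (nz _ _ _ _ _ p1) (nz _ _ _ _ _ p2) (nz _ _ _ _ _ p3)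
  (pd_cA p1) (pd_cA p2) (pd_cA p3) (pd_cB p1) (pd_cB p2) (pd_cB p3)
  (pd_crv p1) (pd_crv p2) (pd_crv p3) p1' p2' p3' L1 L2 L3 R1 R2 R3 D1 D2 D3 F1 F2 det EQ).
Qed.
End Class.

(** * Duplication and the naive height *)

Section Doubling.
Variable R : comNzRingType.
Implicit Types a b x z : R.
(** With [dupG], the homogeneous numerator and denominator of x(2P) when x(P) = x/z. *)
Definition dupF a b x z := x ^+ 4 - 2 * a * x ^+ 2 * z ^+ 2 - 8 * b * x * z ^+ 3 + a ^+ 2 * z ^+ 4.
Definition dupG a b x z := 4 * z * (x ^+ 3 + a * x * z ^+ 2 + b * z ^+ 3).
Definition cdisc a b := 4 * a ^+ 3 + 27 * b ^+ 2.

(** Together with [dup_elimZ] this is the resultant identity for numerator and denominator: one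
    isolates z^7, the other x^7. They limit how small both can be at once, at every prime and at the
    real place. *)
Lemma dup_elimX a b x z :
  (12 * x ^+ 2 * z + 16 * a * z ^+ 3) * dupF a b x z
  - (3 * x ^+ 3 - 5 * a * x * z ^+ 2 - 27 * b * z ^+ 3) * dupG a b x z = 4 * cdisc a b * z ^+ 7.
Proof. rewrite /dupF /dupG /cdisc; ring. Qed.

Lemma dup_elimZ a b x z :
  (4 * cdisc a b * x ^+ 3 - 4 * a ^+ 2 * b * x ^+ 2 * z + 4 * a * (3 * a ^+ 3 + 22 * b ^+ 2) * x * z ^+ 2
    + 12 * b * (a ^+ 3 + 8 * b ^+ 2) * z ^+ 3) * dupF a b x z
  + (a ^+ 2 * b * x ^+ 3 + a * (5 * a ^+ 3 + 32 * b ^+ 2) * x ^+ 2 * z + 2 * b * (13 * a ^+ 3 + 96 * b ^+ 2) * x * z ^+ 2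
    - 3 * a ^+ 2 * (a ^+ 3 + 8 * b ^+ 2) * z ^+ 3) * dupG a b x z = 4 * cdisc a b * x ^+ 7.
Proof. rewrite /dupF /dupG /cdisc; ring. Qed.
End Doubling.

(** * Duplication at the finite places *)

Section PadicNorm.
Variable p : nat.
Hypothesis hp : prime p.

(** An absolute value rather than a valuation, so that 0 needs no infinite value and maxima replace
    minima. *)
Definition pnorm (n : int) : rat := if n == 0 then 0 else (p%:R ^- logn p `|n|).

Lemma pnorm_ge0 n : 0 <= pnorm n.
Proof. by rewrite /pnorm; case: eqP => // _; rewrite invr_ge0 exprn_ge0. Qed.

Let p0 : 0 < p%:R :> rat. Proof. by rewrite ltr0n prime_gt0. Qed.

Lemma pnormM m n : pnorm (m * n) = pnorm m * pnorm n.
Proof.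
rewrite /pnorm mulf_eq0; case: (eqVneq m 0) => [_|m0] /=; first by rewrite mul0r.
case: (eqVneq n 0) => [_|n0] /=; first by rewrite mulr0.
by rewrite abszM lognM ?absz_gt0 // exprD invfM.
Qed.

Lemma pnormX m k : pnorm (m ^+ k) = pnorm m ^+ k.
Proof.
elim: k => [|k IH]; first by rewrite !expr0 /pnorm /= logn1 expr0 invr1.
by rewrite !exprS pnormM IH.
Qed.

Lemma pnormN m : pnorm (- m) = pnorm m.
Proof. by rewrite /pnorm oppr_eq0 abszN. Qed.

Lemma pnorm_le1 n : pnorm n <= 1.
Proof.
rewrite /pnorm; case: eqP => // _; rewrite invf_le1 ?exprn_gt0 // exprn_ege1 //.
by rewrite ler1n prime_gt0.
Qed.

Lemma pnorm_gt0 n : n != 0 -> 0 < pnorm n.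
Proof. by rewrite /pnorm => /negbTE->; rewrite invr_gt0 exprn_gt0. Qed.

Lemma pnorm_le m n : m != 0 -> n != 0 -> (pnorm m <= pnorm n) = (logn p `|n| <= logn p `|m|)%N.
Proof.
move=> m0 n0; rewrite /pnorm (negbTE m0) (negbTE n0) lef_pV2 ?posrE ?exprn_gt0 //.
by rewrite ler_eXn2l // ltr1n prime_gt1.
Qed.

Lemma pnormD m n : pnorm (m + n) <= Num.max (pnorm m) (pnorm n).
Proof.
have [->|m0] := eqVneq m 0; first by rewrite add0r le_max lexx orbT.
have [->|n0] := eqVneq n 0; first by rewrite addr0 le_max lexx.
have [->|mn0] := eqVneq (m + n) 0; first by rewrite {1}/pnorm eqxx le_max pnorm_ge0.
rewrite le_max !pnorm_le //; set i := logn p `|m|; set j := logn p `|n|.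
have h : (p ^ minn i j %| absz (m + n)%R)%N.
  rewrite -[(p ^ _)%N]absz_nat -dvdzE; apply: rpredD; rewrite dvdzE /=.
    by rewrite (dvdn_trans (dvdn_exp2l p (geq_minl i j))) // pfactor_dvdnn.
  by rewrite (dvdn_trans (dvdn_exp2l p (geq_minr i j))) // pfactor_dvdnn.
move: h; rewrite pfactor_dvdn ?absz_gt0 // => h.
by case: (leqP i j) h => ij h; rewrite h ?orbT.
Qed.

Lemma pnorm_abs n : pnorm `|n|%N = pnorm n.
Proof. by case: (ger0P n) => h; rewrite /pnorm absz_nat -!absz_eq0 absz_nat. Qed.

Lemma pnorm_gcd m n : pnorm (gcdn `|m| `|n|) = Num.max (pnorm m) (pnorm n).
Proof.
have z : pnorm 0 = 0 by rewrite /pnorm eqxx.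
have [->|m0] := eqVneq m 0; first by rewrite gcd0n pnorm_abs z max_r // pnorm_ge0.
have [->|n0] := eqVneq n 0; first by rewrite gcdn0 pnorm_abs z max_l // pnorm_ge0.
have g0 : Posz (gcdn `|m| `|n|) != 0 by rewrite eqz_nat -lt0n gcdn_gt0 absz_gt0 m0.
rewrite {1}/pnorm (negbTE g0) absz_nat logn_gcd ?absz_gt0 // /pnorm (negbTE m0) (negbTE n0).
case: (leqP (logn p `|m|) (logn p `|n|)) => h.
  rewrite max_l // lef_pV2 ?posrE ?exprn_gt0 // ler_eXn2l // ltr1n prime_gt1 //.
rewrite max_r // lef_pV2 ?posrE ?exprn_gt0 // ler_eXn2l ?(ltnW h) // ltr1n prime_gt1 //.
Qed.
End PadicNorm.

Lemma dvdn_pnorm (m n : int) : m != 0 -> n != 0 ->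
  (forall p, prime p -> pnorm p n <= pnorm p m) -> (`|m| %| `|n|)%N.
Proof.
move=> m0 n0 h; have m1 : (0 < `|m|)%N by rewrite absz_gt0.
apply/dvdn_partP => // p; rewrite mem_primes => /andP[hp _].
by rewrite p_part pfactor_dvdn ?absz_gt0 // -pnorm_le // h.
Qed.

(* [wbound p g W t z i j]: z has weight i in the scale g^(1/6) and degree j in the scale W^(1/6) *)
Section LocalDoubling.
Variables (p : nat) (hp : prime p) (a b x z k : int).
Let N := pnorm p.
Variables (ga W : rat).
Hypothesis (ga0 : 0 < ga) (W0 : 0 < W).
Hypothesis (hk : k != 0) (k3 : N 3 <= N k).
Hypothesis (haK : N a ^+ 3 <= N k ^+ 3 * ga) (hb : N b ^+ 2 <= ga).
Hypothesis (hx : N x ^+ 6 <= W) (hz : ga * N z ^+ 6 <= W).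
Hypothesis (hW : W = N x ^+ 6 \/ W = ga * N z ^+ 6).

Definition wbound (t : bool) (n : int) (i j : int) : Prop :=
  N n ^+ 6 <= (if t then N k ^+ 6 else 1) * ga ^ i * W ^ j.

Let N0 n : 0 <= N n := pnorm_ge0 p n.
Let k1 : N k <= 1 := pnorm_le1 hp k.
Let ga1 : ga != 0. Proof. by rewrite gt_eqF. Qed.
Let W1 : W != 0. Proof. by rewrite gt_eqF. Qed.

Lemma wboundW t n i j : wbound t n i j -> wbound false n i j.
Proof.
case: t => //; rewrite /wbound mul1r => h; apply: le_trans h _.
rewrite -mulrA ler_piMl //; last by rewrite exprn_ile1.
by rewrite mulr_ge0 // exprz_ge0 // ltW.
Qed.

Lemma wboundM t t' n n' i i' j j' : wbound t n i j -> wbound t' n' i' j' ->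
  wbound (t || t') (n * n') (i + i') (j + j').
Proof.
rewrite /wbound => h h'; rewrite /N pnormM // exprMn !expfzDr //.
have := ler_pM (exprn_ge0 6 (N0 n)) (exprn_ge0 6 (N0 n')) h h'.
move=> H; apply: le_trans H _.
set A := ga ^ i; set B := W ^ j; set A' := ga ^ i'; set B' := W ^ j'.
have A0 : 0 <= A by rewrite exprz_ge0 // ltW.
have A0' : 0 <= A' by rewrite exprz_ge0 // ltW.
have B0 : 0 <= B by rewrite exprz_ge0 // ltW.
have B0' : 0 <= B' by rewrite exprz_ge0 // ltW.
set c := if t then _ else _; set c' := if t' then _ else _.
have -> : c * A * B * (c' * A' * B') = (c * c') * (A * A' * (B * B')) by ring.
rewrite -[leRHS]mulrA ler_wpM2r ?mulr_ge0 //.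
have hk6 : N k ^+ 6 <= 1 by rewrite exprn_ile1.
have hk0 : 0 <= N k ^+ 6 by rewrite exprn_ge0.
by rewrite /c /c'; case: t t' {h h' c c'} => [] [] /=; rewrite ?mulr1 ?mul1r // ler_piMl.
Qed.

Lemma wboundD t n n' i j : wbound t n i j -> wbound t n' i j -> wbound t (n + n') i j.
Proof.
rewrite /wbound => h h'; have := pnormD hp n n'; rewrite le_max => /orP[H|H].
  by apply: le_trans h; rewrite lerXn2r ?nnegrE.
by apply: le_trans h'; rewrite lerXn2r ?nnegrE.
Qed.

Lemma wboundN t n i j : wbound t n i j -> wbound t (- n) i j.
Proof. by rewrite /wbound /N pnormN. Qed.

Lemma wboundB t n n' i j : wbound t n i j -> wbound t n' i j -> wbound t (n - n') i j.
Proof. by move=> h h'; apply: wboundD => //; apply: wboundN. Qed.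

Lemma wboundX t n i j m : wbound t n i j -> wbound t (n ^+ m.+1) (i * m.+1%:Z) (j * m.+1%:Z).
Proof.
move=> h; elim: m => [|m IH]; first by rewrite !mulr1.
have := wboundM h IH; rewrite orbb -exprS.
by congr (wbound _ _ _ _); rewrite -[m.+2]addn1 PoszD; ring.
Qed.

Lemma wbound_const c : wbound false c 0 0.
Proof. by rewrite /wbound !expr0z !mulr1 exprn_ile1 // pnorm_le1. Qed.
(** The Boolean of [wbound] records a gain [N k ^+ 6]. It has two sources, the constant 3 and the
    coefficient a, and a product keeps it as soon as one factor has it; each cofactor below is
    grouped so that every term contains a source. *)
Lemma wbound3 c : wbound true (3 * c) 0 0.
Proof.
apply: (@wboundM true false 3 c 0 0 0 0); last exact: wbound_const.
by rewrite /wbound !expr0z !mulr1 lerXn2r ?nnegrE.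
Qed.
Lemma wbound_a : wbound true a 2 0.
Proof.
rewrite /wbound expr0z mulr1; have := haK.
by rewrite -(ler_pXn2r (n := 2)) ?nnegrE ?mulr_ge0 ?exprn_ge0 ?(ltW ga0) // -exprM exprMn -exprM.
Qed.
Lemma wbound_b : wbound false b 3 0.
Proof.
rewrite /wbound expr0z mulr1 mul1r; have := hb.
by rewrite -(ler_pXn2r (n := 3)) ?nnegrE ?exprn_ge0 ?(ltW ga0) // -exprM.
Qed.
Lemma wbound_x : wbound false x 0 1. Proof. by rewrite /wbound expr0z !mul1r expr1z. Qed.
Lemma wbound_z : wbound false z (-1) 1.
Proof. by rewrite /wbound expr1z mul1r exprN1 mulrC ler_pdivlMr // mulrC. Qed.

Lemma wbound_cast t t' n n' i i' j j' : wbound t n i j -> t = t' -> n = n' -> i = i' -> j = j' ->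
  wbound t' n' i' j'.
Proof. by move=> h <- <- <- <-. Qed.

Let wx := wbound_x. Let wz := wbound_z. Let wa := wbound_a. Let wb := wbound_b.
Let wc := wbound_const. Let w3 := wbound3.

Let wa3 : wbound true (a ^+ 3) 6 0. Proof. exact: wbound_cast (wboundX 2 wa) _ _ _ _. Qed.
Let wb2 : wbound false (b ^+ 2) 6 0. Proof. exact: wbound_cast (wboundX 1 wb) _ _ _ _. Qed.

Lemma wbound_cdisc : wbound true (cdisc a b) 6 0.
Proof.
apply: wboundD; first exact: wbound_cast (wboundM (wc 4) wa3) _ _ _ _.
by apply: (wbound_cast (wboundM (w3 9) wb2)) => //; ring.
Qed.

Lemma wbound_U : wbound true (12 * x ^+ 2 * z + 16 * a * z ^+ 3) (-1) 3.
Proof.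
apply: wboundD.
  by apply: (wbound_cast (wboundM (wboundM (w3 4) (wboundX 1 wx)) wz)) => //; ring.
by apply: (wbound_cast (wboundM (wboundM (wc 16) wa) (wboundX 2 wz))).
Qed.

Lemma wbound_V : wbound true (3 * x ^+ 3 - 5 * a * x * z ^+ 2 - 27 * b * z ^+ 3) 0 3.
Proof.
apply: wboundB; [apply: wboundB|].
- by apply: (wbound_cast (wboundM (w3 1) (wboundX 2 wx))) => //; ring.
- by apply: (wbound_cast (wboundM (wboundM (wboundM (wc 5) wa) wx) (wboundX 1 wz))).
- by apply: (wbound_cast (wboundM (wboundM (w3 9) wb) (wboundX 2 wz))) => //; ring.
Qed.

Lemma wbound_U1 : wbound true (4 * cdisc a b * x ^+ 3 - 4 * a ^+ 2 * b * x ^+ 2 * z +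
    4 * a * (3 * a ^+ 3 + 22 * b ^+ 2) * x * z ^+ 2 + 12 * b * (a ^+ 3 + 8 * b ^+ 2) * z ^+ 3) 6 3.
Proof.
apply: wboundD; [apply: wboundD; [apply: wboundB|]|].
- by apply: (wbound_cast (wboundM (wboundM (wc 4) wbound_cdisc) (wboundX 2 wx))).
- by apply: (wbound_cast (wboundM (wboundM (wboundM (wboundM (wc 4) (wboundX 1 wa)) wb) (wboundX 1 wx)) wz)).
- have h : wbound false (3 * a ^+ 3 + 22 * b ^+ 2) 6 0.
    by apply: wboundD; [exact: wbound_cast (wboundW (wboundM (wc 3) wa3)) _ _ _ _
                       |exact: wbound_cast (wboundM (wc 22) wb2) _ _ _ _].
  by apply: (wbound_cast (wboundM (wboundM (wboundM (wboundM (wc 4) wa) h) wx) (wboundX 1 wz))).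
- have h : wbound false (a ^+ 3 + 8 * b ^+ 2) 6 0.
    by apply: wboundD; [exact: wbound_cast (wboundW wa3) _ _ _ _
                       |exact: wbound_cast (wboundM (wc 8) wb2) _ _ _ _].
  by apply: (wbound_cast (wboundM (wboundM (wboundM (w3 4) wb) h) (wboundX 2 wz))) => //; ring.
Qed.

Lemma wbound_V1 : wbound true (a ^+ 2 * b * x ^+ 3 + a * (5 * a ^+ 3 + 32 * b ^+ 2) * x ^+ 2 * z +
    2 * b * (13 * a ^+ 3 + 96 * b ^+ 2) * x * z ^+ 2 - 3 * a ^+ 2 * (a ^+ 3 + 8 * b ^+ 2) * z ^+ 3) 7 3.
Proof.
apply: wboundB; [apply: wboundD; [apply: wboundD|]|].
- by apply: (wbound_cast (wboundM (wboundM (wboundX 1 wa) wb) (wboundX 2 wx))).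
- have h : wbound false (5 * a ^+ 3 + 32 * b ^+ 2) 6 0.
    by apply: wboundD; [exact: wbound_cast (wboundW (wboundM (wc 5) wa3)) _ _ _ _
                       |exact: wbound_cast (wboundM (wc 32) wb2) _ _ _ _].
  by apply: (wbound_cast (wboundM (wboundM (wboundM wa h) (wboundX 1 wx)) wz)).
- have h : wbound true (13 * a ^+ 3 + 96 * b ^+ 2) 6 0.
    apply: wboundD; first exact: wbound_cast (wboundM (wc 13) wa3) _ _ _ _.
    by apply: (wbound_cast (wboundM (w3 32) wb2)) => //; ring.
  by apply: (wbound_cast (wboundM (wboundM (wboundM (wboundM (wc 2) wb) h) wx) (wboundX 1 wz))).
- have h : wbound false (a ^+ 3 + 8 * b ^+ 2) 6 0.
    by apply: wboundD; [exact: wbound_cast (wboundW wa3) _ _ _ _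
                       |exact: wbound_cast (wboundM (wc 8) wb2) _ _ _ _].
  by apply: (wbound_cast (wboundM (wboundM (wboundM (wc 3) (wboundX 1 wa)) h) (wboundX 2 wz))).
Qed.

(** Whichever of x and z attains W, the identity isolating its seventh power is used. The cofactors
    have degree 3 and the isolated power degree 7 in the scale of W; the difference is the exponent
    4. *)
Lemma local_doubling :
  N (4 * cdisc a b) ^+ 6 * W ^+ 4 <=
  N k ^+ 6 * ga ^+ 6 * Num.max (N (dupF a b x z) ^+ 6) (ga * N (dupG a b x z) ^+ 6).
Proof.
set D := N _; set f := N (dupF _ _ _ _); set g := N (dupG _ _ _ _); set M := Num.max _ _.
have M0 : 0 <= M by rewrite le_max exprn_ge0 // N0.
have fM : f ^+ 6 <= M by rewrite le_max lexx.
have gM : ga * g ^+ 6 <= M by rewrite le_max lexx orbT.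
have c0 : 0 <= N k ^+ 6 by rewrite exprn_ge0 // N0.
have W3 : 0 < W ^+ 3 by rewrite exprn_gt0.
rewrite -(ler_pM2r W3).
(* The ultrametric inequality makes one of the two terms dominate. The denominator carries one more
   power of [ga] than the numerator, hence the weights i and i + 1. *)
have comb A B C (i : int) (s : rat) : 0 <= s -> (4 * cdisc a b * C = A * dupF a b x z + B * dupG a b x z) ->
   wbound true A i 3 -> wbound true B (i + 1) 3 ->
   D ^+ 6 * N C ^+ 6 <= N k ^+ 6 * ga ^ i * W ^+ 3 * M.
  move=> s0 E hA hB; rewrite -exprMn -pnormM // -/N E.
  have := pnormD hp (A * dupF a b x z) (B * dupG a b x z); rewrite le_max => /orP[] H.
    apply: le_trans (_ : N (A * dupF a b x z) ^+ 6 <= _); first by rewrite lerXn2r ?nnegrE // N0.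
    by rewrite /N pnormM // exprMn ler_pM ?exprn_ge0 ?N0.
  apply: le_trans (_ : N (B * dupG a b x z) ^+ 6 <= _); first by rewrite lerXn2r ?nnegrE // N0.
  rewrite /N pnormM // exprMn.
  have := hB; rewrite /wbound expfzDr // expr1z => hB'.
  apply: le_trans (ler_wpM2r _ hB') _; first by rewrite exprn_ge0 // N0.
  have -> : N k ^+ 6 * (ga ^ i * ga) * W ^ 3 * pnorm p (dupG a b x z) ^+ 6 =
    N k ^+ 6 * ga ^ i * W ^+ 3 * (ga * g ^+ 6) by rewrite /g -/N; ring.
  rewrite ler_wpM2l // mulr_ge0 ?(ltW W3) // mulr_ge0 // exprz_ge0 //; exact: ltW.
have EX := dup_elimX a b x z; have EZ := dup_elimZ a b x z.
case: hW => hWE.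
  have := comb _ _ (x ^+ 7) 6 1 ler01 (esym EZ) wbound_U1 wbound_V1.
  rewrite /N pnormX // -/N -exprM mulnC exprM -hWE => h.
  apply: le_trans (_ : D ^+ 6 * W ^+ 7 <= _); first by rewrite -mulrA -exprD.
  by apply: le_trans h _; rewrite mulrAC.
have EX' : 4 * cdisc a b * z ^+ 7 = (12 * x ^+ 2 * z + 16 * a * z ^+ 3) * dupF a b x z +
   (- (3 * x ^+ 3 - 5 * a * x * z ^+ 2 - 27 * b * z ^+ 3)) * dupG a b x z by rewrite mulNr -EX.
have := comb _ _ (z ^+ 7) (-1) 1 ler01 EX' wbound_U (wboundN wbound_V).
rewrite /N pnormX // -/N -exprM mulnC exprM => h.
have h' := ler_wpM2l (exprn_ge0 7 (ltW ga0)) h.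
apply: le_trans (_ : ga ^+ 7 * (D ^+ 6 * (N z ^+ 6) ^+ 7) <= _).
  by rewrite -mulrA -exprD /= [in W ^+ _]hWE exprMn; rewrite le_eqVlt; apply/orP; left; apply/eqP; ring.
apply: le_trans h' _; rewrite exprN1 le_eqVlt; apply/orP; left; apply/eqP; field.
exact: ga1.
Qed.
End LocalDoubling.

(** The p-adic absolute value of this number is the W of the local estimate. Sixth powers avoid the
    root g^(1/6), as gcd(a^3, b^2) has weight 6. *)
Definition wgcd (g : nat) (x z : int) : nat := gcdn (`|x| ^ 6) (g * `|z| ^ 6).

Lemma wgcdE g x z : wgcd g x z = gcdn (absz (x ^+ 6)) (absz (g%:Z * z ^+ 6)).
Proof. by rewrite /wgcd abszM !abszX absz_nat. Qed.

Section Global.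
Variables (a b : int).
Hypothesis D0 : cdisc a b != 0.
Definition abgcd (a b : int) : nat := gcdn (`|a| ^ 3) (`|b| ^ 2).
Let g := abgcd a b.

Lemma abgcd_gt0 : (0 < g)%N.
Proof.
rewrite /g /abgcd gcdn_gt0 !expn_gt0 !absz_gt0 !orbF.
apply: contraNT D0; rewrite negb_or !negbK => /andP[/eqP-> /eqP->].
by rewrite /cdisc !expr0n /= !mulr0.
Qed.

Lemma wgcd_gt0 x z : (x != 0) || (z != 0) -> (0 < wgcd g x z)%N.
Proof.
rewrite /wgcd gcdn_gt0 muln_gt0 abgcd_gt0 !expn_gt0 !absz_gt0 !orbF; by [].
Qed.

Lemma dup_neq0 x z : (x != 0) || (z != 0) -> (dupF a b x z != 0) || (dupG a b x z != 0).
Proof.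
apply: contraLR; rewrite !negb_or !negbK => /andP[/eqP F0 /eqP G0].
have h : 4 * cdisc a b != 0 by rewrite mulf_neq0.
have := dup_elimX a b x z; have := dup_elimZ a b x z.
rewrite F0 G0 !mulr0 ?subr0 ?addr0 => /esym/eqP; rewrite mulf_eq0 (negbTE h) expf_eq0 /= => ->.
by move=> /esym/eqP; rewrite mulf_eq0 (negbTE h) expf_eq0 /= => ->.
Qed.

(** The inequality is proved as a divisibility, which is the conjunction of the local estimates at
    all primes. *)
Theorem global_doubling (k : nat) x z : (0 < k)%N -> (k %| 3)%N -> (k ^ 3 * g %| `|a| ^ 3)%N ->
  (x != 0) || (z != 0) ->
  (k ^ 6 * g ^ 6 * wgcd g (dupF a b x z) (dupG a b x z) <=
   (4 * `|cdisc a b|) ^ 6 * wgcd g x z ^ 4)%N.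
Proof.
move=> k0 k3 hk xz; have g0 := abgcd_gt0.
have w0 := wgcd_gt0 xz; have w0' := wgcd_gt0 (dup_neq0 xz).
have n2 : (0 < (4 * `|cdisc a b|) ^ 6 * wgcd g x z ^ 4)%N.
  by rewrite muln_gt0 !expn_gt0 w0 /= muln_gt0 /= absz_gt0 D0.
apply: (dvdn_leq n2).
pose m1 : int := (k ^ 6 * g ^ 6 * wgcd g (dupF a b x z) (dupG a b x z))%N%:Z.
pose m2 : int := (4 * cdisc a b) ^+ 6 * (wgcd g x z)%:Z ^+ 4.
have -> : ((4 * `|cdisc a b|) ^ 6 * wgcd g x z ^ 4)%N = `|m2|%N.
  by rewrite /m2 abszM !abszX abszM.
have -> : (k ^ 6 * g ^ 6 * wgcd g (dupF a b x z) (dupG a b x z))%N = `|m1|%N by [].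
apply: dvdn_pnorm.
- by rewrite /m1 eqz_nat -lt0n 2!muln_gt0 2!expn_gt0 k0 g0 w0'.
- by rewrite -absz_gt0 /m2 abszM !abszX abszM absz_nat.
move=> p hp.
have E1 : pnorm p (wgcd g x z) = Num.max (pnorm p x ^+ 6) (pnorm p g * pnorm p z ^+ 6).
  by rewrite wgcdE pnorm_gcd // pnormX // pnormM // pnormX.
have E2 : pnorm p (wgcd g (dupF a b x z) (dupG a b x z)) =
   Num.max (pnorm p (dupF a b x z) ^+ 6) (pnorm p g * pnorm p (dupG a b x z) ^+ 6).
  by rewrite wgcdE pnorm_gcd // pnormX // pnormM // pnormX.
have pX (n : nat) i : pnorm p (n ^ i)%N = pnorm p n ^+ i.
  by rewrite -pnormX //; congr pnorm; elim: i => // i IH; rewrite expnS PoszM IH exprS.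
have -> : pnorm p m2 = pnorm p (4 * cdisc a b) ^+ 6 * pnorm p (wgcd g x z) ^+ 4.
  by rewrite /m2 pnormM // 2!pnormX.
have -> : pnorm p m1 = pnorm p k ^+ 6 * pnorm p g ^+ 6 * pnorm p (wgcd g (dupF a b x z) (dupG a b x z)).
  by rewrite /m1 2!PoszM 2?pnormM // 2!pX.
rewrite E1 E2.
have Gg : pnorm p g = Num.max (pnorm p a ^+ 3) (pnorm p b ^+ 2).
  rewrite /g /abgcd -!pnormX // -pnorm_gcd //; congr (pnorm _ (Posz (gcdn _ _))); by rewrite abszX.
have Pg : 0 < pnorm p g by rewrite pnorm_gt0 // eqz_nat -lt0n.
apply: local_doubling => //.
- by rewrite -E1 pnorm_gt0 // eqz_nat -lt0n.
- have /dvdnP[q qE] := k3.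
  by rewrite (_ : 3 = (q%:Z * k%:Z)) ?pnormM ?ler_piMl ?pnorm_le1 ?pnorm_ge0 // -PoszM -qE.
- rewrite -pnormX //.
  have /dvdnP[q qE] := hk; rewrite -pnorm_abs abszX qE 2!PoszM pnormM // pnormM // pX.
  by rewrite ler_piMl ?pnorm_le1 // mulr_ge0 ?exprn_ge0 ?pnorm_ge0.
- by rewrite Gg le_max lexx orbT.
- by rewrite le_max lexx.
- by rewrite le_max lexx orbT.
- by case: (leP (pnorm p x ^+ 6)) => _; [right|left].
Qed.
End Global.

(** * Duplication at the real place *)

Section Arch.
Variable R : realFieldType.
Implicit Types a b x z t : R.

Lemma normD_le (x y p q : R) : `|x| <= p -> `|y| <= q -> `|x + y| <= p + q.
Proof. by move=> h1 h2; apply: le_trans (ler_normD _ _) _; apply: lerD. Qed.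
Lemma normB_le (x y p q : R) : `|x| <= p -> `|y| <= q -> `|x - y| <= p + q.
Proof. by move=> h1 h2; apply: normD_le; rewrite ?normrN. Qed.
Lemma normM_le (x y p q : R) : `|x| <= p -> `|y| <= q -> `|x * y| <= p * q.
Proof. by move=> h1 h2; rewrite normrM ler_pM. Qed.
Lemma normX_le1 (x : R) n : `|x| <= 1 -> `|x ^+ n| <= 1.
Proof. by move=> h; rewrite normrX exprn_ile1. Qed.
Lemma normc_le (c x p : R) : 0 <= c -> `|x| <= p -> `|c * x| <= c * p.
Proof. by move=> c0 h; apply: normM_le => //; rewrite ger0_norm. Qed.

(** 619 = 336 + 283 adds the bounds for the two cofactors of [dup_elimZ] on the unit box, where
    |cdisc| <= 31. The cofactors of [dup_elimX] need only 28 + 35. *)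
Lemma unit_doubling a b x z : `|a| <= 1 -> `|b| <= 1 -> `|x| <= 1 -> `|z| <= 1 ->
  `|x| = 1 \/ `|z| = 1 ->
  4 * `|cdisc a b| <= 619 * Num.max `|dupF a b x z| `|dupG a b x z|.
Proof.
move=> ha hb hx hz h1; set M := Num.max _ _.
have FM : `|dupF a b x z| <= M by rewrite le_max lexx.
have GM : `|dupG a b x z| <= M by rewrite le_max lexx orbT.
have M0 : 0 <= M by apply: le_trans FM.
have X := normX_le1.
have le1M (u w : R) : `|u| <= 1 -> `|w| <= 1 -> `|u * w| <= 1.
  by move=> hu hw; rewrite normrM mulr_ile1.
have N c : `|c%:R : R| <= c%:R by rewrite normr_nat.
have C c (u : R) : `|u| <= 1 -> `|c%:R * u| <= c%:R by move=> h; rewrite normrM normr_nat ler_piMr.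
have C2 c (u w : R) : `|u| <= 1 -> `|w| <= 1 -> `|c%:R * u * w| <= c%:R.
  by move=> hu hw; rewrite -mulrA; apply: (C); apply: (le1M).
have C3 c (u w y : R) : `|u| <= 1 -> `|w| <= 1 -> `|y| <= 1 -> `|c%:R * u * w * y| <= c%:R.
  by move=> hu hw hy; rewrite -2!mulrA; apply: (C); apply: (le1M) => //; apply: (le1M).
have hD : `|cdisc a b| <= 31.
  by rewrite /cdisc; apply: le_trans (normD_le (C 4 _ (X _ 3 ha)) (C 27 _ (X _ 2 hb))) _; lra.
have D4 : 0 <= 4 * `|cdisc a b| by rewrite mulr_ge0.
case: h1 => e1.
- 
  have E : `|4 * cdisc a b * x ^+ 7| = 4 * `|cdisc a b|.
    by rewrite 2!normrM normrX e1 expr1n mulr1 normr_nat.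
  rewrite -E -(dup_elimZ a b x z).
  set U := (X in X * dupF _ _ _ _ + _); set V := (X in _ + X * dupG _ _ _ _).
  have hU : `|U| <= 336.
    rewrite /U.
    have h1 : `|4 * cdisc a b * x ^+ 3| <= 124.
      have := normM_le (normM_le (N 4) hD) (X _ 3 hx); lra.
    have h2 : `|4 * a ^+ 2 * b * x ^+ 2 * z| <= 4 by rewrite -[_ * z]mulrA; apply: (C3) => //; [exact: X|rewrite le1M ?X].
    have h3 : `|3 * a ^+ 3 + 22 * b ^+ 2| <= 25 by apply: le_trans (normD_le (C 3 _ (X _ 3 ha)) (C 22 _ (X _ 2 hb))) _; lra.
    have h3' : `|4 * a * (3 * a ^+ 3 + 22 * b ^+ 2) * x * z ^+ 2| <= 4 * 25.
      have -> : 4 * a * (3 * a ^+ 3 + 22 * b ^+ 2) * x * z ^+ 2 = (4 * a * x * z ^+ 2) * (3 * a ^+ 3 + 22 * b ^+ 2) by ring.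
      by apply: normM_le => //; apply: (C3) => //; exact: X.
    have h4 : `|a ^+ 3 + 8 * b ^+ 2| <= 9 by apply: le_trans (normD_le (X _ 3 ha) (C 8 _ (X _ 2 hb))) _; lra.
    have h4' : `|12 * b * (a ^+ 3 + 8 * b ^+ 2) * z ^+ 3| <= 12 * 9.
      have -> : 12 * b * (a ^+ 3 + 8 * b ^+ 2) * z ^+ 3 = (12 * b * z ^+ 3) * (a ^+ 3 + 8 * b ^+ 2) by ring.
      by apply: normM_le => //; apply: (C2) => //; exact: X.
    apply: le_trans (normD_le (normD_le (normB_le h1 h2) h3') h4') _; lra.
  have hV : `|V| <= 283.
    rewrite /V.
    have h1 : `|a ^+ 2 * b * x ^+ 3| <= 1 by rewrite -mulrA; apply: (le1M); [exact: X|apply: (le1M) => //; exact: X].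
    have h2 : `|5 * a ^+ 3 + 32 * b ^+ 2| <= 37 by apply: le_trans (normD_le (C 5 _ (X _ 3 ha)) (C 32 _ (X _ 2 hb))) _; lra.
    have h2' : `|a * (5 * a ^+ 3 + 32 * b ^+ 2) * x ^+ 2 * z| <= 1 * 37.
      have -> : a * (5 * a ^+ 3 + 32 * b ^+ 2) * x ^+ 2 * z = (a * (x ^+ 2 * z)) * (5 * a ^+ 3 + 32 * b ^+ 2) by ring.
      by apply: normM_le => //; apply: (le1M) => //; apply: (le1M) => //; exact: X.
    have h3 : `|13 * a ^+ 3 + 96 * b ^+ 2| <= 109 by apply: le_trans (normD_le (C 13 _ (X _ 3 ha)) (C 96 _ (X _ 2 hb))) _; lra.
    have h3' : `|2 * b * (13 * a ^+ 3 + 96 * b ^+ 2) * x * z ^+ 2| <= 2 * 109.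
      have -> : 2 * b * (13 * a ^+ 3 + 96 * b ^+ 2) * x * z ^+ 2 = (2 * b * x * z ^+ 2) * (13 * a ^+ 3 + 96 * b ^+ 2) by ring.
      by apply: normM_le => //; apply: (C3) => //; exact: X.
    have h4 : `|a ^+ 3 + 8 * b ^+ 2| <= 9 by apply: le_trans (normD_le (X _ 3 ha) (C 8 _ (X _ 2 hb))) _; lra.
    have h4' : `|3 * a ^+ 2 * (a ^+ 3 + 8 * b ^+ 2) * z ^+ 3| <= 3 * 9.
      have -> : 3 * a ^+ 2 * (a ^+ 3 + 8 * b ^+ 2) * z ^+ 3 = (3 * a ^+ 2 * z ^+ 3) * (a ^+ 3 + 8 * b ^+ 2) by ring.
      by apply: normM_le => //; apply: (C2) => //; exact: X.
    apply: le_trans (normB_le (normD_le (normD_le h1 h2') h3') h4') _; lra.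
  by apply: le_trans (normD_le (normM_le hU FM) (normM_le hV GM)) _; lra.
- have E : `|4 * cdisc a b * z ^+ 7| = 4 * `|cdisc a b|.
    by rewrite 2!normrM normrX e1 expr1n mulr1 normr_nat.
  rewrite -E -(dup_elimX a b x z).
  have hU : `|12 * x ^+ 2 * z + 16 * a * z ^+ 3| <= 12 + 16.
    by apply: normD_le; apply: (C2) => //; exact: X.
  have hV : `|3 * x ^+ 3 - 5 * a * x * z ^+ 2 - 27 * b * z ^+ 3| <= 3 + 5 + 27.
    by apply: normB_le; [apply: normB_le|]; [apply: (C)|apply: (C3)|apply: (C2)] => //; exact: X.
  by apply: le_trans (normB_le (normM_le hU FM) (normM_le hV GM)) _; lra.
Qed.
End Arch.

Section Arch2.
Variable R : realFieldType.
Implicit Types a b x z t : R.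

(** The constant has to exceed 32^(-1/4), about 0.4205, for the last condition of [arch_data] to
    hold with rho = 1 when |cdisc| is the larger term of its maximum. The bound with 619 is too weak
    for that. *)
Lemma small_a_doubling1 a t : `|a| <= 4^-1 ->
  43%:R / 100%:R * Num.max `|t| 1 ^+ 4 <= Num.max `|dupF a 1 t 1| `|dupG a 1 t 1|.
Proof.
rewrite ler_norml => /andP[a1 a2].
have FE : dupF a 1 t 1 = t ^+ 4 - 2 * a * t ^+ 2 - 8 * t + a ^+ 2 by rewrite /dupF; ring.
have GE : dupG a 1 t 1 = 4 * (t ^+ 3 + a * t + 1) by rewrite /dupG; ring.
have a2le : a ^+ 2 <= 16^-1 by nra.
have a2ge := sqr_ge0 a.
have t2 := sqr_ge0 t.
have at2 : `|2 * a * t ^+ 2| <= 2^-1 * t ^+ 2 by rewrite ler_norml; apply/andP; split; nra.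
move: at2; rewrite ler_norml => /andP[at1 at2].
rewrite le_max FE GE.
case: (lerP t 0) => [t0|t0].
  rewrite ler0_norm //; case: (lerP (- t) 1) => [h|h].
    case: (lerP (- t) (8%:R / 10%:R)) => h8; apply/orP; [right|left].
      rewrite expr1n; apply: le_trans (ler_norm _).
      have h3 : (- t) ^+ 3 <= (8%:R / 10%:R) ^+ 3 by rewrite lerXn2r ?nnegrE; lra.
      have h4 : a * t >= - (4^-1 * (8%:R / 10%:R)) by nra.
      have -> : t ^+ 3 = - (- t) ^+ 3 by ring.
      lra.
    rewrite expr1n; apply: le_trans (ler_norm _).
    have : 0 <= t ^+ 4 by rewrite exprn_even_ge0.
    have : t ^+ 2 <= 1 by nra.
    lra.
  apply/orP; left; apply: le_trans (ler_norm _).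
  have -> : (- t) ^+ 4 = t ^+ 2 * t ^+ 2 by ring.
  have -> : t ^+ 4 = t ^+ 2 * t ^+ 2 by ring.
  have : 1 <= t ^+ 2 by nra.
  nra.
rewrite gtr0_norm //; case: (lerP t 1) => [h|h].
  rewrite expr1n; case: (lerP t (8%:R / 10%:R)) => h8; apply/orP; [right|left].
    apply: le_trans (ler_norm _).
    have : 0 <= t ^+ 3 by rewrite exprn_ge0 // ltW.
    have : a * t >= - (4^-1 * (8%:R / 10%:R)) by nra.
    lra.
  rewrite -normrN; apply: le_trans (ler_norm _).
  have : t ^+ 4 <= 1 by rewrite exprn_ile1 // ltW.
  have : t ^+ 2 <= 1 by nra.
  lra.
case: (lerP t (17%:R / 10%:R)) => [h17|h17].
  apply/orP; left; rewrite -normrN; apply: le_trans (ler_norm _).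
  have e4 : t ^+ 4 = t ^+ 2 * t ^+ 2 by ring.
  have hq : t ^+ 2 <= 27%:R / 10%:R * t - 17%:R / 10%:R.
    have : (t - 1) * (t - 17%:R / 10%:R) <= 0 by nra.
    nra.
  have hq4 : t ^+ 4 <= (27%:R / 10%:R * t - 17%:R / 10%:R) ^+ 2 by rewrite e4 expr2; nra.
  nra.
case: (lerP t 9) => [h9|h9].
  apply/orP; right; apply: le_trans (ler_norm _).
  have e4 : t ^+ 4 = t ^+ 3 * t by ring.
  have e3 : t ^+ 3 = t ^+ 2 * t by ring.
  have h3 : t ^+ 3 >= 28%:R / 10%:R * t by rewrite e3; nra.
  have t30 : 0 <= t ^+ 3 by rewrite exprn_ge0 // ltW.
  case: (lerP t (28%:R / 10%:R)) => h28.
    nra.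
  have : t ^+ 3 >= 784%:R / 100%:R * t by rewrite e3; nra.
  nra.
apply/orP; left; apply: le_trans (ler_norm _).
have e4 : t ^+ 4 = t ^+ 2 * t ^+ 2 by ring.
have : 9 * t <= t ^+ 2 by nra.
have : 81%:R <= t ^+ 2 by nra.
rewrite e4; nra.
Qed.

(** Model near a node: t is a coordinate centred at the critical point of the cubic and be its small
    normalised value there. The constant 12 be dominates for |t| <= e/2, the power t^4 for |t| > 2
    e, and between them the second entry is large because of 3 t^2. *)
Lemma node_doubling1 e be t : 0 < e -> e <= 10%:R^-1 -> `|be| = e ^+ 4 ->
  15%:R / 100%:R * Num.max `|t| e ^+ 4 <=
  Num.max `|t ^+ 4 - 8 * be * t - 12 * be| (e * `|4 * (t ^+ 3 + 3 * t ^+ 2 + be)|).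
Proof.
move=> e0 e1 hb; rewrite le_max.
have e40 : 0 < e ^+ 4 by rewrite exprn_gt0.
set s := `|t|; have s0 : 0 <= s by exact: normr_ge0.
have st4 : `|t ^+ 4| = s ^+ 4 by rewrite normrX.
have bt : `|8 * be * t| = 8 * (e ^+ 4 * s) by rewrite 2!normrM normr_nat hb -/s; ring.
have b12 : `|12 * be| = 12 * e ^+ 4 by rewrite normrM normr_nat hb.
case: (lerP s (e / 2)) => h1.
  apply/orP; left; rewrite max_r; last by lra.
  have s4 : s ^+ 4 <= (e / 2) ^+ 4 by rewrite lerXn2r ?nnegrE //; lra.
  have s4' : (e / 2) ^+ 4 = e ^+ 4 / 16 by field.
  have es : e ^+ 4 * s <= e ^+ 4 * 20%:R^-1 by rewrite ler_wpM2l //; lra.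
  have h : `|12 * be| - `|t ^+ 4 - 8 * be * t| <= `|t ^+ 4 - 8 * be * t - 12 * be|.
    by rewrite [X in _ <= X]distrC; exact: lerB_dist.
  have h' := normB_le (lexx `|t ^+ 4|) (lexx `|8 * be * t|).
  move: h h'; rewrite st4 bt b12; lra.
have sp : 0 < s by lra.
case: (lerP s (2 * e)) => h2.
  apply/orP; right.
  have m4 : Num.max s e ^+ 4 <= (2 * e) ^+ 4.
    have mm : Num.max s e <= 2 * e by rewrite ge_max h2 /=; lra.
    by rewrite lerXn2r // nnegrE ?le_max ?s0 //; move: e0; clear; lra.
  have s2 : s ^+ 2 >= e ^+ 2 / 4 by rewrite expr2; nra.
  have s3 : s ^+ 3 <= s ^+ 2 * 5^-1 by rewrite exprSr ler_wpM2l ?exprn_ge0 //; lra.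
  have be2 : e ^+ 4 <= e ^+ 2 * 100%:R^-1.
    have -> : e ^+ 4 = e ^+ 2 * e ^+ 2 by ring.
    have ee : e * e <= 10%:R^-1 * 10%:R^-1 by apply: ler_pM => //; exact: ltW.
    rewrite ler_wpM2l //; first by rewrite exprn_ge0 // ltW.
    by rewrite expr2; lra.
  have h : 3 * s ^+ 2 - (s ^+ 3 + e ^+ 4) <= `|t ^+ 3 + 3 * t ^+ 2 + be|.
    have -> : t ^+ 3 + 3 * t ^+ 2 + be = 3 * t ^+ 2 - (- (t ^+ 3 + be)) by ring.
    apply: le_trans (lerB_dist _ _); rewrite normrN normrM normr_nat normrX lerB //.
    by rewrite -hb -normrX ler_normD.
  have e2 : 0 < e ^+ 2 by rewrite exprn_gt0.
  have h3 : 60%:R / 100%:R * e ^+ 2 <= `|t ^+ 3 + 3 * t ^+ 2 + be| by lra.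
  rewrite normrM normr_nat.
  have h4 : 15%:R / 100%:R * Num.max s e ^+ 4 <= e * (4 * (60%:R / 100%:R * e ^+ 2)).
    have -> : e * (4 * (60%:R / 100%:R * e ^+ 2)) = 240%:R / 100%:R * (e * e ^+ 2) by field.
    have e4e : (2 * e) ^+ 4 = 16 * (e * (e * e ^+ 2)) by ring.
    have p : 0 < e * e ^+ 2 by rewrite mulr_gt0.
    have : e * (e * e ^+ 2) <= 10%:R^-1 * (e * e ^+ 2) by rewrite ler_wpM2r // ltW.
    move: m4; rewrite e4e; lra.
  apply: le_trans h4 _; rewrite ler_wpM2l //; first exact: ltW.
  by rewrite ler_wpM2l.
apply/orP; left; rewrite max_l; last by lra.
have se4 : 16 * e ^+ 4 <= s ^+ 4.
  have -> : 16 * e ^+ 4 = (2 * e) ^+ 4 by ring.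
  by rewrite lerXn2r ?nnegrE //; lra.
have es : 8 * (e ^+ 4 * s) <= 10%:R^-1 * s ^+ 4.
  have s3 : 8 * e ^+ 3 <= s ^+ 3.
    have -> : 8 * e ^+ 3 = (2 * e) ^+ 3 by ring.
    by rewrite lerXn2r ?nnegrE //; lra.
  have -> : 8 * (e ^+ 4 * s) = (8 * e ^+ 3) * (e * s) by ring.
  have -> : 10%:R^-1 * s ^+ 4 = s ^+ 3 * (10%:R^-1 * s) by ring.
  apply: ler_pM => //.
  - by rewrite mulr_ge0 // exprn_ge0 // ltW.
  - by rewrite mulr_ge0 // ltW.
  - by rewrite ler_wpM2r // ltW.
have h : `|t ^+ 4| - `|8 * be * t + 12 * be| <= `|t ^+ 4 - 8 * be * t - 12 * be|.
  have -> : t ^+ 4 - 8 * be * t - 12 * be = t ^+ 4 - (8 * be * t + 12 * be) by ring.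
  exact: lerB_dist.
have h' := normD_le (lexx `|8 * be * t|) (lexx `|12 * be|).
move: h h'; rewrite st4 bt b12; lra.
Qed.
End Arch2.

Section Arch3.
Variable R : rcfType.
Implicit Types a b x z t : R.

(** A real height adapted to the curve: eta is the natural size of x/z, and nu moves the origin to a
    nearly double root. *)
Definition xheight (nu eta x z : R) : R := Num.max `|x - nu * z| (eta * `|z|).

Definition unit_bound a b (c : R) := forall x z,
  c * Num.max `|x| `|z| ^+ 4 <= Num.max `|dupF a b x z| `|dupG a b x z|.

Lemma unit_bound_gen a b : `|a| <= 1 -> `|b| <= 1 -> unit_bound a b (4 * `|cdisc a b| / 619%:R).
Proof.
move=> ha hb x z; set m := Num.max `|x| `|z|.
have m0 : 0 <= m by rewrite le_max normr_ge0.
have [m00|mn0] := eqVneq m 0.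
  by rewrite m00 expr0n /= mulr0 le_max normr_ge0.
have mp : 0 < m by rewrite lt0r mn0.
have m4 : 0 <= m ^+ 4 by rewrite exprn_ge0.
have nx : `|x / m| = `|x| / m by rewrite normrM normfV (gtr0_norm mp).
have nz : `|z / m| = `|z| / m by rewrite normrM normfV (gtr0_norm mp).
have h1 : `|x / m| <= 1 by rewrite nx ler_pdivrMr // mul1r le_max lexx.
have h2 : `|z / m| <= 1 by rewrite nz ler_pdivrMr // mul1r le_max lexx orbT.
have h3 : `|x / m| = 1 \/ `|z / m| = 1.
  rewrite nx nz; case: (leP `|x| `|z|) => h; [right|left].
    by have mE : m = `|z| by [rewrite /m max_r]; rewrite -mE divff.
  by have mE : m = `|x| by [rewrite /m max_l // ltW]; rewrite -mE divff.
have H := unit_doubling ha hb h1 h2 h3.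
have F : dupF a b x z = dupF a b (x / m) (z / m) * m ^+ 4 by rewrite /dupF; field.
have G : dupG a b x z = dupG a b (x / m) (z / m) * m ^+ 4 by rewrite /dupG; field.
rewrite F G (normrM (dupF _ _ _ _)) (normrM (dupG _ _ _ _)) (ger0_norm m4) -maxr_pMl // ler_wpM2r //.
by rewrite ler_pdivrMr // [leRHS]mulrC.
Qed.

Lemma unit_bound_small a b : `|a| <= 4^-1 -> `|b| = 1 -> unit_bound a b (43%:R / 100%:R).
Proof.
move=> ha hb.
have base x z : 43%:R / 100%:R * Num.max `|x| `|z| ^+ 4 <= Num.max `|dupF a 1 x z| `|dupG a 1 x z|.
  have [->|z0] := eqVneq z 0.
    rewrite normr0 max_l // le_max; apply/orP; left.
    have -> : dupF a 1 x 0 = x ^+ 4 by rewrite /dupF; ring.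
    by rewrite normrX; have := exprn_ge0 4 (normr_ge0 x); lra.
  have F : dupF a 1 x z = dupF a 1 (x / z) 1 * z ^+ 4 by rewrite /dupF; field.
  have G : dupG a 1 x z = dupG a 1 (x / z) 1 * z ^+ 4 by rewrite /dupG; field.
  have M : Num.max `|x| `|z| = Num.max `|x / z| 1 * `|z|.
    by rewrite maxr_pMl // mul1r -normrM divfK.
  rewrite F G M (normrM (dupF _ _ _ _)) (normrM (dupG _ _ _ _)) normrX -maxr_pMl ?exprn_ge0 // exprMn mulrA ler_wpM2r ?exprn_ge0 //.
  exact: small_a_doubling1.
move=> x z; have : b = 1 \/ b = -1.
  by move/eqP: hb; rewrite eqr_norml => /andP[/orP[/eqP->|/eqP->] _]; [left|right].
case=> ->; first exact: base.
have := base (- x) z; rewrite normrN.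
have -> : dupF a 1 (- x) z = dupF a (-1) x z by rewrite /dupF; ring.
have -> : dupG a 1 (- x) z = - dupG a (-1) x z by rewrite /dupG; ring.
by rewrite normrN.
Qed.

Lemma unit_bound_scale a b c mu : 0 < mu -> unit_bound (a / mu ^+ 2) (b / mu ^+ 3) c ->
  forall x z, c * xheight 0 mu x z ^+ 4 <= xheight 0 mu (dupF a b x z) (dupG a b x z).
Proof.
move=> mu0 U x z; have := U x (mu * z); rewrite /xheight !mul0r !subr0.
have mn : mu != 0 by rewrite gt_eqF.
have -> : dupF (a / mu ^+ 2) (b / mu ^+ 3) x (mu * z) = dupF a b x z by rewrite /dupF; field.
have -> : dupG (a / mu ^+ 2) (b / mu ^+ 3) x (mu * z) = mu * dupG a b x z by rewrite /dupG; field.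
by rewrite !normrM (gtr0_norm mu0).
Qed.

Lemma node_bound a b nu be e : 3 * nu ^+ 2 = - a -> be = (nu ^+ 3 + a * nu + b) / nu ^+ 3 -> nu != 0 ->
  0 < e -> e <= 10%:R^-1 -> `|be| = e ^+ 4 ->
  forall x z, 15%:R / 100%:R * xheight nu (`|nu| * e) x z ^+ 4 <=
    xheight nu (`|nu| * e) (dupF a b x z) (dupG a b x z).
Proof.
move=> ha hbe nu0 e0 e1 he x z; rewrite /xheight.
have nup : 0 < `|nu| by rewrite normr_gt0.
have [->|z0] := eqVneq z 0.
  rewrite !mulr0 subr0 normr0 mulr0 max_l // le_max; apply/orP; left.
  have -> : dupF a b x 0 - nu * dupG a b x 0 = x ^+ 4 by rewrite /dupF /dupG; ring.
  by rewrite normrX; have := exprn_ge0 4 (normr_ge0 x); lra.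
have aE : a = - (3 * nu ^+ 2) by rewrite ha opprK.
have bE : b = be * nu ^+ 3 - nu ^+ 3 - a * nu by rewrite hbe divfK ?expf_neq0 //; ring.
set t := (x - nu * z) / (nu * z).
have xE : x = nu * z * (t + 1) by rewrite /t; field; rewrite nu0 z0.
have S : dupF a b x z - nu * dupG a b x z = (t ^+ 4 - 8 * be * t - 12 * be) * (nu * z) ^+ 4.
  by rewrite bE aE xE /dupF /dupG; ring.
have G : dupG a b x z = 4 * (t ^+ 3 + 3 * t ^+ 2 + be) * (nu ^+ 3 * z ^+ 4).
  by rewrite bE aE xE /dupG; ring.
have M : Num.max `|x - nu * z| (`|nu| * e * `|z|) = Num.max `|t| e * `|nu * z|.
  rewrite maxr_pMl // -normrM {1}/t divfK ?mulf_neq0 // normrM; congr Num.max; ring.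
have E2 : `|nu| * e * `|dupG a b x z| = e * `|4 * (t ^+ 3 + 3 * t ^+ 2 + be)| * `|nu * z| ^+ 4.
  rewrite G (normrM (4 * _)) (normrM (nu ^+ 3)) (normrM nu z) !normrX; ring.
rewrite S E2 M (normrM (_ - 12 * be)) normrX -maxr_pMl ?exprn_ge0 // exprMn mulrA ler_wpM2r ?exprn_ge0 //.
exact: node_doubling1.
Qed.

(** The last condition is the real part of the height constant, cleared of logarithms and roots;
    6912 |a|^3 / |cdisc| is |j|. The factor rho is the loss in returning to max(|x|, |z|). *)
Definition arch_data (a b nu eta c rho : R) : Prop :=
  [/\ [/\ 0 < eta, 0 < c & 0 < rho],
      forall x z, Num.max `|x| `|z| <= rho * xheight nu eta x z,
      forall x z, c * xheight nu eta x z ^+ 4 <= xheight nu eta (dupF a b x z) (dupG a b x z) &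
      `|cdisc a b| ^+ 3 * rho ^+ 12 <=
         32%:R * c ^+ 4 * Num.max (6912%:R * `|a| ^+ 3) `|cdisc a b| ^+ 3].

Lemma xheight_ge_max mu x z : 1 <= mu -> Num.max `|x| `|z| <= 1 * xheight 0 mu x z.
Proof.
move=> m1; rewrite mul1r /xheight mul0r subr0 ge_max !le_max lexx /=.
by rewrite ler_peMl ?normr_ge0 ?orbT.
Qed.

Lemma cdisc_scale a b mu : mu != 0 -> cdisc a b = cdisc (a / mu ^+ 2) (b / mu ^+ 3) * mu ^+ 6.
Proof. by move=> m0; rewrite /cdisc; field. Qed.

Lemma arch_data_small a b mu : 1 <= mu -> `|a| <= mu ^+ 2 / 4 -> `|b| = mu ^+ 3 ->
  arch_data a b 0 mu (43%:R / 100%:R) 1.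
Proof.
move=> m1 ha hb; have m0 : 0 < mu by lra.
have mn : mu != 0 by rewrite gt_eqF.
have m2 : 0 < mu ^+ 2 by rewrite exprn_gt0.
have m3 : 0 < mu ^+ 3 by rewrite exprn_gt0.
split; [by split=> //; lra|by move=> x z; exact: xheight_ge_max| |].
  apply: unit_bound_scale => //; apply: unit_bound_small.
    by rewrite normrM normfV (gtr0_norm m2) ler_pdivrMr // mulrC.
  by rewrite normrM normfV (gtr0_norm m3) hb divff // gt_eqF.
rewrite expr1n mulr1; set D := `|cdisc a b|; set X := Num.max _ _.
have DX : D <= X by rewrite le_max lexx orbT.
have D0 : 0 <= D by exact: normr_ge0.
have D3 : D ^+ 3 <= X ^+ 3 by rewrite lerXn2r ?nnegrE // (le_trans D0).
have X3 : 0 <= X ^+ 3 by rewrite (le_trans _ D3) // exprn_ge0.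
apply: le_trans D3 _; rewrite -[leLHS]mul1r ler_wpM2r // (_ : (43%:R / 100%:R) ^+ 4 = 3418801%:R / 100000000%:R); last by field.
lra.
Qed.

(** Scaling by mu brings a and b into the unit box. The numerical condition is the last clause of
    [arch_data] for c = 4 |cdisc| / 619 with the scaled discriminant, and 8192 = 32 * 4^4. *)
Lemma arch_data_gen a b mu (k de : R) : 1 <= mu -> `|a| <= mu ^+ 2 -> `|b| <= mu ^+ 3 ->
  0 < k -> k * mu ^+ 6 <= 6912%:R * `|a| ^+ 3 -> 0 < de -> de * mu ^+ 6 <= `|cdisc a b| ->
  619%:R ^+ 4 <= 8192%:R * de * k ^+ 3 ->
  arch_data a b 0 mu (4 * `|cdisc (a / mu ^+ 2) (b / mu ^+ 3)| / 619%:R) 1.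
Proof.
move=> m1 ha hb k0 hk de0 hde hnum; have m0 : 0 < mu by lra.
have mn : mu != 0 by rewrite gt_eqF.
have m2 : 0 < mu ^+ 2 by rewrite exprn_gt0.
have m3 : 0 < mu ^+ 3 by rewrite exprn_gt0.
have m6 : 0 < mu ^+ 6 by rewrite exprn_gt0.
have ha' : `|a / mu ^+ 2| <= 1 by rewrite normrM normfV (gtr0_norm m2) ler_pdivrMr // mul1r.
have hb' : `|b / mu ^+ 3| <= 1 by rewrite normrM normfV (gtr0_norm m3) ler_pdivrMr // mul1r.
set al := a / mu ^+ 2; set be := b / mu ^+ 3.
have DE : `|cdisc a b| = `|cdisc al be| * mu ^+ 6.
  by rewrite (cdisc_scale a b mn) normrM (gtr0_norm m6).
set dl := `|cdisc al be| in DE *.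
have hdl : de <= dl by move: hde; rewrite DE ler_pM2r.
have dl0 : 0 < dl by lra.
split; [by split=> //; lra|by move=> x z; exact: xheight_ge_max| |].
  by apply: unit_bound_scale => //; exact: unit_bound_gen.
rewrite expr1n mulr1 DE; set X := Num.max _ _.
have KX : k * mu ^+ 6 <= X by rewrite le_max hk.
have X3 : (k * mu ^+ 6) ^+ 3 <= X ^+ 3.
  have km : 0 <= k * mu ^+ 6 by rewrite mulr_ge0 // ltW.
  by rewrite lerXn2r ?nnegrE // (le_trans km).
have c0 : 0 <= 32%:R * (4 * dl / 619%:R) ^+ 4 by rewrite mulr_ge0 // exprn_ge0 // divr_ge0 // mulr_ge0 // ltW.
apply: le_trans (ler_wpM2l c0 X3).
have -> : 32%:R * (4 * dl / 619%:R) ^+ 4 * (k * mu ^+ 6) ^+ 3 = (8192%:R * dl * k ^+ 3 / 619%:R ^+ 4) * (dl * mu ^+ 6) ^+ 3 by field.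
rewrite ler_peMl //; first by rewrite exprn_ge0 // mulr_ge0 // ltW.
rewrite ler_pdivlMr ?exprn_gt0 // mul1r; apply: le_trans hnum _.
by rewrite ler_wpM2r ?exprn_ge0 ?(ltW k0) // ler_wpM2l.
Qed.

(** Take for nu the critical point with the sign of b, so that b - 2 nu^3, the value of the cubic at
    nu, is the small factor of cdisc = 27 (b - 2 nu^3)(b + 2 nu^3). With be this value over nu^3 and
    e^4 = |be|, the loss rho^12 = 4096 / |be|^3 is compensated by |cdisc|^3, which is of the order
    of |be|^3. *)
Lemma arch_data_node a b : 1 <= `|a| -> cdisc a b != 0 -> `|cdisc a b| <= 10000%:R^-1 * `|a| ^+ 3 ->
  exists nu eta, exists2 rho, 0 < rho & arch_data a b nu eta (15%:R / 100%:R) rho.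
Proof.
move=> a1 D0 hD.
have a3 : 0 < `|a| ^+ 3 by rewrite exprn_gt0 // (lt_le_trans ltr01).
have an : a < 0.
  rewrite ltNge; apply/negP => a0.
  have h : 4 * `|a| ^+ 3 <= `|cdisc a b|.
    have b2 : 0 <= 27%:R * b ^+ 2 by rewrite mulr_ge0 // sqr_ge0.
    have c2 : 0 <= 4 * a ^+ 3 by rewrite mulr_ge0 // exprn_ge0.
    by rewrite /cdisc (ger0_norm a0) ger0_norm ?addr_ge0 // lerDl.
  by move: (le_trans h hD); lra.
have absa : `|a| = - a by rewrite ltr0_norm.
pose r := Num.sqrt (- a / 3).
have r2 : r ^+ 2 = - a / 3 by rewrite sqr_sqrtr //; lra.
have r0 : 0 < r by rewrite sqrtr_gt0; lra.
pose nu := if 0 <= b then r else - r.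
have nu2 : 3 * nu ^+ 2 = - a by rewrite /nu; case: ifP => _; rewrite ?sqrrN r2; field.
have nr : `|nu| = r by rewrite /nu; case: ifP => _; rewrite ?normrN gtr0_norm.
have nu0 : nu != 0 by rewrite -normr_gt0 nr.
have n3 : `|nu ^+ 3| = r ^+ 3 by rewrite normrX nr.
have r30 : 0 < r ^+ 3 by rewrite exprn_gt0.
have bnu : `|b + 2 * nu ^+ 3| = `|b| + 2 * r ^+ 3.
  rewrite /nu; case: (lerP 0 b) => hb.
    by rewrite ger0_norm ?(ger0_norm hb) // addr_ge0 // mulr_ge0 // ltW.
  rewrite ltr0_norm ?(ltr0_norm hb); last by rewrite exprNn; nra.
  by rewrite exprNn; ring.
pose be := (nu ^+ 3 + a * nu + b) / nu ^+ 3.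
have a3n : a = - (3 * nu ^+ 2) by rewrite nu2 opprK.
have beE : be * nu ^+ 3 = b - 2 * nu ^+ 3 by rewrite /be divfK ?expf_neq0 // {1}a3n; ring.
have DE : cdisc a b = 27%:R * (be * nu ^+ 3) * (b + 2 * nu ^+ 3) by rewrite beE /cdisc a3n; ring.
have absD : `|cdisc a b| = 27%:R * (`|be| * r ^+ 3) * (`|b| + 2 * r ^+ 3).
  by rewrite DE 2!normrM bnu normr_nat (normrM be) n3.
have b0 : 0 < `|be|.
  rewrite normr_gt0; apply: contra D0 => /eqP h; by rewrite DE h mul0r mulr0 mul0r.
have ar : `|a| = 3 * r ^+ 2 by rewrite absa r2; field.
have r6 : 0 < r ^+ 6 by rewrite exprn_gt0.
have a3r : `|a| ^+ 3 = 27%:R * r ^+ 6 by rewrite ar; ring.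
have hbe : `|be| <= 20000%:R^-1.
  have h : 54%:R * `|be| * r ^+ 6 <= `|cdisc a b|.
    rewrite absD; have -> : 54%:R * `|be| * r ^+ 6 = 27%:R * (`|be| * r ^+ 3) * (2 * r ^+ 3) by ring.
    by rewrite ler_wpM2l ?lerDr // mulr_ge0 // mulr_ge0 // ltW.
  have := le_trans h hD; rewrite a3r => h2.
  have : 54%:R * `|be| <= 27%:R / 10000%:R.
    by rewrite -(ler_pM2r r6); apply: le_trans h2 _; rewrite le_eqVlt; apply/orP; left; apply/eqP; field.
  lra.
pose e := Num.sqrt (Num.sqrt `|be|).
have e4 : `|be| = e ^+ 4.
  have e2 : e ^+ 2 = Num.sqrt `|be| by rewrite sqr_sqrtr ?sqrtr_ge0.
  by rewrite (exprM e 2 2) e2 sqr_sqrtr.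
have e0 : 0 < e by rewrite /e !sqrtr_gt0.
have e1 : e <= 10%:R^-1.
  rewrite leNgt; apply/negP => h.
  have : (10%:R^-1) ^+ 4 <= e ^+ 4 by apply: lerXn2r; rewrite ?nnegrE ?invr_ge0 ?(ltW e0) ?(ltW h).
  rewrite -e4 (_ : 10%:R^-1 ^+ 4 = 10000%:R^-1); last by field.
  by move: hbe; lra.
have rge : 1 <= 2 * r.
  have h2 : 1 <= 3 * r ^+ 2 by rewrite -ar.
  by rewrite leNgt; apply/negP => h; nra.
exists nu, (`|nu| * e), (2 / e); first by rewrite divr_gt0.
have eta0 : 0 < `|nu| * e by rewrite nr mulr_gt0.
have rho0 : 0 < 2 / e by rewrite divr_gt0.
split; [by split=> //; lra| | |].
- move=> x z; set M := xheight _ _ _ _.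
  have M1 : `|x - nu * z| <= M by rewrite /M /xheight le_max lexx.
  have M2 : r * e * `|z| <= M by rewrite /M /xheight nr le_max lexx orbT.
  have M0 : 0 <= M by apply: le_trans M1.
  have rz : r * `|z| <= M / e.
    by rewrite ler_pdivlMr // mulrAC.
  have Me : M <= (M / e) * 10%:R^-1.
    rewrite -mulrA -[leLHS]mulr1 ler_wpM2l // mulrC ler_pdivlMr // mul1r //.
  rewrite ge_max; apply/andP; split.
    have : `|x| <= M + r * `|z|.
      by rewrite -[x](subrK (nu * z)) -nr -normrM; apply: le_trans (ler_normD _ _) _; rewrite lerD2r.
    have -> : 2 / e * M = 2 * (M / e) by ring.
    have : 0 <= M / e by rewrite divr_ge0 // ltW.
    by lra.
  have -> : 2 / e * M = 2 * (M / e) by ring.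
  apply: le_trans (_ : 2 * (r * `|z|) <= _); last by rewrite ler_wpM2l.
  by rewrite mulrA ler_peMl.
- exact: node_bound.
set X := Num.max _ _.
have XX : 6912%:R * 27%:R * r ^+ 6 <= X by rewrite /X a3r le_max [leRHS]mulrA lexx.
have X3 : (6912%:R * 27%:R * r ^+ 6) ^+ 3 <= X ^+ 3.
  have p : 0 <= 6912%:R * 27%:R * r ^+ 6 by apply: mulr_ge0 (ltW r6); apply: mulr_ge0.
  by apply: lerXn2r; rewrite ?nnegrE // (le_trans p).
have Dle : `|cdisc a b| <= 111%:R * `|be| * r ^+ 6.
  have hb : `|b| <= 2 * r ^+ 3 + `|be| * r ^+ 3.
    have -> : b = 2 * nu ^+ 3 + be * nu ^+ 3 by rewrite beE; ring.
    by apply: le_trans (ler_normD _ _) _; rewrite !(normrM _ (nu ^+ 3)) n3 normr_nat.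
  rewrite absD; have -> : 111%:R * `|be| * r ^+ 6 = 27%:R * (`|be| * r ^+ 3) * (111%:R / 27%:R * r ^+ 3) by field.
  rewrite ler_wpM2l //; first by rewrite mulr_ge0 // mulr_ge0 // ltW.
  apply: le_trans (_ : (4 + `|be|) * r ^+ 3 <= _); first by move: hb; rewrite mulrDl; lra.
  by rewrite ler_wpM2r ?(ltW r30) //; lra.
apply: le_trans (_ : (111%:R * `|be| * r ^+ 6) ^+ 3 * (2 / e) ^+ 12 <= _).
  by apply: ler_wpM2r; [exact: exprn_ge0 (ltW rho0)|apply: lerXn2r => //; rewrite nnegrE ?normr_ge0 //; apply: le_trans Dle].
have -> : (111%:R * `|be| * r ^+ 6) ^+ 3 * (2 / e) ^+ 12 = 111%:R ^+ 3 * 4096%:R * (r ^+ 6) ^+ 3.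
  by rewrite e4; field; rewrite gt_eqF.
have c0 : 0 <= 32%:R * (15%:R / 100%:R) ^+ 4 :> R by rewrite mulr_ge0 // exprn_ge0 // divr_ge0.
apply: le_trans (ler_wpM2l c0 X3).
rewrite [in leRHS](exprMn 3 _ (r ^+ 6)) [leRHS]mulrA; apply: ler_wpM2r; first exact: exprn_ge0 (ltW r6).
rewrite (_ : (15%:R / 100%:R) ^+ 4 = 81%:R / 160000%:R :> R); last by field.
lra.
Qed.
End Arch3.

(** * Cancellation in the j-invariant *)

(** What can cancel in j = 6912 a^3 / cdisc, where 6912 = 256 * 27. *)
Definition jgcd (a b : int) : nat := gcdn (256 * 27 * `|a| ^ 3) `|cdisc a b|.

Lemma jgcd_reduced (A B : int) (c : nat) : coprimez A B ->
  (c%:Z %| (256 * 27 * A)%R)%Z -> (c%:Z %| (4 * A + 27 * B)%R)%Z -> (c %| 256 * 729)%N.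
Proof.
move=> /eqP cAB h1 h2.
have h3 : (c%:Z %| (256 * 729 * A)%R)%Z.
  rewrite (_ : 256 * 729 * A = 27 * (256 * 27 * A)); last by ring.
  exact: dvdz_mull.
have h4 : (c%:Z %| (256 * 729 * B)%R)%Z.
  rewrite (_ : _ * B = 6912 * (4 * A + 27 * B) - 4 * (256 * 27 * A)); last by ring.
  by apply: rpredB; [exact: dvdz_mull h2|exact: dvdz_mull h1].
have [/= u [v e]] := Bezoutz A B.
have : (c%:Z %| (256 * 729)%N%:Z)%Z.
  rewrite (_ : Posz _ = u * (256 * 729 * A) + v * (256 * 729 * B)); first by apply: rpredD; [exact: dvdz_mull h3|exact: dvdz_mull h4].
  transitivity (256 * 729 * (u * A + v * B)); last by ring.
  by rewrite e cAB.
by rewrite dvdzE.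
Qed.

Lemma dvd_243_or (c : nat) : (c %| 256 * 729)%N -> (243 %| c)%N \/ (c <= 256 * 81)%N.
Proof.
move=> /dvdnP[m hm].
have [h9|h9] := boolP (9 %| m)%N.
  right; move/dvdnP: h9 => [m' em]; move: hm; rewrite em => hm.
  have : (256 * 81 = m' * c)%N.
    move/eqP: hm; rewrite (_ : 729 = 81 * 9)%N // mulnA -(mulnAC m') eqn_pmul2r // => /eqP; exact.
  have m'0 : (0 < m')%N.
    rewrite lt0n; apply/eqP => m'0; move: hm; rewrite m'0 !mul0n => /eqP; rewrite muln_eq0; exact.
  by move=> ->; rewrite leq_pmull.
left; have [h3|h3] := boolP (3 %| m)%N.
  move/dvdnP: h3 => [m' em]; have hm' : (256 * 243 = m' * c)%N.
    move/eqP: hm; rewrite em (_ : 729 = 243 * 3)%N // mulnA -(mulnAC m') eqn_pmul2r // => /eqP; exact.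
  have c3 : coprime (3 ^ 5) m'.
    rewrite coprimeXl // prime_coprime //; apply: contra h9 => /dvdnP[q eq]; rewrite em eq.
    by rewrite -mulnA dvdn_mull.
  by rewrite -(Gauss_dvdr _ c3) -hm'.
have c3 : coprime (3 ^ 5) m by rewrite coprimeXl // prime_coprime.
by rewrite -(Gauss_dvdr _ c3) -hm.
Qed.

(** A trade-off at the prime 3. If 27 divides A = a^3 / g, then k = 3 and the full 256 * 729 = 256 *
    81 * 3^2 may cancel, which is paid for by the gain k in duplication. Otherwise 243 cannot divide
    the common factor, as it would make 27 divide 4 A, and at most 256 * 81 is left. *)
Lemma jgcd_bound (a b : int) : cdisc a b != 0 -> exists k : nat,
  [/\ (0 < k)%N, (k %| 3)%N, (k ^ 3 * abgcd a b %| `|a| ^ 3)%N &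
      (jgcd a b <= 256 * 81 * k ^ 2 * abgcd a b)%N].
Proof.
move=> D0; have g0 := abgcd_gt0 D0; set g := abgcd a b in g0 *.
have ga : (g %| `|a ^+ 3|)%N by rewrite abszX dvdn_gcdl.
have gb : (g %| `|b ^+ 2|)%N by rewrite abszX dvdn_gcdr.
have /dvdzP[A eA] : (g%:Z %| a ^+ 3)%Z by rewrite dvdzE.
have /dvdzP[B eB] : (g%:Z %| b ^+ 2)%Z by rewrite dvdzE.
have cAB : coprimez A B.
  rewrite /coprimez /gcdz; have : g%:Z = (g * gcdn `|A| `|B|)%N :> int.
    rewrite muln_gcdr; congr Posz; rewrite {1}/g /abgcd -!abszX eA eB !abszM absz_nat.
    by rewrite ![(_ * g)%N]mulnC.
  by rewrite PoszM -[LHS]mulr1 => /mulfI <- //; rewrite eqz_nat -lt0n.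
have DE : cdisc a b = (4 * A + 27 * B) * g%:Z by rewrite /cdisc eA eB; ring.
pose c := gcdn (256 * 27 * `|A|) `|4 * A + 27 * B|.
have cE : jgcd a b = (c * g)%N.
  by rewrite /jgcd DE -abszX eA !abszM absz_nat mulnA muln_gcdl.
have c1 : (c%:Z %| (256 * 27 * A)%R)%Z by rewrite dvdzE !abszM dvdn_gcdl.
have c2 : (c%:Z %| (4 * A + 27 * B)%R)%Z by rewrite dvdzE dvdn_gcdr.
have cd := jgcd_reduced cAB c1 c2.
have [h27|h27] := boolP (27 %| `|A|)%N.
  exists 3; split=> //.
    by rewrite -abszX eA abszM absz_nat dvdn_pmul2r.
  have e3 : (256 * 81 * 3 ^ 2 = 256 * 729)%N by rewrite -mulnA.
  have p0 : (0 < 256 * 729)%N by rewrite muln_gt0.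
  rewrite cE (leq_pmul2r g0) e3; exact: dvdn_leq p0 cd.
exists 1%N; split=> //; first by rewrite mul1n -abszX.
rewrite cE (leq_pmul2r g0) muln1.
case: (dvd_243_or cd); last exact.
move=> h; case/negP: h27.
have : (27%:Z %| (4 * A)%R)%Z.
  rewrite (_ : 4 * A = (4 * A + 27 * B) - 27%:Z * B); last by ring.
  apply: rpredB; last exact: dvdz_mulr.
  by apply: dvdz_trans c2; rewrite dvdzE; apply: dvdn_trans h.
by rewrite dvdzE abszM Gauss_dvdr.
Qed.

From mathcomp Require Import all_classical all_reals all_analysis.
From mathcomp Require Import measurable_realfun gauss_integral.
Import numFieldTopology.Exports numFieldNormedType.Exports.

(** If b^2 dominates, mu = |b|^(1/3), and a is either small or larger than mu^2 / 4 in size; then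
    6912 / 64 = 108 and 27 - 4 = 23 are the constants. If |a|^3 dominates, mu = |a|^(1/2), and the
    curve is nearly nodal or |cdisc| > |a|^3 / 10000. Integrality of a and b gives mu >= 1. *)
Lemma arch_data_exists (R : realType) (a b : int) : cdisc a b != 0 ->
  exists nu eta c rho : R, arch_data a%:~R b%:~R nu eta c rho.
Proof.
move=> D0.
have DR : cdisc (a%:~R : R) b%:~R = (cdisc a b)%:~R by rewrite /cdisc !(intrD, intrM, rmorphXn).
have D0R : cdisc (a%:~R : R) b%:~R != 0 by rewrite DR intr_eq0.
set x : R := a%:~R in DR D0R *; set y : R := b%:~R in DR D0R *.
have ge1 (n : int) : n != 0 -> 1 <= `|n%:~R : R| by move=> n0; rewrite -intr_norm ler1z -gtz0_ge1 normr_gt0.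
have x0 : 0 <= `|x| by [].
have y0 : 0 <= `|y| by [].
case: (lerP (`|x| ^+ 3) (`|y| ^+ 2)) => hxy.
  have b0 : b != 0.
    apply: contra D0R => /eqP b0; move: hxy; rewrite /y b0 normr0 expr0n /= => h.
    have : `|x| ^+ 3 == 0 by rewrite eq_le h exprn_ge0.
    by rewrite expf_eq0 /= normr_eq0 => /eqP ->; rewrite /cdisc !expr0n /= !mulr0 addr0.
  have y1 : 1 <= `|y| by exact: ge1.
  have yp : 0 < `|y| by lra.
  pose mu := powR `|y| 3%:R^-1.
  have mu3 : `|y| = mu ^+ 3 by rewrite -powR_mulrn ?powR_ge0 // -powRrM mulVf // powRr1.
  have mu1 : 1 <= mu.
    by rewrite leNgt; apply/negP => h; have : mu ^+ 3 < 1 by [rewrite exprn_ilt1 ?powR_ge0]; rewrite -mu3; lra.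
  have mu0 : 0 < mu by lra.
  have m6 : `|y| ^+ 2 = mu ^+ 6 by rewrite mu3 -exprM.
  have m20 : 0 <= mu ^+ 2 by rewrite exprn_ge0 // ltW.
  have m60 : 0 < mu ^+ 6 by rewrite exprn_gt0.
  have xm : `|x| <= mu ^+ 2.
    rewrite leNgt; apply/negP => h; have : (mu ^+ 2) ^+ 3 < `|x| ^+ 3 by rewrite ltrXn2r // nnegrE.
    by rewrite -exprM -m6; lra.
  case: (lerP `|x| (mu ^+ 2 / 4)) => h4; first by exists 0, mu, (43%:R / 100%:R), 1; apply: arch_data_small.
  exists 0, mu, (4 * `|cdisc (x / mu ^+ 2) (y / mu ^+ 3)| / 619%:R), 1.
  apply: (@arch_data_gen _ _ _ _ 108%:R 23%:R) => //; first by rewrite mu3.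
  - have : (mu ^+ 2 / 4) ^+ 3 <= `|x| ^+ 3.
      by apply: lerXn2r; rewrite ?nnegrE ?(ltW h4) // divr_ge0.
    have -> : (mu ^+ 2 / 4) ^+ 3 = mu ^+ 6 / 64%:R by field.
    lra.
  - rewrite -m6; have -> : cdisc x y = 27%:R * y ^+ 2 - - (4 * x ^+ 3) by rewrite /cdisc; ring.
    have n1 : `|27%:R * y ^+ 2| = 27%:R * `|y| ^+ 2 by rewrite normrM normrX normr_nat.
    have n2 : `|- (4 * x ^+ 3)| = 4 * `|x| ^+ 3 by rewrite normrN normrM normrX normr_nat.
    by apply: le_trans (lerB_dist _ _); rewrite n1 n2; lra.
  - lra.
have a0 : a != 0.
  by apply/eqP => a0; move: hxy; rewrite /x a0 normr0 expr0n /= ltNge exprn_ge0.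
have x1 : 1 <= `|x| by exact: ge1.
case: (lerP `|cdisc x y| (10000%:R^-1 * `|x| ^+ 3)) => hD.
  by have [nu [eta [rho _ H]]] := arch_data_node x1 D0R hD; exists nu, eta, (15%:R / 100%:R), rho.
pose mu := Num.sqrt `|x|.
have mu2 : mu ^+ 2 = `|x| by rewrite sqr_sqrtr.
have mu1 : 1 <= mu by rewrite /mu -sqrtr1 ler_sqrt.
have m6 : mu ^+ 6 = `|x| ^+ 3 by rewrite -mu2 -exprM.
exists 0, mu, (4 * `|cdisc (x / mu ^+ 2) (y / mu ^+ 3)| / 619%:R), 1.
apply: (@arch_data_gen _ _ _ _ 6912%:R 10000%:R^-1) => //.
- by rewrite mu2.
- have m3 : 0 <= mu ^+ 3 by rewrite exprn_ge0 // sqrtr_ge0.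
  rewrite leNgt; apply/negP => h; have : (mu ^+ 3) ^+ 2 < `|y| ^+ 2 by rewrite ltrXn2r // nnegrE.
  by rewrite -exprM m6; lra.
- by rewrite m6.
- by rewrite invr_gt0.
- by rewrite m6 ltW.
- lra.
Qed.

(** * A height adapted to duplication *)

Definition xz (P : ecpt) : int * int := if P is Some (x, _) then (numq x, denq x) else (1, 0).

Lemma xz_coprime P : coprimez (xz P).1 (xz P).2.
Proof.
case: P => [[x y]|] //=; first by rewrite /coprimez /gcdz eqz_nat; exact: coprime_num_den.
Qed.

Lemma coprimez_neq0 x z : coprimez x z -> (x != 0) || (z != 0).
Proof. by move=> h; rewrite -negb_and; apply/negP => /andP[/eqP x0 /eqP z0]; move: h; rewrite x0 z0. Qed.

(** In cross-multiplied form the statement also covers O and the points of order 2, where [dupG]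
    vanishes. *)
Lemma dup_cross a b P : on_curve a b P ->
  dupF a b (xz P).1 (xz P).2 * (xz (ec_add a P P)).2 = dupG a b (xz P).1 (xz P).2 * (xz (ec_add a P P)).1.
Proof.
case: P => [[x y]|] /=; last by move=> _; rewrite /dupF /dupG; ring.
move/eqP => e; rewrite eqxx /=.
have dn0 : (denq x)%:~R != 0 :> rat by rewrite intr_eq0 denq_neq0.
have xE : (numq x)%:~R = x * (denq x)%:~R by rewrite -{2}[x]divq_num_den divfK.
apply: (intr_inj (R := rat)).
have dF (z w : int) : (dupF a b z w)%:~R = dupF a%:~R b%:~R z%:~R w%:~R :> rat.
  by rewrite /dupF; ring.
have dG (z w : int) : (dupG a b z w)%:~R = dupG a%:~R b%:~R z%:~R w%:~R :> rat.
  by rewrite /dupG; ring.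
have GE : dupG a%:~R b%:~R (x * (denq x)%:~R) (denq x)%:~R = 4 * y ^+ 2 * (denq x)%:~R ^+ 4 :> rat.
  by rewrite e /dupG; ring.
case: ifPn => [/eqP yy|yy] /=; rewrite [LHS]intrM [RHS]intrM dF dG xE.
  have y0 : y = 0 by move/eqP: yy; rewrite -addr_eq0 -mulr2n mulrn_eq0 /= => /eqP.
  by rewrite GE y0 mulr0 expr0n /= mulr0 !mul0r.
have y0 : y != 0 by apply: contra yy => /eqP ->; rewrite oppr0.
set x3 := _ - x - x.
have dn3 : (denq x3)%:~R != 0 :> rat by rewrite intr_eq0 denq_neq0.
have x3E : (numq x3)%:~R = x3 * (denq x3)%:~R by rewrite -{2}[x3]divq_num_den divfK.
have FE : dupF a%:~R b%:~R (x * (denq x)%:~R) (denq x)%:~R = 4 * y ^+ 2 * x3 * (denq x)%:~R ^+ 4 :> rat.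
  have -> : x3 = ((3 * x ^+ 2 + a%:~R) ^+ 2 - 8 * x * y ^+ 2) / (4 * y ^+ 2) by rewrite /x3; field.
  have y20 : 4 * y ^+ 2 != 0 by rewrite mulf_neq0 // expf_neq0.
  by rewrite [4 * _ * _]mulrC divfK // e /dupF; ring.
by rewrite FE GE x3E; ring.
Qed.

Lemma lnMp (R : realType) (x y : R) : 0 < x -> 0 < y -> ln (x * y) = ln x + ln y.
Proof. by move=> x0 y0; rewrite lnM ?posrE. Qed.

Lemma lnXp (R : realType) (x : R) n : 0 < x -> ln (x ^+ n) = n%:R * ln x.
Proof. by move=> x0; rewrite lnXn // mulr_natl. Qed.

Section Psi.
Variables (R : realType) (a b : int) (nu eta c rho : R).
Hypothesis D0 : cdisc a b != 0.
Hypothesis AD : arch_data (a%:~R : R) b%:~R nu eta c rho.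
Let g := abgcd a b.
Let M (x z : int) : R := xheight nu eta x%:~R z%:~R.

(** A logarithmic height whose real part is [xheight] and whose finite part is the weighted gcd. It
    depends only on the ratio x : z, so [dupF] and [dupG] can be inserted without reducing the
    fraction, and duplication costs one explicit constant. *)
Definition psi (x z : int) : R := ln (M x z) - 6^-1 * ln (wgcd g x z)%:R.

Let max1 (x z : int) : (x != 0) || (z != 0) -> 1 <= Num.max `|x%:~R : R| `|z%:~R|.
Proof.
by case/orP => h; rewrite le_max -!intr_norm !ler1z -!gtz0_ge1 !normr_gt0 h ?orbT.
Qed.

Lemma psi_M_gt0 x z : (x != 0) || (z != 0) -> 0 < M x z.
Proof.
move=> h; have [[e0 c0 r0] H _ _] := AD; have h1 := le_trans (max1 h) (H x%:~R z%:~R).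
by rewrite -(pmulr_rgt0 _ r0); apply: lt_le_trans ltr01 h1.
Qed.

Lemma psi_scale s x z : s != 0 -> (x != 0) || (z != 0) -> psi (s * x) (s * z) = psi x z.
Proof.
move=> s0 xz0; have M0 := psi_M_gt0 xz0; have w0 := wgcd_gt0 D0 xz0.
have sn : 0 < `|s%:~R : R| by rewrite normr_gt0 intr_eq0.
have E1 : M (s * x) (s * z) = M x z * `|s%:~R|.
  rewrite /M /xheight maxr_pMl // -normrM !intrM; congr Num.max; first by congr `|_|; ring.
  by rewrite normrM; ring.
have E2 : wgcd g (s * x) (s * z) = (wgcd g x z * `|s| ^ 6)%N.
  rewrite /wgcd muln_gcdl !abszM !expnMn; congr gcdn; first by rewrite mulnC.
  by rewrite [(`|s| ^ 6 * _)%N]mulnC mulnA.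
have sr : (`|s|%N%:R : R) = `|s%:~R| by rewrite natr_absz -intr_norm.
rewrite /psi E1 E2 natrM natrX sr lnM ?posrE // lnM ?posrE ?ltr0n ?exprn_gt0 // lnXn //.
by rewrite -(mulr_natr (ln _) 6); field.
Qed.

Lemma psi_dup (k : nat) x z : (0 < k)%N -> (k %| 3)%N -> (k ^ 3 * g %| `|a| ^ 3)%N ->
  (x != 0) || (z != 0) ->
  4 * psi x z - ln (4 * `|cdisc a b|%N%:R / (c * k%:R * g%:R)) <= psi (dupF a b x z) (dupG a b x z).
Proof.
move=> k0 k3 hk xz0; have [[e0 c0 r0] _ H _] := AD.
have M0 := psi_M_gt0 xz0; have M1 := psi_M_gt0 (dup_neq0 D0 xz0).
have w0 := wgcd_gt0 D0 xz0; have w1 := wgcd_gt0 D0 (dup_neq0 D0 xz0).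
have g0 := abgcd_gt0 D0.
have h1 : c * M x z ^+ 4 <= M (dupF a b x z) (dupG a b x z).
  have := H x%:~R z%:~R; rewrite /M; congr (_ <= xheight _ _ _ _); rewrite /dupF /dupG; ring.
have h2 := global_doubling D0 k0 k3 hk xz0; rewrite -/g in h2 g0 w0 w1.
have D1 : (0 < 4 * `|cdisc a b|)%N by rewrite muln_gt0 absz_gt0.
set w := wgcd _ x z in h2 w0; set w' := wgcd _ _ _ in h2 w1.
rewrite /psi -/w -/w'.
move: h1; rewrite -ler_ln ?posrE ?mulr_gt0 ?exprn_gt0 // (lnMp c0 (exprn_gt0 4 M0)) (lnXp 4 M0) => h1.
have : k%:R ^+ 6 * g%:R ^+ 6 * w'%:R <= (4 * `|cdisc a b|%N%:R) ^+ 6 * w%:R ^+ 4 :> R.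
  by rewrite -(natrM _ 4) -!natrX -!natrM ler_nat.
set D := 4 * _; have Dp : 0 < D by rewrite /D mulr_gt0 // ltr0n absz_gt0.
have kp : 0 < k%:R :> R by rewrite ltr0n.
have gp : 0 < g%:R :> R by rewrite ltr0n.
have wp : 0 < w%:R :> R by rewrite ltr0n.
have wp' : 0 < w'%:R :> R by rewrite ltr0n.
have p6 (y : R) n : 0 < y -> 0 < y ^+ n by move=> ?; rewrite exprn_gt0.
have pm (y1 y2 : R) : 0 < y1 -> 0 < y2 -> 0 < y1 * y2 by exact: mulr_gt0.
have L1 : ln (k%:R ^+ 6 * g%:R ^+ 6 * w'%:R) = 6 * ln k%:R + 6 * ln g%:R + ln (w'%:R : R).
  by rewrite (lnMp (pm _ _ (p6 _ _ kp) (p6 _ _ gp)) wp') (lnMp (p6 _ _ kp) (p6 _ _ gp)) !lnXp.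
have L2 : ln (D ^+ 6 * w%:R ^+ 4) = 6 * ln D + 4 * ln (w%:R : R).
  by rewrite (lnMp (p6 _ _ Dp) (p6 _ _ wp)) !lnXp.
have L3 : ln (D / (c * k%:R * g%:R)) = ln D - (ln c + ln k%:R + ln g%:R).
  have ck := pm _ _ c0 kp; have q := pm _ _ ck gp.
  by rewrite ln_div ?posrE // (lnMp ck gp) (lnMp c0 kp).
rewrite -ler_ln ?posrE ?L1 ?L2 ?L3; first by lra.
  by apply: (pm) => //; apply: (pm); apply: (p6).
by apply: (pm); apply: (p6).
Qed.

Lemma psi_ge x z : coprimez x z ->
  ln (Num.max `|x%:~R| `|z%:~R|) <= ln rho + psi x z + 6^-1 * ln (g%:R : R).
Proof.
move=> cxz; have xz0 := coprimez_neq0 cxz; have [[e0 c0 r0] H _ _] := AD.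
have M0 := psi_M_gt0 xz0; have w0 := wgcd_gt0 D0 xz0; have g0 := abgcd_gt0 D0.
have h1 : Num.max `|x%:~R : R| `|z%:~R| <= rho * M x z by exact: H.
have wg : (wgcd g x z <= g)%N.
  apply: dvdn_leq => //; rewrite /wgcd Gauss_gcdl ?dvdn_gcdr //.
  by rewrite coprimeXl // coprimeXr.
have h2 : ln (wgcd g x z)%:R <= ln (g%:R : R) by rewrite ler_ln ?posrE ?ltr0n ?ler_nat.
have m0 : 0 < Num.max `|x%:~R : R| `|z%:~R| by apply: lt_le_trans ltr01 (max1 xz0).
have L : ln (Num.max `|x%:~R : R| `|z%:~R|) <= ln (rho * M x z) by rewrite ler_ln ?posrE ?mulr_gt0.
by move: L; rewrite (lnMp r0 M0) /psi -/g -/(M x z); lra.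
Qed.

Lemma psi_le x z : coprimez x z ->
  psi x z <= ln (1 + `|nu| + eta) + ln (Num.max `|x%:~R| `|z%:~R|).
Proof.
move=> cxz; have xz0 := coprimez_neq0 cxz; have [[e0 c0 r0] _ _ _] := AD.
have M0 := psi_M_gt0 xz0; have w0 := wgcd_gt0 D0 xz0.
have m1 := max1 xz0; set m := Num.max _ _ in m1 *.
have C0 : 0 < 1 + `|nu| + eta by have := normr_ge0 nu; lra.
have mx : `|x%:~R : R| <= m by rewrite /m le_max lexx.
have mz : `|z%:~R : R| <= m by rewrite /m le_max lexx orbT.
have h1 : M x z <= (1 + `|nu| + eta) * m.
  rewrite /M /xheight ge_max !mulrDl mul1r; apply/andP; split.
    apply: le_trans (ler_normB _ _) _; rewrite normrM.
    have : `|nu| * `|z%:~R| <= `|nu| * m by rewrite ler_wpM2l.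
    have : 0 <= eta * m by rewrite mulr_ge0 ?(ltW e0) //; lra.
    lra.
  have : eta * `|z%:~R| <= eta * m by rewrite ler_wpM2l // ltW.
  have : 0 <= `|nu| * m by rewrite mulr_ge0 //; lra.
  lra.
have h2 : 0 <= ln ((wgcd g x z)%:R : R) by rewrite ln_ge0 // ler1n.
have m0 : 0 < m by lra.
have L : ln (M x z) <= ln ((1 + `|nu| + eta) * m) by rewrite ler_ln ?posrE ?mulr_gt0.
by move: L; rewrite (lnMp C0 m0) /psi -/g -/(M x z); lra.
Qed.

End Psi.

Local Open Scope classical_set_scope.
Local Open Scope ring_scope.

(** * Comparison of the naive with the canonical height *)

Lemma hW_ptE (R : realType) P :
  hW_pt R P = ln (Num.max `|(xz P).1%:~R| `|(xz P).2%:~R| : R).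
Proof.
case: P => [[x y]|] /=; last by rewrite normr1 normr0 max_l // ln1.
by rewrite /hW_rat -!intr_norm (gtr0_norm (denq_gt0 x)).
Qed.

Lemma cvg_expn2 : (fun k : nat => (2 ^ k)%N) @ \oo --> \oo.
Proof.
apply/cvgnyPge => N; exists N => // k /= Nk.
by apply: leq_trans Nk _; apply: ltnW; apply: ltn_expl.
Qed.

(** Duplication controls only the terms at powers of 2; for a convergent sequence this subsequence
    has the same limit. *)
Lemma cvgn_ge_geometric (R : realType) (u : nat -> R) (B C : R) : cvgn u ->
  (forall k, B - C / 4 ^+ k <= u (2 ^ k)%N) -> B <= limn u.
Proof.
move=> cu H.
have h1 : (fun k => u (2 ^ k)%N) @ \oo --> limn u by apply: (cvg_comp _ _ cvg_expn2 cu).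
have h2 : (fun k => C / 4 ^+ k) @ \oo --> (0 : R).
  have := @cvg_geometric R C (4^-1) _; rewrite /geometric /= => h.
  rewrite (_ : (fun k => C / 4 ^+ k) = (fun n => C * 4^-1 ^+ n)); last by apply/funext => k; rewrite exprVn.
  by apply: h; rewrite gtr0_norm ?invf_lt1 ?ltr1n.
have h3 : (fun k => u (2 ^ k)%N + C / 4 ^+ k) @ \oo --> limn u + 0 by exact: cvgD h1 h2.
rewrite addr0 in h3; have <- := cvg_lim (@Rhausdorff R) h3.
apply: limr_ge; first by apply/cvg_ex; exists (limn u).
by apply: nearW => k; rewrite -lerBlDr.
Qed.

(** The exponent is 40 = 12 * (2 * 5/3). The two sides differ by only about two percent, so e is
    bounded below by eight terms of its series and little is lost in each power. *)
Lemma exp40_bound (R : realType) : 2 ^+ 29 * (256 * 81) ^+ 2 <= expR 40 :> R.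
Proof.
have e1 : 2718%:R / 1000%:R <= expR 1 :> R.
  have nd : {homo series (exp_coeff (1 : R)) : n m / (n <= m)%N >-> n <= m}.
    by apply/nondecreasing_seqP => n; rewrite seriesSr lerDl; apply: exp_coeff_ge0.
  apply: le_trans (nondecreasing_cvgn_le nd (is_cvg_series_exp_coeff _) 8).
  rewrite /series /= !big_nat_recr //= big_geq // /exp_coeff /= !expr1n !factS fact0 !muln1.
  lra.
have step (x y : R) n : 0 <= y -> y <= expR x -> y ^+ n <= expR (n%:R * x).
  by move=> y0 h; rewrite expRM_natl lerXn2r ?nnegrE ?expR_ge0.
have e5 : 1483%:R / 10%:R <= expR 5 :> R.
  have := step 1 (2718%:R / 1000%:R) 5; rewrite mulr1 => h; apply: le_trans (h _ e1); last by lra.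
  lra.
have e10 : 21992%:R <= expR 10 :> R.
  have := step 5%:R (1483%:R / 10%:R) 2; rewrite -natrM => h; apply: le_trans (h _ e5); last by lra.
  lra.
have e20 : 483648064%:R <= expR 20 :> R.
  have := step 10%:R 21992%:R 2; rewrite -natrM => h; apply: le_trans (h _ e10); last by lra.
  lra.
have := step 20%:R 483648064%:R 2; rewrite -natrM => h; apply: le_trans (h _ e20); last by lra.
lra.
Qed.

Lemma ec_discE a b : ec_disc a b = - 16 * cdisc a b. Proof. by []. Qed.

Lemma ec_disc_cdisc a b : ec_disc a b != 0 -> cdisc a b != 0.
Proof. by apply: contra => /eqP h; rewrite ec_discE h mulr0. Qed.

Lemma hW_disc (R : realType) a b : cdisc a b != 0 ->
  hW_rat R ((ec_disc a b)%:~R) = 4 * ln 2 + ln `|cdisc a b|%N%:R.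
Proof.
move=> D0; have D1 : 0 < `|cdisc a b|%N%:R :> R by rewrite ltr0n absz_gt0.
rewrite /hW_rat numq_int denq_int ec_discE -natr_absz abszM.
have N : (0 < `|cdisc a b|)%N by rewrite absz_gt0.
rewrite max_l; last by rewrite ler1n muln_gt0 N.
by rewrite natrM lnMp // (_ : `|(- 16)%R|%N = 2 ^ 4)%N // natrX lnXp.
Qed.

Lemma hW_j_ge (R : realType) a b : cdisc a b != 0 ->
  ln (Num.max (6912%:R * `|a%:~R| ^+ 3) `|cdisc a%:~R b%:~R|) - ln (jgcd a b)%:R <= hW_rat R (j_inv a b).
Proof.
move=> D0; have [n nE] : exists n : int, n = 256 * 27 * a ^+ 3 by exists (256 * 27 * a ^+ 3).
have [d dE] : exists d : int, d = cdisc a b by exists (cdisc a b).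
rewrite -dE in D0.
have d0 : d%:~R != 0 :> rat by rewrite intr_eq0.
have jE : j_inv a b = n%:~R / d%:~R.
  have -> : n%:~R = 256 * 27 * a%:~R ^+ 3 :> rat by rewrite nE; ring.
  by rewrite /j_inv ec_discE -dE intrM; field.
set j := j_inv a b in jE *.
have [s [ds ns]] : exists s, d = s * denq j /\ n = s * numq j.
  rewrite jE; move: d0; case: (divqP n d) => [_|k x k0 _]; first by rewrite eqxx.
  by exists k; split; reflexivity.
clear d0 jE; clearbody j.
have s0 : s != 0 by apply: contra D0 => /eqP h; rewrite ds h mul0r.
have sg : (`|s| <= jgcd a b)%N.
  apply: dvdn_leq; first by rewrite /jgcd gcdn_gt0 -dE [X in _ || X]absz_gt0 D0 orbT.
  have nE' : (256 * 27 * `|a| ^ 3)%N = `|n|%N by rewrite nE abszM abszX.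
  rewrite /jgcd dvdn_gcd nE' -dE; apply/andP; split.
    by rewrite ns abszM; apply: dvdn_mulr.
  by rewrite ds abszM; apply: dvdn_mulr.
set X := Num.max _ _.
have XE : X = `|s|%N%:R * Num.max `|numq j|%:~R (denq j)%:~R.
  rewrite maxr_pMr // natr_absz -{1}(gtr0_norm (denq_gt0 j)) -!intrM -!normrM -ns -ds /X !intr_norm.
  congr Num.max; last by rewrite dE /cdisc; congr `|_|; ring.
  have -> : n%:~R = 6912%:R * a%:~R ^+ 3 :> R by rewrite nE; ring.
  by rewrite normrM normrX normr_nat.
set H := Num.max _ _ in XE.
have H1 : 1 <= H by rewrite le_max !ler1z -!gtz0_ge1 denq_gt0 orbT.
have H0 : 0 < H by lra.
have sp : 0 < `|s|%N%:R :> R by rewrite ltr0n absz_gt0.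
have jp : 0 < (jgcd a b)%:R :> R by rewrite ltr0n (leq_trans _ sg) // absz_gt0.
rewrite XE lnMp // /hW_rat -/H.
have : ln `|s|%N%:R <= ln (jgcd a b)%:R :> R by rewrite ler_ln ?posrE ?ler_nat.
lra.
Qed.

(** The cancellation lj enters with weight 1/4, of which 1/12 is estimated by lD and 1/6 by lN + 2
    lk + lg. Then lD, lk and lg disappear and 29 l2 + 2 lN <= 40 is what remains. *)
Lemma height_const_lin (R : realType) (l2 lN lk lg lj lD lr lc lX hj : R) :
  lX - lj <= hj -> lj <= lD -> lj <= lN + 2 * lk + lg -> 29%:R * l2 + 2 * lN <= 40%:R ->
  3 * lD + 12 * lr <= 5 * l2 + 4 * lc + 3 * lX ->
  lr + 6^-1 * lg + 3^-1 * (2 * l2 + lD - (lc + lk + lg)) <=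
  2 * (8^-1 * hj + 12^-1 * (4 * l2 + lD) + 5 / 3 - l2).
Proof. lra. Qed.

Lemma height_const (R : realType) a b (nu eta c rho : R) : cdisc a b != 0 ->
  arch_data a%:~R b%:~R nu eta c rho ->
  exists k : nat, [/\ (0 < k)%N, (k %| 3)%N, (k ^ 3 * abgcd a b %| `|a| ^ 3)%N &
    ln rho + 6^-1 * ln (abgcd a b)%:R + 3^-1 * ln (4 * `|cdisc a b|%N%:R / (c * k%:R * (abgcd a b)%:R))
     <= 2 * (deltaE R a b - ln 2)].
Proof.
move=> D0 [[e0 c0 r0] _ _ A]; have [k [k0 k3 hk hj]] := jgcd_bound D0.
exists k; split=> //; have g0 := abgcd_gt0 D0; set g := abgcd a b in hk hj g0 *.
have gp : 0 < g%:R :> R by rewrite ltr0n.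
have kp : 0 < k%:R :> R by rewrite ltr0n.
have H1 := hW_j_ge R D0; have H2 := hW_disc R D0.
have j0 : (0 < jgcd a b)%N by rewrite /jgcd gcdn_gt0 [X in _ || X]absz_gt0 D0 orbT.
have jp : 0 < (jgcd a b)%:R :> R by rewrite ltr0n.
have Dp : 0 < `|cdisc a b|%N%:R :> R by rewrite ltr0n absz_gt0.
have DE : `|cdisc (a%:~R : R) b%:~R| = `|cdisc a b|%N%:R.
  by rewrite natr_absz intr_norm; congr `|_|; rewrite /cdisc; ring.
have jD : ln (jgcd a b)%:R <= ln `|cdisc a b|%N%:R :> R.
  by rewrite ler_ln ?posrE // ler_nat dvdn_leq ?dvdn_gcdr // absz_gt0.
have [N NE] : exists N : nat, N = (256 * 81)%N by exists (256 * 81)%N.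
have N0 : (0 < N)%N by rewrite NE muln_gt0.
have NR : 256 * 81 = N%:R :> R by rewrite NE natrM.
rewrite -NE in hj; have K0 : 0 < N%:R :> R by rewrite ltr0n.
have jK : ln (jgcd a b)%:R <= ln N%:R + 2 * ln k%:R + ln g%:R :> R.
  have k2 := exprn_gt0 2 kp; have Nk2 := mulr_gt0 K0 k2.
  rewrite -(lnXp 2 kp) -(lnMp K0 k2) -(lnMp Nk2 gp).
  by rewrite ler_ln ?posrE ?(mulr_gt0 Nk2 gp) // -natrX -!natrM ler_nat.
have E40 : 29%:R * ln 2 + 2 * ln N%:R <= 40%:R :> R.
  have p29 : 0 < 2 ^+ 29 :> R by rewrite exprn_gt0.
  have p2 : 0 < N%:R ^+ 2 :> R by exact: exprn_gt0.
  have := exp40_bound R; rewrite NR; rewrite -ler_ln ?posrE ?expR_gt0 ?(mulr_gt0 p29 p2) // expRK.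
  by rewrite (lnMp p29 p2) !lnXp.
rewrite DE in A H1; set X := Num.max _ _ in A H1.
have Xp : 0 < X by rewrite lt_max Dp orbT.
have A' : 3 * ln `|cdisc a b|%N%:R + 12 * ln rho <= 5 * ln 2 + 4 * ln c + 3 * ln X.
  have p5 : 0 < 32%:R :> R by [].
  have pl : 0 < `|cdisc a b|%N%:R ^+ 3 * rho ^+ 12 by rewrite mulr_gt0 ?exprn_gt0.
  have pc : 0 < 32%:R * c ^+ 4 by rewrite mulr_gt0 ?exprn_gt0.
  move: A; rewrite -ler_ln ?posrE //; last by rewrite mulr_gt0 ?exprn_gt0.
  rewrite (lnMp (exprn_gt0 3 Dp) (exprn_gt0 12 r0)) (lnMp pc (exprn_gt0 3 Xp)) (lnMp p5 (exprn_gt0 4 c0)).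
  by rewrite (_ : 32%:R = 2 ^+ 5 :> R) ?lnXp //; ring.
have ck : 0 < c * k%:R by rewrite mulr_gt0.
have ckg : 0 < c * k%:R * g%:R by rewrite mulr_gt0.
have D4 : 0 < 4 * `|cdisc a b|%N%:R :> R by rewrite mulr_gt0.
have p4 : 0 < 4 :> R by [].
have l4 : ln 4 = 2 * ln 2 :> R by rewrite -lnXp // (_ : 2 ^+ 2 = 4 :> R) //; ring.
rewrite ln_div ?posrE // (lnMp p4 Dp) (lnMp ck gp) (lnMp c0 kp) l4.
rewrite /deltaE H2; exact: (height_const_lin H1 jD jK E40 A').
Qed.

Lemma psi_double (R : realType) a b (nu eta c rho : R) (k : nat) Q : cdisc a b != 0 ->
  arch_data a%:~R b%:~R nu eta c rho ->
  (0 < k)%N -> (k %| 3)%N -> (k ^ 3 * abgcd a b %| `|a| ^ 3)%N -> on_curve a b Q ->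
  4 * psi a b nu eta (xz Q).1 (xz Q).2 - ln (4 * `|cdisc a b|%N%:R / (c * k%:R * (abgcd a b)%:R)) <=
  psi a b nu eta (xz (ec_add a Q Q)).1 (xz (ec_add a Q Q)).2.
Proof.
move=> D0 AD k0 k3 hk oQ; have q0 := coprimez_neq0 (xz_coprime Q).
apply: le_trans (psi_dup D0 AD k0 k3 hk q0) _.
have := dup_cross oQ; have := dup_neq0 D0 q0; have := xz_coprime (ec_add a Q Q).
set F := dupF _ _ _ _; set G := dupG _ _ _ _; set x := (xz _).1; set z := (xz _).2.
move=> cxz FG0 e; have xz0 := coprimez_neq0 cxz.
have [s [Fs Gs]] : exists s, F = s * x /\ G = s * z.
  have [/= u [v uv]] := Bezoutz x z; exists (u * F + v * G).
  have uv1 : u * x + v * z = 1 by rewrite uv; apply/eqP.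
  split.
    transitivity (F * (u * x + v * z)); first by rewrite uv1 mulr1.
    transitivity (u * F * x + v * (F * z)); [by ring|by rewrite e; ring].
  transitivity (G * (u * x + v * z)); first by rewrite uv1 mulr1.
  by transitivity (u * (G * x) + v * G * z); [ring|rewrite -e; ring].
have s0 : s != 0 by apply/eqP => s0; move: FG0; rewrite Fs Gs s0 !mul0r eqxx.
by rewrite Fs Gs (psi_scale D0 AD s0 xz0).
Qed.

(** Subtracting K/3 turns the duplication estimate into ps(2Q) - K/3 >= 4 (ps(Q) - K/3), which can
    be iterated. Convergence is assumed here since [limn] of a divergent sequence carries no
    information; [cvg_qlim] provides it later. *)
Theorem height_le_canon (R : realType) a b P : ec_disc a b != 0 -> on_curve a b P ->
  cvgn (fun n : nat => (hW_pt R (ec_muln a n P) / (n%:R ^+ 2))) ->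
  hW_pt R P <= 2 * canon_height R a P + 2 * (deltaE R a b - ln 2).
Proof.
move=> disc0 oP cu; have D0 := ec_disc_cdisc disc0.
have [nu [eta [c [rho AD]]]] := arch_data_exists R D0.
have [k [k0 k3 hk HC]] := height_const D0 AD.
have [[e0 c0 r0] _ _ _] := AD.
set K := ln (4 * _ / _) in HC.
pose ps Q := psi a b nu eta (xz Q).1 (xz Q).2.
have dbl Q : on_curve a b Q -> 4 * ps Q - K <= ps (ec_add a Q Q).
  by move=> oQ; exact: (psi_double D0 AD k0 k3 hk oQ).
have [p pE] : exists p : ept disc0, val p = P by exists (exist _ P oP).
have mulE n : ec_muln a n P = val (p *+ n) by rewrite eptMn pE.
pose B := ps P - K / 3; pose C := ln (1 + `|nu| + eta) - K / 3.
have psk n : 4 ^+ n * B <= ps (ec_muln a (2 ^ n) P) - K / 3.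
  elim: n => [|n IH]; first by rewrite expn0 expr0 mul1r mulE mulr1n pE.
  have on : on_curve a b (ec_muln a (2 ^ n) P) by rewrite mulE; exact: (valP (p *+ (2 ^ n))).
  have := dbl _ on; rewrite [ec_add _ _ _](_ : _ = ec_muln a (2 ^ n.+1) P); last first.
    by rewrite !mulE -eptD -mulrnDr addnn -mul2n -expnS.
  rewrite exprS; move: IH; lra.
have LB : B <= 2 * canon_height R a P.
  have -> : 2 * canon_height R a P = limn (fun n : nat => (hW_pt R (ec_muln a n P) / (n%:R ^+ 2))).
    by rewrite /canon_height mulrA divff // mul1r.
  apply: (@cvgn_ge_geometric _ _ _ C) cu _ => n.
  have p4 : 0 < 4 ^+ n :> R by rewrite exprn_gt0.
  rewrite natrX -exprM mulnC exprM (_ : 2 ^+ 2 = 4 :> R); last by ring.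
  rewrite ler_pdivlMr // mulrBl divfK ?gt_eqF // [B * _]mulrC.
  have := psi_le D0 AD (xz_coprime (ec_muln a (2 ^ n) P)); rewrite -hW_ptE.
  have := psk n; rewrite /ps /C; lra.
have := psi_ge D0 AD (xz_coprime P); rewrite -hW_ptE -/(ps P).
move: LB HC; rewrite /B; lra.
Qed.

(** * The canonical height *)

Section QuadraticMap.
Variables (R : realType) (V : zmodType) (q : V -> R).
Hypothesis para : forall P Q, q (P + Q) + q (P - Q) = 2 * q P + 2 * q Q.

Definition polar (P Q : V) : R := 2^-1 * (q (P + Q) - q P - q Q).

Lemma quad0 : q 0 = 0.
Proof. by have := para 0 0; rewrite addr0 subr0; lra. Qed.

Lemma quadN P : q (- P) = q P.
Proof. by have := para 0 P; rewrite add0r sub0r quad0; lra. Qed.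

Lemma polarC P Q : polar P Q = polar Q P.
Proof. by rewrite /polar (addrC P); ring. Qed.

Lemma polarxx P : polar P P = q P.
Proof. by have := para P P; rewrite /polar subrr quad0; lra. Qed.

(** The Jordan-von Neumann argument: a linear combination of four instances of the parallelogram
    law. *)
Lemma polarDl P Q S : polar (P + Q) S = polar P S + polar Q S.
Proof.
have h1 := para (P + S) Q; have h2 := para P (S - Q); have h4 := para Q S.
have e4 : q (S - Q) = q (Q - S) by rewrite -quadN opprB.
have e1 : P + S + Q = P + Q + S by rewrite addrAC.
have e2 : P + (S - Q) = P + S - Q by rewrite addrA.
have e3 : P - (S - Q) = P + Q - S by rewrite opprB addrA.
have h6 := para (P + Q) S.
rewrite e1 in h1; rewrite e2 e3 e4 in h2; rewrite /polar; lra.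
Qed.

Lemma polar0l S : polar 0 S = 0.
Proof. by rewrite /polar add0r quad0; lra. Qed.

Lemma polarNl P S : polar (- P) S = - polar P S.
Proof. by have := polarDl P (- P) S; rewrite subrr polar0l; lra. Qed.

Lemma polarMnl P S n : polar (P *+ n) S = n%:R * polar P S.
Proof. by elim: n => [|n IH]; rewrite ?mulr0n ?polar0l ?mul0r // mulrS polarDl IH -natr1; ring. Qed.

Lemma polarMzl P S (n : int) : polar (P *~ n) S = n%:~R * polar P S.
Proof. by case: n => n; rewrite ?polarMnl // NegzE !mulrNz polarNl polarMnl mulNr. Qed.

Lemma polarMzr P S (n : int) : polar S (P *~ n) = n%:~R * polar S P.
Proof. by rewrite polarC polarMzl polarC. Qed.

Lemma quadMn P n : q (P *+ n) = n%:R ^+ 2 * q P.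
Proof. by rewrite -polarxx polarMnl polarC polarMnl polarxx; ring. Qed.

Lemma quad_sum r (P : 'I_r -> V) (n : 'I_r -> int) :
  q (\sum_i P i *~ n i) = \sum_i \sum_j (n i)%:~R * (n j)%:~R * polar (P i) (P j).
Proof.
rewrite -polarxx.
have suml I (s : seq I) (F : I -> V) S : polar (\sum_(i <- s) F i) S = \sum_(i <- s) polar (F i) S.
  by elim/big_rec2: _ => [|i y1 y2 _ IH]; rewrite ?polar0l // polarDl IH.
rewrite suml; apply: eq_bigr => i _; rewrite polarC suml; apply: eq_bigr => j _.
by rewrite polarMzl polarMzr (polarC (P j)); ring.
Qed.

End QuadraticMap.

Section QuasiParallelogram.
Variables (R : realType) (V : zmodType) (h : V -> R) (C : R).
Hypothesis h_ge0 : forall P, 0 <= h P.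
Hypothesis h0 : h 0 = 0.
Hypothesis quasi : forall P Q, `|h (P + Q) + h (P - Q) - 2 * h P - 2 * h Q| <= C.

Let v (P : V) (k : nat) : R := h (P *+ (2 ^ k)) / 4 ^+ k.

Let p4 k : 0 < 4 ^+ k :> R. Proof. by rewrite exprn_gt0. Qed.

Let v_step P k : `|v P k.+1 - v P k| <= C / 4 ^+ k.+1.
Proof.
have := quasi (P *+ (2 ^ k)) (P *+ (2 ^ k)); rewrite subrr h0 -mulrnDr addnn -mul2n -expnS addr0 => H.
rewrite /v (_ : _ - _ = (h (P *+ (2 ^ k.+1)) - 2 * h (P *+ (2 ^ k)) - 2 * h (P *+ (2 ^ k))) / 4 ^+ k.+1); last first.
  by rewrite exprS; field; rewrite gt_eqF.
by rewrite normrM normfV (gtr0_norm (p4 _)) ler_pM2r ?invr_gt0.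
Qed.

Let C0 : 0 <= C. Proof. exact: le_trans (normr_ge0 _) (quasi 0 0). Qed.

Let v_ge0 P k : 0 <= v P k.
Proof. by apply: divr_ge0 (h_ge0 _) (ltW (p4 k)). Qed.

Let c_ge0 k : 0 <= C / 3 / 4 ^+ k.
Proof. by apply: divr_ge0 (ltW (p4 k)); apply: divr_ge0. Qed.

Let geo0 : (fun k => C / 3 / 4 ^+ k) @ \oo --> (0 : R).
Proof.
have := @cvg_geometric R (C / 3) (4^-1) _; rewrite /geometric /= => H.
rewrite (_ : (fun k => _) = (fun n => C / 3 * 4^-1 ^+ n)); last by apply/funext => k; rewrite exprVn.
by apply: H; rewrite gtr0_norm ?invf_lt1 ?ltr1n.
Qed.

Let v_cvg P : cvgn (v P).
Proof.
(* The added term decreases by exactly C / 4^(k+1), the largest possible step of [v], so the sum is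
   nonincreasing. *)
have cw : cvgn (fun k => v P k + C / 3 / 4 ^+ k).
  apply: nonincreasing_is_cvgn.
    apply/nonincreasing_seqP => k; have := v_step P k; rewrite ler_norml => /andP[_].
    rewrite exprS invfM; set z := (4 ^+ k)^-1; rewrite !mulrA; lra.
  exists 0 => _ [k _ <-]; apply: addr_ge0; first exact: v_ge0.
  exact: c_ge0.
have -> : v P = (fun k => (v P k + C / 3 / 4 ^+ k) - C / 3 / 4 ^+ k) by apply/funext => k; rewrite addrK.
by apply: is_cvgB => //; apply/cvg_ex; exists 0.
Qed.

Definition qlim (P : V) : R := limn (v P).

Lemma qlim_para P Q : qlim (P + Q) + qlim (P - Q) = 2 * qlim P + 2 * qlim Q.
Proof.
apply/eqP; rewrite -subr_eq0; apply/eqP.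
have H : (fun k => v (P + Q) k + v (P - Q) k - (2 * v P k + 2 * v Q k)) @ \oo -->
   qlim (P + Q) + qlim (P - Q) - (2 * qlim P + 2 * qlim Q).
  by apply: cvgB; apply: cvgD; try exact: v_cvg; apply: cvgM; [exact: cvg_cst|exact: v_cvg|exact: cvg_cst|exact: v_cvg].
apply: (cvg_unique _ H); first exact: Rhausdorff.
apply/cvgr0Pnorm_le => e e0.
have C40 : (fun k => C / 4 ^+ k) @ \oo --> (0 : R).
  have H3 : (fun k => 3 * (C / 3 / 4 ^+ k)) @ \oo --> 3 * (0 : R) by apply: cvgM; [exact: cvg_cst|exact: geo0].
  rewrite mulr0 in H3; rewrite (_ : (fun k => C / 4 ^+ k) = (fun k => 3 * (C / 3 / 4 ^+ k))) //.
  by apply/funext => k; field; rewrite gt_eqF.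
have bd k : `|v (P + Q) k + v (P - Q) k - (2 * v P k + 2 * v Q k)| <= C / 4 ^+ k.
  have := quasi (P *+ (2 ^ k)) (Q *+ (2 ^ k)); rewrite -mulrnDl -mulrnBl => H1.
  rewrite (_ : _ - _ = (h ((P + Q) *+ (2 ^ k)) + h ((P - Q) *+ (2 ^ k)) - 2 * h (P *+ (2 ^ k)) - 2 * h (Q *+ (2 ^ k))) / 4 ^+ k); last first.
    by rewrite /v; field; rewrite gt_eqF.
  by rewrite normrM normfV (gtr0_norm (p4 k)) ler_pM2r ?invr_gt0.
have /cvgr0Pnorm_le/(_ _ e0) := C40; apply: filterS => k; apply: le_trans.
by apply: le_trans (bd k) _; rewrite ler_norm.
Qed.

Lemma qlim_ge0 P : 0 <= qlim P.
Proof. by apply: limr_ge; [exact: v_cvg|apply: nearW => k; exact: v_ge0]. Qed.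

Lemma qlim_dist P : `|qlim P - h P| <= C / 3.
Proof.
have B k : `|v P k - h P| <= C / 3 - C / 3 / 4 ^+ k.
  elim: k => [|k IH]; first by rewrite /v expn0 mulr1n expr0 !divr1 !subrr normr0.
  rewrite (_ : _ - h P = (v P k.+1 - v P k) + (v P k - h P)); last by ring.
  apply: le_trans (ler_normD _ _) _; have := v_step P k.
  rewrite exprS invfM; set z := (4 ^+ k)^-1 in IH *; rewrite !mulrA; lra.
have cn : (fun k => `|v P k - h P|) @ \oo --> `|qlim P - h P|.
  by apply: cvg_norm; apply: cvgB; [exact: v_cvg|exact: cvg_cst].
rewrite -(cvg_lim (@Rhausdorff R) cn); apply: limr_le; first by apply/cvg_ex; exists `|qlim P - h P|.
apply: nearW => k; apply: le_trans (B k) _.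
by rewrite gerBl c_ge0.
Qed.

(** The limit along powers of 2 satisfies the exact parallelogram law, hence qlim(nP) = n^2 qlim(P).
    As h stays within C/3 of qlim, the error at n is at most C / (3 n^2), for all n as
    [canon_height] demands. *)
Lemma cvg_qlim P : (fun n : nat => h (P *+ n) / n%:R ^+ 2) @ \oo --> qlim P.
Proof.
apply/cvgrPdist_le => e e0.
have C3 : 0 <= C / 3 by rewrite divr_ge0 ?C0.
exists (Num.bound (C / 3 / e)).+1 => // n /= Nn.
have n0 : (0 < n)%N by apply: leq_trans Nn.
have np : 0 < n%:R :> R by rewrite ltr0n.
have np2 : 0 < n%:R ^+ 2 :> R by rewrite exprn_gt0.
have -> : qlim P - h (P *+ n) / n%:R ^+ 2 = (qlim (P *+ n) - h (P *+ n)) / n%:R ^+ 2.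
  by rewrite (quadMn qlim_para); field; rewrite gt_eqF.
rewrite normrM normfV (gtr0_norm np2) ler_pdivrMr //; apply: le_trans (qlim_dist _) _.
have hN : C / 3 / e <= n%:R.
  have ce : 0 <= C / 3 / e by apply: divr_ge0 C3 (ltW e0).
  by apply: ltW; apply: lt_le_trans (archi_boundP ce) _; rewrite ler_nat ltnW.
have n1 : 1 <= n%:R :> R by rewrite ler1n.
rewrite ler_pdivrMr // in hN; apply: le_trans hN _; rewrite mulrC ler_wpM2l ?(ltW e0) //.
by rewrite expr2 ler_peMl ?(ltW np).
Qed.
End QuasiParallelogram.

(** * The quasi-parallelogram law for the naive height *)

(** In homogeneous coordinates x(P+Q) + x(P-Q) = U/W and x(P+Q) x(P-Q) = V/W, for U, V, W given by
    this and the next two definitions. *)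
Definition sumU (R : comPzRingType) (a b x1 z1 x2 z2 : R) :=
  2 * (x1 * x2 + a * z1 * z2) * (x1 * z2 + x2 * z1) + 4 * b * z1 ^+ 2 * z2 ^+ 2.
Definition sumV (R : comPzRingType) (a b x1 z1 x2 z2 : R) :=
  (x1 * x2 - a * z1 * z2) ^+ 2 - 4 * b * z1 * z2 * (x1 * z2 + x2 * z1).
Definition sumW (R : comPzRingType) (x1 z1 x2 z2 : R) := (x1 * z2 - x2 * z1) ^+ 2.

(** Proportionality through the 2 by 2 minors, which makes sense without division and includes the
    points at infinity. *)
Definition prop3 (R : pzRingType) (t u : R * R * R) : Prop :=
  [/\ t.1.1 * u.1.2 = t.1.2 * u.1.1, t.1.1 * u.2 = t.2 * u.1.1 & t.1.2 * u.2 = t.2 * u.1.2].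

Definition symprod (R : pzRingType) (p q : R * R) : R * R * R :=
  (p.1 * q.1, p.1 * q.2 + q.1 * p.2, p.2 * q.2).

Lemma symprodC (R : comPzRingType) (p q : R * R) : symprod p q = symprod q p.
Proof. by rewrite /symprod addrC !(mulrC p.1) !(mulrC p.2). Qed.

Lemma prop3_dup (R : comPzRingType) (F G : R) (p : R * R) : F * p.2 = G * p.1 ->
  prop3 (symprod p (1, 0)) (F, G, 0).
Proof.
move=> D; split=> /=; rewrite ?mulr0 ?mul0r // mulr1 mul1r add0r.
by rewrite mulrC -D mulrC.
Qed.

Lemma xz_neg (P Q : ecpt) : xz (ec_neg P) = xz P.
Proof. by case: P => [[]|]. Qed.

Lemma xz_some x y : exists s : rat, [/\ s != 0, (xz (Some (x, y))).1%:~R = x * s & (xz (Some (x, y))).2%:~R = s].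
Proof.
have d0 : (denq x)%:~R != 0 :> rat by rewrite intr_eq0 denq_neq0.
by exists (denq x)%:~R; split => //=; rewrite -{2}[x]divq_num_den divfK.
Qed.

Lemma sum_cross a b P Q : on_curve a b P -> on_curve a b Q ->
  let p := xz P in let q := xz Q in
  prop3 (symprod (xz (ec_add a P Q)) (xz (ec_add a P (ec_neg Q))))
        (sumV a b p.1 p.2 q.1 q.2, sumU a b p.1 p.2 q.1 q.2, sumW p.1 p.2 q.1 q.2).
Proof.
case: P => [[x1 y1]|] oP; last first.
  move=> _ /=; rewrite xz_neg //; case: (xz Q) => x z.
  by rewrite /symprod /sumU /sumV /sumW /=; split=> /=; ring.
case: Q => [[x2 y2]|] oQ; last first.
  rewrite /= /symprod /sumU /sumV /sumW /=; split=> /=; ring.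
move=> p q.
have [x12|x12] := eqVneq x1 x2.
  have D := dup_cross oP; rewrite -/p in D.
  have pq : q = p by rewrite /p /q /= x12.
  have y12 : y2 = y1 \/ y2 = - y1.
    have : y2 ^+ 2 = y1 ^+ 2 by move/eqP: oP => ->; move/eqP: oQ => ->; rewrite x12.
    by move/eqP; rewrite eqf_sqr => /orP[] /eqP; [left|right].
  rewrite pq; have W : sumW p.1 p.2 p.1 p.2 = 0 by rewrite /sumW subrr expr0n.
  have U : sumU a b p.1 p.2 p.1 p.2 = dupG a b p.1 p.2 by rewrite /sumU /dupG; ring.
  have V : sumV a b p.1 p.2 p.1 p.2 = dupF a b p.1 p.2 by rewrite /sumV /dupF; ring.
  rewrite W U V; have O1 y : ec_add a (Some (x1, y)) (Some (x1, - y)) = None by rewrite /= eqxx opprK eqxx.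
  by case: y12 => ->; rewrite -x12 /ec_neg ?opprK O1; [apply: prop3_dup|rewrite symprodC; apply: prop3_dup].
rewrite /ec_add /ec_neg !(negbTE x12) /=; set x3 := _ - x1 - x2; set x4 := _ - x1 - x2.
have [s1 [s10 X1 Z1]] := xz_some x1 y1; have [s2 [s20 X2 Z2]] := xz_some x2 y2.
rewrite -/p -/q in X1 Z1 X2 Z2.
have [s3 [s30 /= X3 Z3]] := xz_some x3 0; have [s4 [s40 /= X4 Z4]] := xz_some x4 0.
have d21 : x2 - x1 != 0 by rewrite subr_eq0 eq_sym.
have E1 : y1 ^+ 2 = x1 ^+ 3 + a%:~R * x1 + b%:~R by apply/eqP.
have E2 : y2 ^+ 2 = x2 ^+ 3 + a%:~R * x2 + b%:~R by apply/eqP.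
have S34 : (x3 + x4) * (x2 - x1) ^+ 2 = 2 * (x1 * x2 + a%:~R) * (x1 + x2) + 4 * b%:~R.
  transitivity (2 * (y1 ^+ 2 + y2 ^+ 2) - 2 * (x1 + x2) * (x2 - x1) ^+ 2).
    by rewrite /x3 /x4; field.
  by rewrite E1 E2; ring.
have P34 : x3 * x4 * (x2 - x1) ^+ 2 = (x1 * x2 - a%:~R) ^+ 2 - 4 * b%:~R * (x1 + x2).
  apply: (mulIf (x := (x2 - x1) ^+ 2)); first by rewrite expf_neq0.
  transitivity ((y1 ^+ 2 + y2 ^+ 2 - (x1 + x2) * (x2 - x1) ^+ 2) ^+ 2 - 4 * y1 ^+ 2 * y2 ^+ 2).
    by rewrite /x3 /x4; field.
  by rewrite E1 E2; ring.
have UE : (sumU a b p.1 p.2 q.1 q.2)%:~R = (x3 + x4) * (x2 - x1) ^+ 2 * (s1 * s2) ^+ 2 :> rat.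
  transitivity (sumU a%:~R b%:~R (p.1)%:~R (p.2)%:~R (q.1)%:~R (q.2)%:~R : rat).
    by rewrite /sumU; ring.
  by rewrite X1 Z1 X2 Z2 S34 /sumU; ring.
have VE : (sumV a b p.1 p.2 q.1 q.2)%:~R = x3 * x4 * (x2 - x1) ^+ 2 * (s1 * s2) ^+ 2 :> rat.
  transitivity (sumV a%:~R b%:~R (p.1)%:~R (p.2)%:~R (q.1)%:~R (q.2)%:~R : rat).
    by rewrite /sumV; ring.
  by rewrite X1 Z1 X2 Z2 P34 /sumV; ring.
have WE : (sumW p.1 p.2 q.1 q.2)%:~R = (x2 - x1) ^+ 2 * (s1 * s2) ^+ 2 :> rat.
  transitivity (sumW (p.1)%:~R (p.2)%:~R (q.1)%:~R (q.2)%:~R : rat).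
    by rewrite /sumW; ring.
  by rewrite X1 Z1 X2 Z2 /sumW; ring.
have T1 : (numq x3 * numq x4)%:~R = x3 * x4 * (s3 * s4) :> rat by rewrite intrM X3 X4; ring.
have T2 : (numq x3 * denq x4 + numq x4 * denq x3)%:~R = (x3 + x4) * (s3 * s4) :> rat.
  by rewrite intrD !intrM X3 X4 Z3 Z4; ring.
have T3 : (denq x3 * denq x4)%:~R = s3 * s4 :> rat by rewrite intrM Z3 Z4.
split=> /=; apply: (intr_inj (R := rat)); rewrite [LHS]intrM [RHS]intrM ?UE ?VE ?WE ?T1 ?T2 ?T3; ring.
Qed.

Definition norm3 (R : numDomainType) (t : R * R * R) : R :=
  Num.max `|t.1.1| (Num.max `|t.1.2| `|t.2|).

(* Gauss's lemma for the product of two primitive linear forms, with explicit Bezout coefficients. *)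
Lemma symprod_scale (p q : int * int) (u : int * int * int) :
  coprimez p.1 p.2 -> coprimez q.1 q.2 -> prop3 (symprod p q) u ->
  exists m, [/\ u.1.1 = m * (symprod p q).1.1, u.1.2 = m * (symprod p q).1.2 & u.2 = m * (symprod p q).2].
Proof.
move=> cp cq.
have cp2 : coprimez (p.1 ^+ 2) (p.2 ^+ 2) by rewrite coprimezXl // coprimezXr.
have [/= A [B AB]] := Bezoutz (p.1 ^+ 2) (p.2 ^+ 2).
have [/= s [t st]] := Bezoutz q.1 q.2.
have {AB cp2}AB : A * p.1 ^+ 2 + B * p.2 ^+ 2 = 1 by rewrite AB; apply/eqP.
have {st cq}st : s * q.1 + t * q.2 = 1 by rewrite st; apply/eqP.
set T := symprod p q; have [T1 T2 T3] : [/\ T.1.1 = p.1 * q.1, T.1.2 = p.1 * q.2 + q.1 * p.2 & T.2 = p.2 * q.2] by [].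
move: T T1 T2 T3 => [[T1 T2] T3] /= e1 e2 e3 [/= h12 h13 h23].
pose al := A * (s * p.1 - t * p.2); pose be := A * t * p.1 + B * s * p.2; pose ga := B * (t * p.2 - s * p.1).
have E : al * T1 + be * T2 + ga * T3 = 1.
  transitivity ((A * p.1 ^+ 2 + B * p.2 ^+ 2) * (s * q.1 + t * q.2)); last by rewrite AB st mulr1.
  by rewrite /al /be /ga e1 e2 e3; ring.
exists (al * u.1.1 + be * u.1.2 + ga * u.2); clearbody al be ga.
rewrite -e1 -e2 -e3; split.
- rewrite -[LHS]mulr1 -E; transitivity (al * T1 * u.1.1 + be * (T2 * u.1.1) + ga * (T3 * u.1.1)); first by ring.
  by rewrite -h12 -h13; ring.
- rewrite -[LHS]mulr1 -E; transitivity (al * (T1 * u.1.2) + be * T2 * u.1.2 + ga * (T3 * u.1.2)); first by ring.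
  by rewrite h12 -h23; ring.
rewrite -[LHS]mulr1 -E; transitivity (al * (T1 * u.2) + be * (T2 * u.2) + ga * T3 * u.2); first by ring.
by rewrite h13 h23; ring.
Qed.

Section Bounds.
Variable R : realFieldType.
Implicit Types x z a b : R.

(** The real counterpart of Gauss's lemma: cancellation in the middle coefficient of a product of
    two linear forms loses at most a factor 2. *)
Lemma symprod_norm_ge (p q : R * R) :
  Num.max `|p.1| `|p.2| * Num.max `|q.1| `|q.2| <= 2 * norm3 (symprod p q).
Proof.
case: p q => [x z] [x' z']; rewrite /norm3 /symprod /=.
set M := Num.max _ (Num.max _ _).
have h1 : `|x| * `|x'| <= M by rewrite /M -normrM le_max lexx.
have h2 : `|x * z' + x' * z| <= M by rewrite /M !le_max lexx orbT.
have h3 : `|z| * `|z'| <= M by rewrite /M -normrM !le_max lexx !orbT.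
have M0 : 0 <= M by apply: le_trans h2.
have t1 : `|x| * `|z'| <= `|x * z' + x' * z| + `|x'| * `|z|.
  by rewrite -!normrM -{1}[x * z'](addrK (x' * z)); apply: ler_normB.
have t2 : `|x'| * `|z| <= `|x * z' + x' * z| + `|x| * `|z'|.
  by rewrite -!normrM -{1}[x' * z](addKr (x * z')) addrC; apply: ler_normB.
case: (leP `|x| `|z|) => hxz; case: (leP `|x'| `|z'|) => hxz'; try lra.
- have : `|x| * `|z'| <= `|z| * `|z'| by rewrite ler_wpM2r.
  by rewrite [`|z| * `|x'|]mulrC; lra.
- have : `|x'| * `|z| <= `|x'| * `|x| by rewrite ler_wpM2l // ltW.
  by rewrite [`|x'| * `|x|]mulrC; lra.
Qed.

Lemma sum_norm_le a b x1 z1 x2 z2 m1 m2 : `|x1| <= m1 -> `|z1| <= m1 -> `|x2| <= m2 -> `|z2| <= m2 ->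
  norm3 (sumV a b x1 z1 x2 z2, sumU a b x1 z1 x2 z2, sumW x1 z1 x2 z2) <=
  (4 * (1 + `|a|) ^+ 2 + 8 * `|b|) * (m1 ^+ 2 * m2 ^+ 2).
Proof.
move=> hx1 hz1 hx2 hz2.
rewrite -exprMn; set N := m1 * m2.
have hxx : `|x1 * x2| <= N by apply: normM_le.
have hxz : `|x1 * z2| <= N by apply: normM_le.
have hzx : `|x2 * z1| <= N by rewrite mulrC; apply: normM_le.
have hzz : `|z1 * z2| <= N by apply: normM_le.
have N0 : 0 <= N by apply: le_trans hxx.
have a0 := normr_ge0 a; have b0 := normr_ge0 b.
have azz : `|a * (z1 * z2)| <= `|a| * N by apply: normM_le.
have s1 : `|x1 * x2 + a * (z1 * z2)| <= N + `|a| * N by apply: normD_le.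
have s1' : `|x1 * x2 - a * (z1 * z2)| <= N + `|a| * N by apply: normB_le.
have s2 : `|x1 * z2 + x2 * z1| <= N + N by apply: normD_le.
have zz2 : `|(z1 * z2) ^+ 2| <= N ^+ 2 by rewrite normrX lerXn2r ?nnegrE.
have c4b : `|4 * b| <= 4 * `|b| by rewrite normrM normr_nat.
have N2 : 0 <= N ^+ 2 by rewrite sqr_ge0.
have U : `|sumU a b x1 z1 x2 z2| <= 2 * ((N + `|a| * N) * (N + N)) + 4 * `|b| * N ^+ 2.
  rewrite (_ : sumU _ _ _ _ _ _ = 2 * ((x1 * x2 + a * (z1 * z2)) * (x1 * z2 + x2 * z1)) + 4 * b * (z1 * z2) ^+ 2); last by rewrite /sumU; ring.
  by apply: normD_le; [apply: normc_le => //; apply: normM_le|apply: normM_le].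
have V : `|sumV a b x1 z1 x2 z2| <= (N + `|a| * N) ^+ 2 + 4 * `|b| * (N * (N + N)).
  rewrite (_ : sumV _ _ _ _ _ _ = (x1 * x2 - a * (z1 * z2)) ^+ 2 - 4 * b * ((z1 * z2) * (x1 * z2 + x2 * z1))); last by rewrite /sumV; ring.
  apply: normB_le; last by apply: normM_le => //; apply: normM_le.
  by rewrite normrX lerXn2r ?nnegrE ?(le_trans _ s1').
have W : `|sumW x1 z1 x2 z2| <= (N + N) ^+ 2.
  by rewrite /sumW normrX lerXn2r ?nnegrE ?addr_ge0 //; apply: normB_le.
have aN : 0 <= `|a| * N ^+ 2 by rewrite mulr_ge0.
have aaN : 0 <= `|a| ^+ 2 * N ^+ 2 by rewrite mulr_ge0 ?sqr_ge0.
have bN : 0 <= `|b| * N ^+ 2 by rewrite mulr_ge0.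
rewrite /norm3 /= !ge_max; apply/and3P; split.
- apply: le_trans V _; move: aN aaN bN N2; lra.
- apply: le_trans U _; move: aN aaN bN N2; lra.
- apply: le_trans W _; move: aN aaN bN N2; lra.
Qed.
End Bounds.

Section Canonical.
Variables (R : realType) (a b : int).
Hypothesis disc0 : ec_disc a b != 0.
Local Notation E := (ept disc0).
Implicit Types P Q : E.

Let D0 := ec_disc_cdisc disc0.

Definition hW (P : E) : R := hW_pt R (val P).

Let mx (P : ecpt) : R := Num.max `|(xz P).1%:~R| `|(xz P).2%:~R|.

Let mx_ge1 (X : ecpt) : 1 <= mx X.
Proof.
have := coprimez_neq0 (xz_coprime X).
by case/orP => h; rewrite /mx le_max -!intr_norm !ler1z -!gtz0_ge1 !normr_gt0 h ?orbT.
Qed.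

Lemma hW_ge0 P : 0 <= hW P.
Proof. by rewrite /hW hW_ptE ln_ge0 // mx_ge1. Qed.

Lemma hW0 : hW 0 = 0. Proof. by []. Qed.

(** The triple (V, U, W) is an integer multiple m of the primitive one belonging to P + Q and P - Q,
    so reduction can only lower its size. If m were 0 then P and Q would have the same abscissa and
    [dupF], [dupG] would vanish together. *)
Lemma hW_sum_le : exists C : R, forall P Q, hW (P + Q) + hW (P - Q) <= 2 * hW P + 2 * hW Q + C.
Proof.
pose K : R := 4 * (1 + `|a%:~R|) ^+ 2 + 8 * `|b%:~R|.
have K0 : 0 < K by rewrite ltr_pwDl ?mulr_ge0 // mulr_gt0 // exprn_gt0 // ltr_pwDl.
exists (ln (2 * K)) => P Q; rewrite /hW !hW_ptE -!/(mx _).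
have [oP oQ] := (valP P, valP Q); rewrite eptD eptD eptN.
set P3 := ec_add a (val P) (val Q); set P4 := ec_add a (val P) _.
have := sum_cross oP oQ; rewrite -/P3 -/P4.
set p := xz (val P); set q := xz (val Q) => /=.
set u := (_, _, _) => cr.
have [m [u1 u2 u3]] := symprod_scale (xz_coprime P3) (xz_coprime P4) cr.
have un0 : ~ [/\ u.1.1 = 0, u.1.2 = 0 & u.2 = 0].
  rewrite /u /= => -[V0 U0 W0]; have p0 := coprimez_neq0 (xz_coprime (val P)).
  have [cp cq] := (xz_coprime (val P), xz_coprime (val Q)); rewrite -/p -/q in p0 cp cq.
  move/eqP: W0; rewrite /sumW sqrf_eq0 subr_eq0 => /eqP W0.
  have [k [k1 k2]] : exists k, q.1 = k * p.1 /\ q.2 = k * p.2.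
    have [/= s [t st]] := Bezoutz p.1 p.2; have {}st : s * p.1 + t * p.2 = 1 by rewrite st; apply/eqP.
    exists (s * q.1 + t * q.2); split; rewrite -[LHS]mulr1 -st.
      by transitivity (s * q.1 * p.1 + t * (q.1 * p.2)); [ring|rewrite -W0; ring].
    by transitivity (s * (p.1 * q.2) + t * q.2 * p.2); [ring|rewrite W0; ring].
  have k0 : k != 0 by apply/eqP => k0; have := coprimez_neq0 cq; rewrite k1 k2 k0 !mul0r eqxx.
  have F0 : dupF a b p.1 p.2 = 0.
    have : k ^+ 2 * dupF a b p.1 p.2 = 0 by rewrite -V0 k1 k2 /sumV /dupF; ring.
    by move/eqP; rewrite mulf_eq0 expf_eq0 /= (negbTE k0) => /eqP.
  have G0 : dupG a b p.1 p.2 = 0.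
    have : k ^+ 2 * dupG a b p.1 p.2 = 0 by rewrite -U0 k1 k2 /sumU /dupG; ring.
    by move/eqP; rewrite mulf_eq0 expf_eq0 /= (negbTE k0) => /eqP.
  by have := dup_neq0 D0 p0; rewrite F0 G0 eqxx.
have m0 : m != 0.
  by apply/eqP => m0; apply: un0; rewrite u1 u2 u3 m0 !mul0r.
have m1 : 1 <= `|m%:~R : R| by rewrite -intr_norm ler1z -gtz0_ge1 normr_gt0.
pose cst (t : int * int * int) : R * R * R := (t.1.1%:~R, t.1.2%:~R, t.2%:~R).
pose pr (t : int * int) : R * R := (t.1%:~R, t.2%:~R).
have n1 : mx P3 * mx P4 <= 2 * norm3 (cst (symprod (xz P3) (xz P4))).
  have := symprod_norm_ge (pr (xz P3)) (pr (xz P4)); rewrite /mx /pr /symprod /cst /=.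
  by rewrite !intrD !intrM.
have n2 : norm3 (cst (symprod (xz P3) (xz P4))) <= norm3 (cst u).
  rewrite /norm3 /cst u1 u2 u3 /= !ge_max !le_max !intrM !normrM.
  by rewrite !ler_peMl // !orbT.
have n3 : norm3 (cst u) <= K * (mx (val P) ^+ 2 * mx (val Q) ^+ 2).
  have := @sum_norm_le R a%:~R b%:~R p.1%:~R p.2%:~R q.1%:~R q.2%:~R (mx (val P)) (mx (val Q)).
  rewrite /mx !le_max !lexx !orbT => /(_ isT isT isT isT); congr (norm3 _ <= _).
  by rewrite /cst /u /=; congr (_, _, _); rewrite /sumV /sumU /sumW; ring.
have mp X : 0 < mx X by apply: lt_le_trans ltr01 (mx_ge1 X).
have K2 : 0 < 2 * K by rewrite mulr_gt0.
have mm : 0 < mx (val P) ^+ 2 * mx (val Q) ^+ 2 by rewrite mulr_gt0 ?exprn_gt0.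
have : ln (mx P3 * mx P4) <= ln (2 * K * (mx (val P) ^+ 2 * mx (val Q) ^+ 2)).
  rewrite ler_ln ?posrE ?mulr_gt0 ?exprn_gt0 //; apply: le_trans n1 _.
  by rewrite -mulrA ler_wpM2l // (le_trans n2).
rewrite (lnMp (mp _) (mp _)) (lnMp K2 mm) (lnMp (exprn_gt0 2 (mp _)) (exprn_gt0 2 (mp _))) !lnXp //.
lra.
Qed.

Lemma hW_dbl_ge : exists C : R, forall P, 4 * hW P - C <= hW (P + P).
Proof.
have [nu [eta [c [rho AD]]]] := arch_data_exists R D0.
have [k [k0 k3 hk _]] := height_const D0 AD.
set K := ln rho + 6^-1 * ln (abgcd a b)%:R.
exists (4 * K + ln (4 * `|cdisc a b|%N%:R / (c * k%:R * (abgcd a b)%:R)) + ln (1 + `|nu| + eta)) => P; rewrite /hW.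
have oP := valP P; rewrite eptD.
have h1 := psi_ge D0 AD (xz_coprime (val P)); rewrite -hW_ptE in h1.
have h2 := psi_le D0 AD (xz_coprime (ec_add a (val P) (val P))); rewrite -hW_ptE in h2.
have h3 := psi_double D0 AD k0 k3 hk oP; move: h1 h2 h3; rewrite /K; lra.
Qed.

Lemma hW_quasi : exists C : R, forall P Q, `|hW (P + Q) + hW (P - Q) - 2 * hW P - 2 * hW Q| <= C.
Proof.
have [C1 H1] := hW_sum_le; have [C2 H2] := hW_dbl_ge.
exists (Num.max C1 (C1 / 2 + C2)) => P Q; rewrite ler_norml le_max lerNl le_max.
(* The lower bound comes from the upper bound at P + Q and P - Q, whose sum and difference are 2P
   and 2Q, and from the lower bound for duplication. *)
have h1 := H1 P Q; have h2 := H1 (P + Q) (P - Q); have h3 := H2 P; have h4 := H2 Q.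
have e1 : P + Q + (P - Q) = P + P by rewrite addrACA subrr addr0.
have e2 : P + Q - (P - Q) = Q + Q by rewrite opprB addrC addrA subrK.
rewrite e1 e2 in h2; apply/andP; split; apply/orP; [right|left]; lra.
Qed.

Definition canonh (P : E) : R := canon_height R a (val P).

Let hWn P : (fun n : nat => hW_pt R (ec_muln a n (val P)) / n%:R ^+ 2) = (fun n => hW (P *+ n) / n%:R ^+ 2).
Proof. by apply/funext => n; rewrite /hW eptMn. Qed.

Let canonhE P : (canonh P = 2^-1 * qlim hW P) /\
  (cvgn (fun n : nat => hW_pt R (ec_muln a n (val P)) / n%:R ^+ 2 : R)).
Proof.
have [C HC] := hW_quasi; have H := @cvg_qlim _ _ _ _ hW_ge0 hW0 HC P.
rewrite /canonh /canon_height hWn (cvg_lim (@Rhausdorff R) H); split=> //.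
Qed.

Lemma canonh_para P Q : canonh (P + Q) + canonh (P - Q) = 2 * canonh P + 2 * canonh Q.
Proof.
have [C HC] := hW_quasi; have := qlim_para hW_ge0 hW0 HC P Q.
rewrite !(fun X => (canonhE X).1); lra.
Qed.

Lemma canonh_ge0 P : 0 <= canonh P.
Proof.
have [C HC] := hW_quasi; rewrite (canonhE P).1 mulr_ge0 ?invr_ge0 //.
exact: qlim_ge0 hW_ge0 hW0 HC P.
Qed.

Lemma hW_le_canonh P : hW P <= 2 * canonh P + 2 * (deltaE R a b - ln 2).
Proof. exact: height_le_canon (valP P) (canonhE P).2. Qed.

(** A quadratic map vanishes on torsion and so do the pairings with torsion: n^2 q(Q) = q(nQ) = 0,
    and n times the pairing of Q with P is 0. *)
Lemma canonh_torsion P Q n : (0 < n)%N -> Q *+ n = 0 -> canonh (P + Q) = canonh P.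
Proof.
move=> n0 Qn; have para := canonh_para.
have np : n%:R != 0 :> R by rewrite pnatr_eq0 -lt0n.
have q0 : canonh Q = 0.
  have := quadMn para Q n; rewrite Qn (quad0 para) => /esym/eqP.
  by rewrite mulf_eq0 expf_eq0 (negbTE np) andbF /= => /eqP.
have p0 : polar canonh Q P = 0.
  have := polarMnl para Q P n; rewrite Qn (polar0l para) => /esym/eqP.
  by rewrite mulf_eq0 (negbTE np) /= => /eqP.
move: p0; rewrite /polar q0 (addrC Q); lra.
Qed.
End Canonical.

(** * The volume of the unit ball *)

Lemma is_derive_conv (R : realType) (f g : R -> R) (x a b : R) :
  is_derive x 1 f a -> f =1 g -> a = b -> is_derive x 1 g b.
Proof. by move=> d /funext <- <-. Qed.

Lemma is_derive_expRN (R : realType) (t : R) : is_derive t 1 (fun t : R => expR (- t)) (- expR (- t)).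
Proof.
have := @is_derive1_comp R expR -%R t _ _ (is_derive_expR (- t)) (is_deriveNid t 1).
by move/is_derive_conv; apply=> //; rewrite mulrN1.
Qed.

Section GammaHalf.
Variable R : realType.
Implicit Types (t g : R) (k : nat).

(** In terms of a primitive with limits at both ends, integration by parts becomes an identity
    between functions. The value g is Gamma(k/2 + 1). *)
Definition gamma_prim k g := exists (F : R -> R) (l : R),
  [/\ forall t, 0 < t -> is_derive t 1 F (Num.sqrt t ^+ k * expR (- t)),
      F t @[t --> 0^'+] --> F 0, F t @[t --> +oo] --> l & l - F 0 = g].

Lemma is_derive_sqrt_exp k t : 0 < t ->
  is_derive t 1 (fun t : R => Num.sqrt t ^+ k.+1 * expR (- t))
    (k.+1%:R / 2 * Num.sqrt t ^+ k * expR (- t) * (Num.sqrt t)^-1 - Num.sqrt t ^+ k.+1 * expR (- t)).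
Proof.
move=> t0; have d1 := is_derive1_sqrt t0; have d2 := is_deriveX k.+1 d1.
have d4 := is_deriveM d2 (is_derive_expRN t).
apply: (is_derive_conv d4) => [x|]; first by rewrite !fctE.
rewrite /GRing.scale /= !fctE /=.
have s0 : Num.sqrt t != 0 by rewrite gt_eqF ?sqrtr_gt0.
by field.
Qed.

Lemma cvg_sqrt_exp0 k : (fun t : R => Num.sqrt t ^+ k * expR (- t)) t @[t --> 0^'+] --> Num.sqrt (0 : R) ^+ k * expR (- 0).
Proof.
apply: cvg_at_right_filter; apply: cvgM.
  by apply: (@continuous_comp _ _ _ (@Num.sqrt R) (fun x => x ^+ k)); [exact: sqrt_continuous|exact: exprn_continuous].
by apply: (@continuous_comp _ _ _ (-%R : R -> R) expR); [exact: opp_continuous|exact: continuous_expR].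
Qed.

Lemma cvg_sqrt_exp_pinfty k : Num.sqrt t ^+ k * expR (- t) @[t --> +oo] --> (0 : R).
Proof.
have c0 : (k.+1)`!%:R / t @[t --> +oo] --> (0 : R).
  rewrite -[0](mulr0 (k.+1)`!%:R); apply: cvgM; first exact: cvg_cst.
  by apply/gtr0_cvgV0; [exact: nbhs_pinfty_gt|exact: cvg_id].
apply: (squeeze_cvgr _ (cvg_cst (0 : R)) c0).
near=> t.
have t1 : 1 <= t by near: t; exact: nbhs_pinfty_ge.
have t0 : 0 < t by lra.
have s1 : 1 <= Num.sqrt t by rewrite -sqrtr1 ler_sqrt.
rewrite mulr_ge0 ?exprn_ge0 ?expR_ge0 //=.
have st : Num.sqrt t <= t by rewrite -{2}(sqr_sqrtr (ltW t0)) expr2 ler_peMl.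
have h1 : Num.sqrt t ^+ k <= t ^+ k by rewrite lerXn2r ?nnegrE // ltW.
have h2 : t ^+ k.+1 / (k.+1)`!%:R <= expR t.
  by apply: le_trans (expR_ge1Dxn k (ltW t0)); rewrite lerDr.
have f0 : 0 < (k.+1)`!%:R :> R by rewrite ltr0n fact_gt0.
rewrite expRN ler_pdivlMr // mulrAC ler_pdivrMr ?expR_gt0 //.
apply: le_trans (_ : t ^+ k.+1 <= _); first by rewrite exprSr ler_wpM2r // ltW.
by rewrite mulrC -ler_pdivrMr.
Unshelve. all: by end_near. Qed.

Lemma gamma_primS k g : gamma_prim k g -> gamma_prim k.+2 ((k%:R / 2 + 1) * g).
Proof.
move=> [F [l [dF F0 Fl lF]]].
exists (fun t => (k%:R / 2 + 1) * F t - Num.sqrt t ^+ k.+2 * expR (- t)), ((k%:R / 2 + 1) * l - 0); split.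
- move=> t t0; have d1 := is_deriveZ (k%:R / 2 + 1 : R) (dF t t0).
  have d2 := is_deriveB d1 (is_derive_sqrt_exp k.+1 t0).
  apply: (is_derive_conv d2) => //; rewrite /GRing.scale /= exprSr.
  have s0 : Num.sqrt t != 0 by rewrite gt_eqF ?sqrtr_gt0.
  by field.
- by apply: cvgB; [apply: cvgM => //; exact: cvg_cst|exact: cvg_sqrt_exp0].
- by apply: cvgB; [apply: cvgM => //; exact: cvg_cst|exact: cvg_sqrt_exp_pinfty].
- by rewrite sqrtr0 expr0n /= -lF; ring.
Qed.

Lemma gamma_prim0 : gamma_prim 0 1.
Proof.
exists (fun t => - expR (- t)), 0; split.
- move=> t t0; apply: (is_derive_conv (is_deriveN (is_derive_expRN t))) => //.
  by rewrite opprK expr0 mul1r.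
- have h := @cvg_sqrt_exp0 0; rewrite (_ : (fun t => - expR (- t)) = (fun t : R => - (Num.sqrt t ^+ 0 * expR (- t)))).
    have e : expR (- 0) = Num.sqrt 0 ^+ 0 * expR (- 0) :> R by rewrite expr0 mul1r.
    by rewrite e; exact: cvgN h.
  by apply/funext => t; rewrite expr0 mul1r.
- have h := @cvg_sqrt_exp_pinfty 0; rewrite (_ : (fun t => - expR (- t)) = (fun t : R => - (Num.sqrt t ^+ 0 * expR (- t)))).
    by rewrite -[X in _ --> X]oppr0; apply: cvgN.
  by apply/funext => t; rewrite expr0 mul1r.
- by rewrite oppr0 expR0; ring.
Qed.

Lemma Gamma_prim k g : gamma_prim k g -> Gamma (k%:R / 2 + 1 : R) = g.
Proof.
move=> [F [l [dF F0 Fl <-]]]; rewrite /Gamma addrK.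
rewrite -(@Rintegral_ge0_continuous_FTC2y R (fun t => Num.sqrt t ^+ k * expR (- t)) F 0 l) //.
- rewrite /Rintegral; congr fine; rewrite -integral_itv_obnd_cbnd.
    apply: eq_integral => t; rewrite inE /= in_itv /= andbT => t0; congr EFin; congr (_ * _).
    by rewrite -powR_mulrn ?sqrtr_ge0 // -powR12_sqrt ?(ltW t0) // -powRrM mulrC.
  apply/measurable_EFinP; apply: open_continuous_measurable_fun; first exact: interval_open.
  move=> t _; apply: cvgM.
    by apply: (@continuous_comp _ _ _ (@Num.sqrt R) (fun x => x ^+ k)); [exact: sqrt_continuous|exact: exprn_continuous].
  by apply: (@continuous_comp _ _ _ (-%R : R -> R) expR); [exact: opp_continuous|exact: continuous_expR].
- apply: continuous_subspaceT => t; apply: cvgM.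
    by apply: (@continuous_comp _ _ _ (@Num.sqrt R) (fun x => x ^+ k)); [exact: sqrt_continuous|exact: exprn_continuous].
  by apply: (@continuous_comp _ _ _ (-%R : R -> R) expR); [exact: opp_continuous|exact: continuous_expR].
- by move=> t t0; have [] := dF t t0.
- move=> t; rewrite in_itv /= andbT => t0; rewrite derive1E; have d := dF t t0.
  exact: derive_val.
Qed.

Import gauss_integral_proof.

Let int_gauss (x : R) : lebesgue_measure.-integrable `[0, x] (EFin \o gauss_fun).
Proof.
apply: continuous_compact_integrable; first exact: segment_compact.
by apply: continuous_subspaceT; exact: continuous_gauss_fun.
Qed.

Let gauss_le (x : R) : 0 <= x -> integral0_gauss x <= x.
Proof.
move=> x0; have xE : x = \int[lebesgue_measure]_(t in `[0, x]) (1 : R).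
  by rewrite Rintegral_cst //= lebesgue_measure_itv /= lte_fin; case: (ltrP 0 x) => h /=; rewrite ?oppr0 ?addr0 ?mul1r ?mulr0 //; apply/eqP; rewrite eq_le h x0.
rewrite [leRHS]xE; apply: le_Rintegral.
- exact: measurable_itv.
- exact: int_gauss.
- apply: continuous_compact_integrable; first exact: segment_compact.
  by apply: continuous_subspaceT => t; exact: cvg_cst.
- by move=> t _; exact: gauss_fun_le1.
Qed.

(** Substituting t = s^2 and integrating by parts reduces Gamma(3/2) to the Gaussian integral over
    the half-line. *)
Lemma gamma_prim1 : gamma_prim 1 (Num.sqrt pi / 2).
Proof.
exists (fun t => integral0_gauss (Num.sqrt t) - Num.sqrt t ^+ 1 * expR (- t)), (Num.sqrt pi / 2 - 0); split.
- move=> t t0; have s0 : 0 < Num.sqrt t by rewrite sqrtr_gt0.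
  have lt1 : Num.sqrt t < Num.sqrt t + 1 by rewrite ltrDl.
  have [d1 d2] := continuous_FTC1_closed lt1 (int_gauss _) s0 (@continuous_gauss_fun R (Num.sqrt t)).
  have d3 : is_derive (Num.sqrt t) 1 (@integral0_gauss R) (gauss_fun (Num.sqrt t)).
    by apply: DeriveDef; [exact: d1|rewrite -derive1E; exact: d2].
  have d4 := is_deriveB (is_derive1_comp d3 (is_derive1_sqrt t0)) (is_derive_sqrt_exp 0 t0).
  apply: (is_derive_conv d4) => //.
  rewrite /gauss_fun sqr_sqrtr ?(ltW t0) //.
  by field; rewrite gt_eqF.
- rewrite [X in _ --> X](_ : _ = (0 : R) - Num.sqrt 0 ^+ 1 * expR (- 0)); last first.
    congr (_ - _); rewrite sqrtr0; apply/eqP; rewrite eq_le gauss_le // integral0_gauss_ge0 //.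
  apply: cvgB; last exact: cvg_sqrt_exp0.
  have c0 : Num.sqrt t @[t --> 0^'+] --> (0 : R).
    by rewrite -[X in _ --> X]sqrtr0; apply: cvg_at_right_filter; exact: sqrt_continuous.
  apply: (squeeze_cvgr _ (cvg_cst (0 : R)) c0); near=> t.
  by rewrite integral0_gauss_ge0 gauss_le.
- apply: cvgB; last exact: cvg_sqrt_exp_pinfty.
  have h : Num.sqrt (@integral0_gauss R (Num.sqrt t) ^+ 2) @[t --> +oo] --> Num.sqrt (pi / 4 : R).
    apply: continuous_cvg; first exact: sqrt_continuous.
    apply: (cvg_comp (@Num.sqrt R) (fun x => integral0_gauss x ^+ 2)) cvg_integral0_gauss_sqr.
    apply/cvgryPge => A; near=> t.
    have [A0|A0] := lerP A 0; first exact: le_trans (sqrtr_ge0 _).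
    by rewrite -(ger0_norm (ltW A0)) -sqrtr_sqr ler_wsqrtr //; near: t; exact: nbhs_pinfty_ge.
  rewrite sqrtrM ?pi_ge0 // sqrtrV // (_ : 4 = 2 ^+ 2) in h; last by ring.
  rewrite sqrtr_sqr ger0_norm // in h.
  rewrite (_ : (fun t => integral0_gauss (Num.sqrt t)) = (fun t => Num.sqrt (@integral0_gauss R (Num.sqrt t) ^+ 2))) //.
  by apply/funext => t; rewrite sqrtr_sqr ger0_norm // integral0_gauss_ge0.
- by rewrite sqrtr0 mul0r !subr0; apply/eqP; rewrite subr_eq addrC -subr_eq subrr eq_sym eq_le gauss_le ?integral0_gauss_ge0.
Unshelve. all: by end_near. Qed.
End GammaHalf.

Section BallVolume.
Variable R : realType.

(** The integral of (1 - y^2)^(k/2) over [-1, 1], which is the ratio of the volumes of the unit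
    balls in dimensions k + 1 and k. *)
Fixpoint slice_integral (k : nat) : R :=
  match k with
  | 0 => 2
  | 1 => pi / 2
  | k'.+2 => k'.+2%:R / k'.+3%:R * slice_integral k'
  end.

Lemma slice_integralSS k : slice_integral k.+2 = k.+2%:R / k.+3%:R * slice_integral k.
Proof. by []. Qed.

Lemma OmegaSS k : Omega R k.+2 = 2 * pi / k.+2%:R * Omega R k.
Proof.
have [g hg] : exists g, gamma_prim k (g : R).
  have : (exists g, gamma_prim k (g : R)) /\ (exists g, gamma_prim k.+1 (g : R)).
    elim: k => [|k [[g hg] h2]]; first by split; [exists 1; exact: gamma_prim0|eexists; exact: gamma_prim1].
    by split=> //; eexists; exact: gamma_primS hg.
  by case.
have G1 := Gamma_prim hg; have G2 := Gamma_prim (gamma_primS hg).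
rewrite /Omega G1 G2.
have pi0 : pi != 0 :> R by rewrite gt_eqF ?pi_gt0.
have -> : (pi : R) `^ (k.+2%:R / 2) = pi * pi `^ (k%:R / 2).
  transitivity ((pi : R) `^ 1 * pi `^ (k%:R / 2)); last by rewrite powRr1 ?pi_ge0.
  rewrite -powRD ?pi0 ?implybT //; congr powR.
  by rewrite -addn2 natrD; field.
have k0 : (k.+2%:R : R) != 0 by rewrite pnatr_eq0.
have -> : k%:R / 2 + 1 = k.+2%:R / 2 :> R by rewrite -addn2 natrD; field.
by rewrite !invfM invrK; ring.
Qed.

Lemma Omega0 : Omega R 0 = 1.
Proof. by rewrite /Omega (Gamma_prim (@gamma_prim0 R)) mul0r powRr0 invr1 mulr1. Qed.

Lemma Omega1 : Omega R 1 = 2.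
Proof.
have s0 : Num.sqrt pi != 0 :> R by rewrite gt_eqF // sqrtr_gt0 pi_gt0.
by rewrite /Omega (Gamma_prim (@gamma_prim1 R)) mul1r powR12_sqrt ?pi_ge0 //; field.
Qed.

Lemma OmegaS k : Omega R k.+1 = slice_integral k * Omega R k.
Proof.
have [Om0 Om1] := (Omega0, Omega1).
elim/ltn_ind: k => -[_|[_|k IH]].
- by rewrite Om1 Om0 mulr1.
- by rewrite (OmegaSS 0) Om1 Om0 /=; field.
rewrite OmegaSS IH // mulrA; rewrite OmegaSS mulrA; congr (_ * _).
have h n : n.+1%:R != 0 :> R by rewrite pnatr_eq0.
rewrite slice_integralSS; move: (h k.+1) (h k.+2); set p : R := k.+2%:R; set q : R := k.+3%:R => p0 q0.
by clearbody p q; field; rewrite ?p0 ?q0.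
Qed.

(** The derivative is required only in the open interval, since sqrt(1 - y^2) and asin are not
    differentiable at the end points; the mean value theorem asks for no more. *)
Definition slice_prim (k : nat) (w : R) := exists F : R -> R,
  [/\ forall y : R, -1 < y < 1 -> is_derive y 1 F (Num.sqrt (1 - y ^+ 2) ^+ k),
      {within `[(-1 : R), 1], continuous F} & F 1 - F (-1) = w].

Lemma is_derive_circle (y : R) : -1 < y < 1 ->
  is_derive y 1 (fun y : R => Num.sqrt (1 - y ^+ 2)) (- y / Num.sqrt (1 - y ^+ 2)).
Proof.
move=> y1; have p0 : 0 < 1 - y ^+ 2 by move/andP: y1 => [y1 y2]; nra.
have d1 := is_deriveB (is_derive_cst (1 : R) y 1) (is_deriveX 2 (is_derive_id y 1)).
have d2 := @is_derive1_comp R (@Num.sqrt R) (fun y => 1 - y ^+ 2) y _ _ (is_derive1_sqrt p0).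
apply: (is_derive_conv (d2 _ (is_derive_conv d1 _ erefl))) => //.
rewrite /GRing.scale /= expr1 mulr1 sub0r; field.
by rewrite gt_eqF // sqrtr_gt0.
Qed.

Lemma continuous_circle k : continuous (fun y : R => Num.sqrt (1 - y ^+ 2) ^+ k).
Proof.
move=> y; apply: (@continuous_comp _ _ _ (fun y : R => 1 - y ^+ 2) (fun x : R => Num.sqrt x ^+ k)).
  by apply: cvgB; [exact: cvg_cst|exact: exprn_continuous].
by apply: (@continuous_comp _ _ _ (@Num.sqrt R) (fun x => x ^+ k)); [exact: sqrt_continuous|exact: exprn_continuous].
Qed.

Lemma slice_prim0 : slice_prim 0 2.
Proof.
exists id; split; last by ring.
  by move=> y _; rewrite expr0; exact: is_derive_id.
by apply: continuous_subspaceT => y; exact: cvg_id.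
Qed.

Lemma asin1 : asin 1 = pi / 2 :> R.
Proof.
rewrite -[X in asin X]sin_pihalf; apply: sinK.
by rewrite in_itv /= lexx andbT; have := pi_ge0 R; lra.
Qed.

Lemma asinN1 : asin (-1) = - (pi / 2) :> R.
Proof.
rewrite -[X in asin (- X)]sin_pihalf -sinN; apply: sinK.
by rewrite in_itv /= lexx /=; have := pi_ge0 R; lra.
Qed.

Lemma slice_prim1 : slice_prim 1 (pi / 2).
Proof.
exists (fun y => 2^-1 * (y * Num.sqrt (1 - y ^+ 2) ^+ 1 + asin y)); split.
- move=> y y1; have p0 : 0 < 1 - y ^+ 2 by move/andP: (y1) => [? ?]; nra.
  have d1 := is_deriveM (is_derive_id y 1) (is_derive_circle y1).
  have d2 := is_deriveZ (2^-1 : R) (is_deriveD d1 (is_derive1_asin y1)).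
  apply: (is_derive_conv d2) => [x|]; first by rewrite expr1.
  have s0 : Num.sqrt (1 - y ^+ 2) != 0 by rewrite gt_eqF // sqrtr_gt0.
  rewrite /GRing.scale /= expr1; set s := Num.sqrt _ in s0 *.
  have s2 : s ^+ 2 = 1 - y ^+ 2 by rewrite sqr_sqrtr // ltW.
  have -> : 2^-1 * (y * (- y / s) + s * 1 + s^-1) = 2^-1 * ((1 - y ^+ 2) / s + s) by field.
  by rewrite -s2; field.
- have c1 : {within `[-1, 1], continuous (@asin R)}.
    have ab : - (pi / 2) <= pi / 2 :> R by have := pi_ge0 R; lra.
    have cs : {within `[- (pi / 2), pi / 2], continuous (@sin R)}.
      by apply: continuous_subspaceT => y; exact: continuous_sin.
    by have := segment_can_le_continuous ab cs (@sinK R); rewrite sinN sin_pihalf.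
  move=> y; apply: cvgM; first exact: cvg_cst.
  apply: cvgD; last exact: c1.
  have cc : {within `[(-1 : R), 1], continuous (fun y : R => y * Num.sqrt (1 - y ^+ 2) ^+ 1)}.
    by apply: continuous_subspaceT => z; apply: cvgM; [exact: cvg_id|exact: continuous_circle].
  exact: cc.
- by rewrite asin1 asinN1 expr1n sqrrN expr1n subrr sqrtr0; field.
Qed.

Lemma slice_primS k w : slice_prim k w -> slice_prim k.+2 (k.+2%:R / k.+3%:R * w).
Proof.
move=> [F [dF cF Fw]].
have k3 : k.+3%:R != 0 :> R by rewrite pnatr_eq0.
exists (fun y => k.+3%:R^-1 * (y * Num.sqrt (1 - y ^+ 2) ^+ k.+2 + k.+2%:R * F y)); split.
- move=> y y1; have p0 : 0 < 1 - y ^+ 2 by move/andP: (y1) => [? ?]; nra.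
  have d1 := is_deriveM (is_derive_id y 1) (is_deriveX k.+2 (is_derive_circle y1)).
  have d2 := is_deriveZ (k.+3%:R^-1 : R) (is_deriveD d1 (is_deriveZ (k.+2%:R : R) (dF y y1))).
  apply: (is_derive_conv d2) => [x|]; first by rewrite /= !fctE.
  have s0 : Num.sqrt (1 - y ^+ 2) != 0 by rewrite gt_eqF // sqrtr_gt0.
  rewrite /GRing.scale /= !fctE; set s := Num.sqrt _ in s0 *.
  have s2 : y ^+ 2 = 1 - s ^+ 2 by rewrite sqr_sqrtr; [ring|exact: ltW].
  transitivity (k.+3%:R^-1 * (- (k.+2%:R * s ^+ k * y ^+ 2) + s ^+ k.+2 + k.+2%:R * s ^+ k)).
    move: k3; set p : R := k.+2%:R; set q : R := k.+3%:R => k3; clearbody p q.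
    by rewrite !exprSr; field; rewrite s0 k3.
  have e3 : k.+3%:R = k.+2%:R + 1 :> R by rewrite natr1.
  move: k3; rewrite s2 e3; set p : R := k.+2%:R => k3; clearbody p.
  by rewrite !exprSr; field.
- move=> y; apply: cvgM; first exact: cvg_cst.
  apply: cvgD; last by apply: cvgM; [exact: cvg_cst|exact: cF].
  have cc : {within `[(-1 : R), 1], continuous (fun y : R => y * Num.sqrt (1 - y ^+ 2) ^+ k.+2)}.
    by apply: continuous_subspaceT => z; apply: cvgM; [exact: cvg_id|exact: continuous_circle].
  exact: cc.
- by rewrite expr1n sqrrN expr1n subrr sqrtr0 expr0n /= -Fw; ring.
Qed.

Lemma slice_primP k : slice_prim k (slice_integral k).
Proof.
elim/ltn_ind: k => -[_|[_|k IH]]; [exact: slice_prim0|exact: slice_prim1|].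
by rewrite slice_integralSS; apply: slice_primS; apply: IH.
Qed.
End BallVolume.

(** * Integer points in ellipsoids *)

(** An interval of half-length sg around c0 is cut at the half-integers. In each slab the mean value
    theorem gives a y at which g times the width is the increment of F, and widths are at most 1.
    Each slab contributes its own integer, so the integers are distinct. *)
Lemma unit_slices (R : realType) (F g : R -> R) (c0 sg : R) : 0 < sg ->
  (forall y : R, -1 < y < 1 -> is_derive y 1 F (g y)) ->
  {within `[(-1 : R), 1], continuous F} -> (forall y, 0 <= g y) ->
  exists s : seq (int * R), [/\ uniq (map fst s),
    forall p, p \in s -> -1 < p.2 < 1 /\ `|c0 + sg * p.2 - p.1%:~R| <= 2^-1 &
    sg * (F 1 - F (-1)) <= \sum_(p <- s) g p.2].
Proof.
move=> sg0 dF cF g0.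
pose N := Num.bound (`|c0| + sg).
have hN : `|c0| + sg < N%:R by apply: archi_boundP; rewrite addr_ge0 // ltW.
(* [h j] is the cut j - N - 1/2 in the normalised coordinate and [p j] its truncation to [-1, 1]; N
   is so large that the cuts cover the interval. *)
pose h (j : nat) : R := (j%:R - N%:R - 2^-1 - c0) / sg.
pose p (j : nat) : R := Num.max (-1) (Num.min 1 (h j)).
have hS j : h j.+1 = h j + sg^-1 by rewrite /h -natr1; field; rewrite gt_eqF.
have sgi : 0 < sg^-1 by rewrite invr_gt0.
have p_ge j : -1 <= p j by rewrite /p le_max lexx.
have p_le j : p j <= 1 by rewrite /p ge_max ge_min lexx /= andbT; lra.
have pS j : p j <= p j.+1 <= p j + sg^-1.
  rewrite /p hS /Num.max /Num.min; do !case: ifPn; rewrite -?leNgt => *; lra.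
have claim J : exists s : seq (int * R), [/\ uniq (map fst s),
    forall q, q \in s -> (q.1 < J%:Z - N%:Z) /\ (-1 < q.2 < 1 /\ `|c0 + sg * q.2 - q.1%:~R| <= 2^-1) &
    sg * (F (p J) - F (p 0)) <= \sum_(q <- s) g q.2].
  elim: J => [|J [s [us hs ls]]]; first by exists [::]; split; rewrite ?big_nil ?subrr ?mulr0.
  have /andP[pJ1 pJ2] := pS J.
  have [pe|pn] := eqVneq (p J) (p J.+1).
    exists s; split=> //; last by rewrite -pe.
    move=> q qs; have [h1 h2] := hs q qs; split=> //; apply: lt_trans h1 _.
    by rewrite ltrD2r ltz_nat.
  have plt : p J < p J.+1 by rewrite lt_neqAle pn.
  have dF' y : y \in `]p J, p J.+1[ -> is_derive y 1 F (g y).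
    rewrite in_itv /= => /andP[y1 y2]; apply: dF; apply/andP; split.
      exact: le_lt_trans (p_ge J) y1.
    exact: lt_le_trans y2 (p_le _).
  have cF' : {within `[p J, p J.+1], continuous F}.
    apply: continuous_subspaceW cF => y /=; rewrite !in_itv /= => /andP[y1 y2].
    by rewrite (le_trans (p_ge J) y1) (le_trans y2 (p_le _)).
  have [y] := MVT plt dF' cF'; rewrite in_itv /= => /andP[y1 y2] yE.
  have yb1 : -1 < y := le_lt_trans (p_ge J) y1.
  have yb2 : y < 1 := lt_le_trans y2 (p_le J.+1).
  have hy1 : h J < y.
    move: y1; rewrite /p gt_max gt_min => /andP[_ /orP[|//]]; lra.
  have hy2 : y < h J.+1.
    move: y2; rewrite /p lt_max lt_min => /orP[|/andP[_ //]]; lra.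
  exists ((J%:Z - N%:Z, y) :: s); split.
  - rewrite /= us andbT; apply/negP => /mapP[q qs e]; have [] := hs q qs.
    by rewrite -e ltxx.
  - move=> q; rewrite inE => /orP[/eqP ->|qs] /=; last first.
      have [h1 h2] := hs q qs; split=> //; apply: lt_trans h1 _.
      by rewrite ltrD2r ltz_nat.
    split; first by rewrite ltrD2r ltz_nat.
    split; first by rewrite yb1 yb2.
    have hE : sg * h J = J%:R - N%:R - 2^-1 - c0 by rewrite mulrC divfK // gt_eqF.
    have hE' : sg * h J.+1 = sg * h J + 1 by rewrite hS mulrDr mulfV // gt_eqF.
    move: hy1 hy2; rewrite -(ltr_pM2l sg0) hE => hy1; rewrite -(ltr_pM2l sg0) hE' hE => hy2.
    by rewrite intrB ler_norml /=; apply/andP; split; lra.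
  rewrite big_cons /=.
  have : sg * (F (p J.+1) - F (p J)) <= g y.
    rewrite yE mulrCA ler_piMr //; have : sg * (p J.+1 - p J) <= sg * sg^-1 by rewrite ler_pM2l //; lra.
    by rewrite mulfV // gt_eqF.
  lra.
have [s [us hs ls]] := claim (N + N + 1)%N; exists s; split=> //.
  by move=> q qs; have [] := hs q qs.
have c1 : - `|c0| <= c0 by rewrite lerNl ler_normr lexx orbT.
have c2 : c0 <= `|c0| by rewrite ler_norm.
have p0 : p 0 = -1.
  rewrite /p max_l // ge_min; apply/orP; right.
  by rewrite /h ler_pdivrMr //; lra.
have p1 : p (N + N + 1)%N = 1.
  have h1 : 1 <= h (N + N + 1)%N by rewrite /h ler_pdivlMr // !natrD; lra.
  by rewrite /p min_l // max_r //; lra.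
by move: ls; rewrite p0 p1.
Qed.

Local Close Scope classical_set_scope.

Section PosDef.
Variable R : rcfType.

Definition qf n (A : 'M[R]_n) (x : 'rV[R]_n) : R := (x *m A *m x^T) 0 0.

Definition posdef n (A : 'M[R]_n) := A^T = A /\ forall x, x != 0 -> 0 < qf A x.

Lemma qf0 n (A : 'M[R]_n) : qf A 0 = 0.
Proof. by rewrite /qf mul0mx mul0mx mxE. Qed.

Lemma posdef_unit n (A : 'M[R]_n) : posdef A -> A \in unitmx.
Proof.
move=> [_ hA]; rewrite -row_free_unit -kermx_eq0; apply/eqP/row_matrixP => i.
rewrite row0; apply/eqP; apply: contraT => h; have := hA _ h.
have : row i (kermx A) *m A = 0 by apply: sub_kermxP; apply: row_sub.
by rewrite /qf => ->; rewrite mul0mx mxE ltxx.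
Qed.

(** Completing the square in x: A' is the form on the hyperplane t = 0 and e the Schur complement.
    Slices at fixed t are therefore translates of ellipsoids of A'. *)
Lemma schur_complement r (A : 'M[R]_(1 + r)) : posdef A ->
  exists (e : R) (w : 'rV[R]_r) (A' : 'M[R]_r),
  [/\ posdef A', 0 < e, \det A = e * \det A' &
      forall (t : R) x, qf A (row_mx t%:M x) = e * t ^+ 2 + qf A' (x + t *: w)].
Proof.
move=> hA; have [sA pA] := hA.
pose al := ulsubmx A; pose be := ursubmx A; pose A' := drsubmx A.
have eA : A = block_mx al be be^T A'.
  by rewrite /al /be /A' trmx_ursub sA submxK.
have sA' : A'^T = A' by rewrite /A' trmx_drsub sA.
have pA' : posdef A'.
  split=> // x x0; have : (row_mx (0 : 'M[R]_1) x : 'rV_(1 + r)) != 0.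
    apply: contra x0 => /eqP h; have := congr1 (@rsubmx R 1 1 r) h.
    by rewrite row_mxKr => ->; apply/eqP/matrixP => i j; rewrite !mxE.
  move/pA; rewrite {1}eA /qf mul_row_block !mul0mx !add0r tr_row_mx mul_row_col trmx0 mulmx0 add0r.
  exact.
have uA' := posdef_unit pA'.
pose w := be *m invmx A'; pose E := al - w *m be^T.
have wA : w *m A' = be by rewrite /w mulmxKV.
have Aw : A' *m w^T = be^T by rewrite -wA [RHS]trmx_mul sA'.
pose U : 'M[R]_(1 + r) := block_mx 1%:M w 0 1%:M.
have fA : A = U *m block_mx E 0 0 A' *m U^T.
  rewrite /U tr_block_mx !trmx1 trmx0 !mulmx_block !mul1mx !mulmx0 !mul0mx !addr0 !add0r wA !mulmx1.
  have wb : w *m be^T = be *m w^T by rewrite -Aw mulmxA wA.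
  by rewrite [LHS]eA Aw /E wb subrK add0r.
have dU : \det U = 1 by rewrite /U det_ublock !det1 mulr1.
have qA t x : qf A (row_mx t%:M x) = E 0 0 * t ^+ 2 + qf A' (x + t *: w).
  rewrite /qf fA !mulmxA -mulmxA -trmx_mul.
  have -> : (row_mx t%:M x : 'rV_(1 + r)) *m U = row_mx t%:M (x + t *: w).
    by rewrite /U mul_row_block mulmx1 mulmx0 addr0 mulmx1 mul_scalar_mx addrC.
  rewrite mul_row_block !mulmx0 addr0 add0r tr_row_mx mul_row_col mxE; congr (_ + _).
  by rewrite tr_scalar_mx mul_scalar_mx -scalemxAl mul_mx_scalar !mxE; ring.
have e0 : 0 < E 0 0.
  have : (row_mx 1%:M (- w) : 'rV_(1 + r)) != 0.
    apply/eqP => h; have := congr1 (@lsubmx R 1 1 r) h; rewrite row_mxKl => /matrixP/(_ 0 0).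
    by rewrite !mxE /= => /eqP; rewrite oner_eq0.
  by move/pA; rewrite qA scale1r addNr qf0 addr0 expr1n mulr1.
exists (E 0 0), w, A'; split=> //.
by rewrite {1}fA !det_mulmx det_tr dU mul1r mulr1 det_ublock {1}[E]mx11_scalar det_scalar1.
Qed.

End PosDef.

(** * Unit cubes meeting an ellipsoid *)

Section Cubes.
Variable R : realType.

Definition near_int n (y : 'rV[R]_n) (m : 'rV[int]_n) := forall i, `|y 0 i - (m 0 i)%:~R| <= 2^-1.

Lemma Omega_ge0 k : 0 <= Omega R k.
Proof.
rewrite /Omega; apply: divr_ge0; first exact: powR_ge0.
rewrite /Gamma; apply: Rintegral_ge0 => x _.
by apply: mulr_ge0; [exact: powR_ge0|exact: expR_ge0].
Qed.

(** The centre is arbitrary because the slices of a centred ellipsoid are not centred. Positivity of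
    the determinant is part of the induction, as the step divides by sqrt(det A'). *)
Theorem ellipsoid_cubes r (A : 'M[R]_r) (c : 'rV[R]_r) (s : R) : posdef A -> 0 <= s ->
  0 < \det A /\ exists S : seq 'rV[int]_r,
  [/\ uniq S, forall m, m \in S -> exists2 y, near_int y m & qf A (y - c) <= s ^+ 2 &
      Omega R r * s ^+ r <= Num.sqrt (\det A) * (size S)%:R].
Proof.
elim: r A c s => [|r IH] A c s pA s0.
  rewrite det_mx00; split=> //; exists [:: 0]; split=> //.
    move=> m _; exists c; first by case.
    by rewrite subrr qf0 sqr_ge0.
  by rewrite Omega0 expr0 sqrtr1 mulr1.
have [e [w [A' [pA' e0 dA qA]]]] := @schur_complement R r A pA.
have [d0 _] := IH A' 0 0 pA' (lexx 0).
have dA0 : 0 < \det A by rewrite dA mulr_gt0.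
split=> //.
move: s0; rewrite le_eqVlt => /orP[/eqP <-|s0].
  by exists [::]; split=> //; rewrite expr0n /= !mulr0.
pose sd := Num.sqrt (\det A'); have sd0 : 0 < sd by rewrite sqrtr_gt0.
pose se := Num.sqrt e; have se0 : 0 < se by rewrite sqrtr_gt0.
have se2 : se ^+ 2 = e by rewrite sqr_sqrtr // ltW.
pose K := Omega R r * s ^+ r / sd.
have O0 := Omega_ge0.
have K0 : 0 <= K by apply: divr_ge0 (ltW sd0); apply: mulr_ge0; [exact: O0|exact: exprn_ge0 (ltW s0)].
have [F [dF cF WF]] := slice_primP R r.
pose cir (y : R) := Num.sqrt (1 - y ^+ 2).
have cir0 (y : R) : 0 <= cir y ^+ r by apply: exprn_ge0; exact: sqrtr_ge0.
pose c' : 'rV[R]_(1 + r) := c.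
pose c0 := (lsubmx c') 0 0; pose c1 := rsubmx c'.
have sg0 : 0 < s / se by rewrite divr_gt0.
have [sl [us hs ls]] := @unit_slices R F (fun y => cir y ^+ r) c0 (s / se) sg0 dF cF cir0.
(* Induction on the list of slices. Cubes from different slices are distinct because their first
   coordinates are. *)
have build : forall l : seq (int * R), uniq (map fst l) ->
    (forall p, p \in l -> -1 < p.2 < 1 /\ `|c0 + s / se * p.2 - p.1%:~R| <= 2^-1) ->
  exists S : seq 'rV[int]_(1 + r), [/\ uniq S,
    forall m, m \in S -> (lsubmx m) 0 0 \in map fst l,
    forall m, m \in S -> exists2 y, near_int y m & qf A (y - c') <= s ^+ 2 &
    K * \sum_(p <- l) cir p.2 ^+ r <= (size S)%:R].
  elim=> [_ _|[m t] l IHl /= /andP[ml ul] hl].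
    by exists [::]; split=> //; rewrite big_nil mulr0.
  have [S1 [u1 h1 w1 n1]] := IHl ul (fun p pl => hl p (@mem_behead _ ((m, t) :: l) p pl)).
  have [/andP[t1 t2] tm] := hl _ (mem_head _ _); rewrite /= in t1 t2 tm.
  have st0 : 0 <= s * cir t by rewrite mulr_ge0 ?(ltW s0) ?sqrtr_ge0.
  (* At height t the slice has radius s sqrt(1 - t^2), and the cross term w shifts its centre. *)
  have [_ [S2 [u2 w2 n2]]] := IH A' (c1 - (s / se * t) *: w) (s * cir t) pA' st0.
  pose emb (z : 'rV[int]_r) : 'rV[int]_(1 + r) := row_mx (m%:M) z.
  exists (map emb S2 ++ S1); split.
  - rewrite cat_uniq u1 andbT map_inj_uniq ?u2 /=; last by move=> z1 z2 /eq_row_mx[].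
    apply/hasPn => z zS; apply/negP => /mapP[z' _ ez]; move: (h1 _ zS).
    by rewrite ez row_mxKl mxE eqxx mulr1n (negbTE ml).
  - move=> z; rewrite mem_cat inE => /orP[/mapP[z' _ ->]|/h1 ->]; last by rewrite orbT.
    by rewrite row_mxKl mxE eqxx mulr1n eqxx.
  - move=> z; rewrite mem_cat => /orP[/mapP[z' zS ->]|/w1 //].
    have [y' ny' qy'] := w2 _ zS.
    exists (row_mx (c0 + s / se * t)%:M y').
      move=> i; rewrite /emb; case: (split_ordP i) => j ->.
        by rewrite !row_mxEl !mxE (ord1 j) eqxx !mulr1n.
      by rewrite !row_mxEr.
    have -> : row_mx (c0 + s / se * t)%:M y' - c' = row_mx (s / se * t)%:M (y' - c1).
      rewrite -[c']hsubmxK opp_row_mx add_row_mx; congr row_mx.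
      by apply/matrixP => i j; rewrite (ord1 i) (ord1 j) !mxE !eqxx !mulr1n /c0 !mxE; ring.
    rewrite qA; have -> : y' - c1 + (s / se * t) *: w = y' - (c1 - (s / se * t) *: w) by rewrite opprB addrAC addrA.
    have ct : cir t ^+ 2 = 1 - t ^+ 2 by rewrite sqr_sqrtr //; nra.
    move: qy'; rewrite [(s * cir t) ^+ 2]exprMn ct => qy'.
    have -> : e * (s / se * t) ^+ 2 = s ^+ 2 * t ^+ 2 by rewrite -se2; field; rewrite gt_eqF.
    by move: qy'; rewrite mulrBr mulr1; lra.
  rewrite big_cons size_cat size_map natrD mulrDr lerD //=.
  have -> : K * cir t ^+ r = Omega R r * (s * cir t) ^+ r / sd by rewrite /K exprMn; ring.
  by rewrite ler_pdivrMr // [leRHS]mulrC.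
have [S [uS _ wS nS]] := build sl us hs.
exists S; split=> //.
have -> : Num.sqrt (\det A) = se * sd by rewrite dA sqrtrM ?(ltW e0).
apply: le_trans (_ : se * sd * (K * \sum_(p <- sl) cir p.2 ^+ r) <= _); last first.
  by rewrite ler_wpM2l // mulr_ge0 ?(ltW se0) ?(ltW sd0).
rewrite OmegaS -WF.
apply: le_trans (_ : se * sd * (K * (s / se * (F 1 - F (-1)))) <= _); last first.
  by rewrite ler_wpM2l ?mulr_ge0 ?(ltW se0) ?(ltW sd0) // ler_wpM2l.
rewrite le_eqVlt; apply/orP; left; apply/eqP; rewrite /K exprSr; field.
by rewrite !gt_eqF.
Qed.
End Cubes.

(** * Convexity and positivity of quadratic forms *)

Section Forms.
Variables (R : realType) (n : nat) (A : 'M[R]_n).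
Hypothesis sA : A^T = A.
Implicit Types x y z : 'rV[R]_n.

Definition bf x y : R := (x *m A *m y^T) 0 0.

Lemma bfC x y : bf x y = bf y x.
Proof.
rewrite /bf; transitivity ((x *m A *m y^T)^T 0 0); first by rewrite [RHS]mxE.
by rewrite !trmx_mul trmxK sA mulmxA.
Qed.

Lemma bfDl x y z : bf (x + y) z = bf x z + bf y z.
Proof. by rewrite /bf !mulmxDl mxE. Qed.

Lemma bfZl (k : R) x z : bf (k *: x) z = k * bf x z.
Proof. by rewrite /bf -!scalemxAl mxE. Qed.

Lemma qfE x : qf A x = bf x x. Proof. by []. Qed.

Lemma qfD x y : qf A (x + y) = qf A x + 2 * bf x y + qf A y.
Proof. by rewrite !qfE bfDl ![bf _ (x + y)]bfC !bfDl (bfC y x); ring. Qed.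

Lemma qfZ (k : R) x : qf A (k *: x) = k ^+ 2 * qf A x.
Proof. by rewrite !qfE bfZl bfC bfZl; ring. Qed.

Lemma bf_sum x y : bf x y = \sum_i \sum_j x 0 i * y 0 j * A i j.
Proof.
rewrite /bf mxE exchange_big /=; apply: eq_bigr => j _; rewrite !mxE mulr_suml.
by apply: eq_bigr => i _; rewrite mulrAC.
Qed.

Lemma qf_sum x : qf A x = \sum_i \sum_j x 0 i * x 0 j * A i j.
Proof. exact: bf_sum. Qed.

Lemma qf_triangle (s rho : R) x y : posdef A -> 0 <= s -> 0 <= rho ->
  qf A x <= s ^+ 2 -> qf A y <= rho ^+ 2 -> qf A (x + y) <= (s + rho) ^+ 2.
Proof.
move=> [_ pA] s0 r0 hx hy.
have pos z : 0 <= qf A z.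
  by have [->|z0] := eqVneq z 0; [rewrite qf0|rewrite ltW // pA].
have zer z : qf A z <= 0 -> z = 0.
  by move=> h; apply/eqP; apply: contraTT h => z0; rewrite -ltNge pA.
have [se|sn] := eqVneq s 0.
  by rewrite se expr0n /= in hx; rewrite (zer _ hx) add0r se add0r.
have [re|rn] := eqVneq rho 0.
  by rewrite re expr0n /= in hy; rewrite (zer _ hy) addr0 re addr0.
have sp : 0 < s by rewrite lt0r sn.
have rp : 0 < rho by rewrite lt0r rn.
(* Nonnegativity at rho x - s y is the Cauchy-Schwarz inequality in the form bf x y <= s rho. *)
have := pos (rho *: x + (- s) *: y); rewrite (qfD (_ *: x)) (qfD x) (qfZ _ x) (qfZ _ y) bfZl (bfC x (_ *: y)) bfZl (bfC y x) sqrrN => h.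
have h1 : rho ^+ 2 * qf A x <= rho ^+ 2 * s ^+ 2 by rewrite ler_pM2l // exprn_gt0.
have h2 : s ^+ 2 * qf A y <= s ^+ 2 * rho ^+ 2 by rewrite ler_pM2l // exprn_gt0.
have h3 : bf x y <= s * rho.
  rewrite -(ler_pM2l (mulr_gt0 sp rp)); move: h h1 h2; set b := bf x y.
  have E1 : rho * (- s * b) = - (s * rho * b) by ring.
  have E2 : s * rho * (s * rho) = rho ^+ 2 * s ^+ 2 by ring.
  rewrite E1 E2 [s ^+ 2 * rho ^+ 2]mulrC; set W := rho ^+ 2 * s ^+ 2.
  by set p := _ * qf A x; set q := _ * qf A y; set w := s * rho * b; lra.
by move: hx hy h3; lra.
Qed.

(** A convex function on a cube is largest at a vertex. Coordinates from index k on are already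
    extreme; one more is moved to both its end points, and [key] compares the value at a convex
    combination with the two values. *)
Lemma qf_cube (C : R) : (forall x, 0 <= qf A x) ->
  (forall x, (forall i, x 0 i = 2^-1 \/ x 0 i = - 2^-1) -> qf A x <= C) ->
  forall x, (forall i, `|x 0 i| <= 2^-1) -> qf A x <= C.
Proof.
move=> psd hv.
suff H k : forall x, (forall i, `|x 0 i| <= 2^-1) ->
    (forall i : 'I_n, (k <= i)%N -> x 0 i = 2^-1 \/ x 0 i = - 2^-1) -> qf A x <= C.
  by move=> x hx; apply: (H n) => // i; rewrite leqNgt ltn_ord.
elim: k => [|k IH] x hx hk; first by apply: hv => i; apply: hk.
have [kn|kn] := leqP n k; first by apply: IH => // i ki; move: (ltn_ord i); rewrite ltnNge (leq_trans kn ki).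
pose o := Ordinal kn.
pose upd (t : R) : 'rV[R]_n := \row_i (if i == o then t else x 0 i).
have hupd (t : R) : `|t| = 2^-1 -> t = 2^-1 \/ t = - 2^-1 -> qf A (upd t) <= C.
  move=> nt ht; apply: IH => i; rewrite mxE; first by case: ifP; rewrite ?nt.
  rewrite leq_eqVlt => /orP[/eqP e|ki]; first by rewrite (_ : i == o) //; apply/eqP/val_inj.
  by case: ifP => // _; apply: hk.
have h1 := hupd 2^-1 (ger0_norm _) (or_introl erefl).
have h2 := hupd (- 2^-1) _ (or_intror erefl).
pose l := x 0 o + 2^-1.
have := hx o; rewrite ler_norml => /andP[l0 l1].
have xE : x = l *: upd (2^-1) + (1 - l) *: upd (- 2^-1).
  apply/rowP => i; rewrite !mxE; case: eqP => [->|_]; rewrite /l; first by field.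
  by ring.
have key : qf A x = l * qf A (upd 2^-1) + (1 - l) * qf A (upd (- 2^-1)) - l * (1 - l) * qf A (upd 2^-1 + (-1) *: upd (- 2^-1)).
  by rewrite {1}xE !qfD !qfZ !bfZl !(bfC _ (_ *: _)) !bfZl (bfC (upd (- 2^-1))); ring.
have p := psd (upd 2^-1 + (-1) *: upd (- 2^-1)).
have g1 : qf A (upd 2^-1) <= C by apply: h1; rewrite invr_ge0.
have g2 : qf A (upd (- 2^-1)) <= C by apply: h2; rewrite normrN ger0_norm // invr_ge0.
have lp : 0 <= l by rewrite /l; lra.
have lq : 0 <= 1 - l by rewrite /l; lra.
have e1 := ler_wpM2l lp g1; have e2 := ler_wpM2l lq g2.
have e3 := mulr_ge0 (mulr_ge0 lp lq) p.
rewrite key; lra.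
Qed.

(** Heights give nonnegativity at integer vectors only. If q(x) < 0, the vector of floors of N x
    differs from N x by a bounded amount, so its value is N^2 q(x) + O(N) and becomes negative. *)
Lemma qf_psd : (forall m : 'rV[int]_n, 0 <= qf A (map_mx intr m)) -> forall x, 0 <= qf A x.
Proof.
move=> hZ x; rewrite leNgt; apply/negP => q0.
pose C := \sum_i \sum_j `|A i j|; pose C' := \sum_i \sum_j `|x 0 i| * `|A i j|.
have C0 : 0 <= C by apply: sumr_ge0 => i _; apply: sumr_ge0.
have bound (z : 'rV[R]_n) : (forall i, `|z 0 i| <= 1) -> qf A z <= C /\ `|bf x z| <= C'.
  move=> hz; split.
    rewrite qf_sum; apply: ler_sum => i _; apply: ler_sum => j _.
    apply: le_trans (ler_norm _) _; rewrite !normrM ler_piMl // mulr_ile1 //.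
  rewrite bf_sum; apply: le_trans (ler_norm_sum _ _ _) _; apply: ler_sum => i _.
  apply: le_trans (ler_norm_sum _ _ _) _; apply: ler_sum => j _.
  by rewrite !normrM ler_wpM2r // ler_piMr.
pose c := - qf A x; have c0 : 0 < c by rewrite /c; lra.
have C'0 : 0 <= C' by apply: sumr_ge0 => i _; apply: sumr_ge0 => j _; rewrite mulr_ge0.
have h0 : 0 <= (2 * C' + C) / c by rewrite divr_ge0 ?(ltW c0) // addr_ge0 // mulr_ge0.
pose N := (Num.bound ((2 * C' + C) / c)).
have hN : 2 * C' + C < c * N%:R by have := archi_boundP h0; rewrite ltr_pdivrMr // [_ * c]mulrC.
have N1 : 1 <= N%:R :> R.
  rewrite ler1n lt0n; apply/eqP => N0; move: hN; rewrite N0 mulr0; lra.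
pose m : 'rV[int]_n := \row_i Num.floor (N%:R * x 0 i).
pose f : 'rV[R]_n := map_mx intr m + (- N%:R) *: x.
have hf i : `|f 0 i| <= 1.
  rewrite !mxE ler_norml; have := floor_itv (N%:R * x 0 i).
  by rewrite intrD => /andP[]; lra.
have [b1 b2] := bound f hf.
have := hZ m; have -> : map_mx intr m = N%:R *: x + f by rewrite /f addrC scaleNr addrNK.
rewrite qfD qfZ bfZl.
have : bf x f <= C' by apply: le_trans b2; rewrite ler_norm.
rewrite -(ler_pM2l (lt_le_trans ltr01 N1)) => b3.
have : C <= N%:R * C by rewrite ler_peMl.
have : N%:R * (2 * C' + C) < N%:R * (c * N%:R) by rewrite ltr_pM2l // (lt_le_trans ltr01 N1).
rewrite /c; move: b1 b3; lra.
Qed.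

End Forms.

Lemma psd_posdef (R : realType) n (A : 'M[R]_n) : A^T = A -> (forall x, 0 <= qf A x) -> \det A != 0 -> posdef A.
Proof.
move=> sA psd dA; split=> // x x0; rewrite lt0r psd andbT; apply: contra x0 => /eqP q0.
have uA : A \in unitmx by rewrite unitmxE unitfE.
have b0 y : bf A x y = 0.
  apply/eqP; rewrite -normr_le0 leNgt; apply/negP => b1.
  set b := bf A x y in b1.
  (* This k makes the form equal to -1 at k x + y. *)
  pose k := - (qf A y + 1) / (2 * b).
  have bn : b != 0 by rewrite -normr_gt0.
  have := psd (k *: x + y); rewrite (qfD sA) (qfZ sA) q0 bfZl -/b /k.
  by rewrite (_ : _ + _ = - 1); [lra|field].
have : x *m A = 0.
  apply/rowP => j; rewrite [RHS]mxE; have := b0 (delta_mx 0 j).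
  rewrite /bf mxE (bigD1 j) //= big1 ?addr0 => [|i ij]; first by rewrite !mxE !eqxx mulr1.
  by rewrite !mxE (negbTE ij) andbF mulr0.
by move/(congr1 (mulmx^~ (invmx A))); rewrite mulmxK // mul0mx => ->.
Qed.

Theorem lattice_count (R : realType) r (A : 'M[R]_r) (T rho : R) : posdef A ->
  0 <= T -> 0 <= rho <= Num.sqrt T ->
  (forall z : 'rV[R]_r, (forall i, `|z 0 i| <= 2^-1) -> qf A z <= rho ^+ 2) ->
  exists S : seq 'rV[int]_r, [/\ uniq S, forall m, m \in S -> qf A (map_mx intr m) <= T &
    Omega R r * (Num.sqrt T - rho) ^+ r <= Num.sqrt (\det A) * (size S)%:R].
Proof.
move=> pA T0 /andP[r0 rT] hc; have [sA _] := pA.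
have s0 : 0 <= Num.sqrt T - rho by rewrite subr_ge0.
have [_ [S [uS wS nS]]] := ellipsoid_cubes 0 pA s0.
exists S; split=> // m /wS[y ny]; rewrite subr0 => qy.
have -> : T = (Num.sqrt T - rho + rho) ^+ 2 by rewrite subrK sqr_sqrtr.
have -> : map_mx intr m = y + (map_mx intr m - y) by rewrite addrC subrK.
apply: (qf_triangle sA) => //; apply: hc => i.
by rewrite !mxE distrC; exact: ny.
Qed.

(** It turns (sqrt T - rho)^r into the two-term expression of the final bound. *)
Lemma bernoulli_sub (R : realType) (a rho : R) n : 0 <= rho <= a ->
  a ^+ n.+1 - n.+1%:R * rho * a ^+ n <= (a - rho) ^+ n.+1.
Proof.
move=> /andP[r0 ra]; elim: n => [|n IH]; first by rewrite !expr1 expr0; lra.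
rewrite [leRHS]exprS; apply: le_trans (ler_wpM2l _ IH); last by rewrite subr_ge0.
have : 0 <= n.+1%:R * rho ^+ 2 * a ^+ n by rewrite !mulr_ge0 ?exprn_ge0 // (le_trans r0).
rewrite -[n.+2%:R]natr1 [a ^+ n.+2]exprS [a ^+ n.+1]exprS.
set N := n.+1%:R; set p := a ^+ n; move=> h.
rewrite (_ : (a - rho) * (a * p - N * rho * p) = a * (a * p) - (N + 1) * rho * (a * p) + N * rho ^+ 2 * p); first by lra.
by ring.
Qed.

(** * Counting classes *)

Lemma bqf_equiv_sym f g : bqf_equiv f g -> bqf_equiv g f.
Proof.
case: f g => [[a b] c] [[a' b'] c'] [al [be [ga [de [D [-> -> ->]]]]]].
exists de, (- be), (- ga), al; split; first by rewrite -D; ring.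
have D2 : (al * de - be * ga) ^+ 2 = 1 by rewrite D expr1n.
by congr (_, _, _); rewrite -[LHS]mulr1 -[X in _ * X = _]D2; ring.
Qed.

Lemma bqf_equiv_trans f g k : bqf_equiv f g -> bqf_equiv g k -> bqf_equiv f k.
Proof.
case: f g k => [[a b] c] [[a' b'] c'] [[a'' b''] c''] [al [be [ga [de [D [-> -> ->]]]]]].
case=> al' [be' [ga' [de' [D' [-> -> ->]]]]].
exists (al * al' + be * ga'), (al * be' + be * de'), (ga * al' + de * ga'), (ga * be' + de * de').
split; last by congr (_, _, _); ring.
by transitivity ((al * de - be * ga) * (al' * de' - be' * ga')); [ring|rewrite D D' mulr1].
Qed.

Lemma hW_rat_ge0 (R : realType) x : 0 <= hW_rat R x.
Proof. by rewrite /hW_rat ln_ge0 // le_max [X in _ || X]ler1z -gtz0_ge1 denq_gt0 orbT. Qed.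

Lemma deltaE_ge (R : realType) a4 a6 : 5 / 3 <= deltaE R a4 a6.
Proof.
rewrite /deltaE; have := hW_rat_ge0 R (j_inv a4 a6).
by have := hW_rat_ge0 R (ec_disc a4 a6)%:~R; lra.
Qed.

(** * Consequences of bound-suitability *)

Section Bounds.
Variables (R : realType) (a4 a6 u v : int) (eps D : R).
Hypotheses (u0 : 0 < u) (v0 : 0 < v) (d0 : 0 < dE a4 a6 u v).
Hypotheses (e0 : 0 < eps) (e1 : eps < 2^-1) (D0 : 0 <= D).
Let d : R := (dE a4 a6 u v)%:~R.
Let m : R := (u * v + v ^+ 2)%:~R.

Let dp : 0 < d. Proof. by rewrite ltr0z. Qed.
Let m2 : 2 <= m.
Proof.
have u1 : 1 <= u by rewrite -gtz0_ge1.
have v1 : 1 <= v by rewrite -gtz0_ge1.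
rewrite (_ : 2 = 2%:~R) // ler_int; nra.
Qed.

Let e2 : 0 < 1 - eps. Proof. by move: e1; lra. Qed.

Let eps'E : 1 + eps / (1 - eps) = (1 - eps)^-1.
Proof. by field; rewrite gt_eqF. Qed.

Let lower : powR (4^-1 * m) (1 + eps / (1 - eps)) * expR (2 * (1 + eps / (1 - eps)) * (deltaE R a4 a6 + D)) < d ->
  ln m - 2 * ln 2 + 2 * (deltaE R a4 a6 + D) < (1 - eps) * ln d.
Proof.
have m0 : 0 < m by move: m2; lra.
have k0 : 0 < (1 - eps)^-1 by rewrite invr_gt0.
have q0 : 0 < 4^-1 * m by rewrite mulr_gt0 ?invr_gt0.
rewrite eps'E -ltr_ln ?posrE ?(mulr_gt0 (powR_gt0 _ q0) (expR_gt0 _)) // (lnMp (powR_gt0 _ q0) (expR_gt0 _)) ln_powR expRK.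
have l4 : ln (4^-1 * m) = ln m - 2 * ln 2.
  rewrite lnMp ?invr_gt0 // lnV ?posrE // (_ : 4 = 2 ^+ 2 :> R) ?lnXp //; last by ring.
  by rewrite addrC.
rewrite l4 => h; rewrite [ltRHS]mulrC -ltr_pdivrMr //.
by rewrite mulrDl; move: h; set k := (1 - eps)^-1; lra.
Qed.

(** It makes the radius sqrt(T) larger than the correction sqrt(D/8) coming from the cubes. *)
Lemma TE_gt : powR (4^-1 * m) (1 + eps / (1 - eps)) * expR (2 * (1 + eps / (1 - eps)) * (deltaE R a4 a6 + D)) < d ->
  D / 4 < TE a4 a6 u v eps.
Proof.
move/lower => h; rewrite /TE -/d -/m.
have m0 : 0 < m by move: m2; lra.
have p0 : 0 < powR d (1 - eps) by exact: powR_gt0.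
have p4 : 0 < 4 :> R by [].
rewrite ln_div ?posrE ?mulr_gt0 // (lnMp p4 p0) ln_powR (_ : ln 4 = 2 * ln 2 :> R); first by lra.
by rewrite -lnXp // (_ : 2 ^+ 2 = 4 :> R) //; ring.
Qed.

Lemma TE_exp : 8 * TE a4 a6 u v eps + 2 * (deltaE R a4 a6 - ln 2) = ln (powR d (1 - eps) / m).
Proof.
have m0 : 0 < m by move: m2; lra.
have p0 : 0 < powR d (1 - eps) by exact: powR_gt0.
have p4 : 0 < 4 :> R by [].
rewrite /TE -/d -/m !ln_div ?posrE ?mulr_gt0 // (lnMp p4 p0) ln_powR (_ : ln 4 = 2 * ln 2 :> R); first by lra.
by rewrite -lnXp // (_ : 2 ^+ 2 = 4 :> R) //; ring.
Qed.

(** Since delta >= 5/3 and m >= 2, the lower bound on d makes ln d positive, so that the exponent 1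
    - eps lowers d. *)
Lemma dE_gt1 : powR (4^-1 * m) (1 + eps / (1 - eps)) * expR (2 * (1 + eps / (1 - eps)) * (deltaE R a4 a6 + D)) < d ->
  powR d (1 - eps) < d.
Proof.
move/lower => h.
have l2 : ln 2 < 2 :> R by apply: ln_sublinear.
have lm : ln 2 <= ln m by rewrite ler_ln ?posrE // (lt_le_trans _ m2).
have dl := deltaE_ge R a4 a6.
have ld : 0 < ln d by rewrite -(pmulr_rgt0 _ e2); move: h D0 l2; lra.
rewrite -ltr_ln ?posrE ?powR_gt0 // ln_powR.
by rewrite gtr_pMl //; move: e0; lra.
Qed.

Lemma dE_powR_lt : d < powR ((v ^+ 2 * (u * v + v ^+ 2))%:~R) (1 + eps / (1 - eps)) ->
  powR d (1 - eps) / m < (v ^+ 2)%:~R.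
Proof.
have m0 : 0 < m by move: m2; lra.
have vp : 0 < (v ^+ 2)%:~R :> R by rewrite ltr0z exprn_gt0.
rewrite eps'E [(_ * (_ + _))%:~R]intrM -/m => h.
rewrite ltr_pdivrMr // -ltr_ln ?posrE ?powR_gt0 ?mulr_gt0 // ln_powR.
move: h; rewrite -ltr_ln ?posrE ?powR_gt0 ?mulr_gt0 // ln_powR => h.
by rewrite mulrC -ltr_pdivlMr // mulrC.
Qed.
End Bounds.

(** Each point selects a representative of the class of its form. Two points selecting the same one
    have equivalent forms, which [class_kernel] excludes when their difference lies below both
    thresholds. *)
Lemma class_count (a4 a6 u v : int) (h : nat) (disc0 : ec_disc a4 a6 != 0) (L : seq (ept disc0)) :
  map_suitable a4 a6 u v -> fundamental_disc (- DE a4 a6 u v) ->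
  is_class_number (- DE a4 a6 u v) h -> uniq L ->
  (forall Q Q', Q \in L -> Q' \in L -> Q != Q' -> forall x y, val (Q - Q') = Some (x, y) ->
    denq x < v ^+ 2 /\ v * (u + v) * Num.max `|numq x| (denq x) < dE a4 a6 u v) ->
  (size L <= h)%N.
Proof.
move=> ms fd [reps [<- _ _ hrep]] uL hL.
have ex (Q : ept disc0) : exists g, g \in reps /\ exists2 f, form_of a4 a6 u v (val Q) f & bqf_equiv g f.
  have [f fQ] := form_of_exists fd (valP Q).
  by have [g gr gf] := hrep f (form_of_ppd ms fd fQ); exists g; split=> //; exists f.
pose rep Q := projT1 (cid (ex Q)).
have repP Q : rep Q \in reps /\ exists2 f, form_of a4 a6 u v (val Q) f & bqf_equiv (rep Q) f.
  exact: projT2 (cid (ex Q)).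
rewrite -(size_map rep); apply: uniq_leq_size; last by move=> _ /mapP[Q _ ->]; exact: (repP Q).1.
rewrite map_inj_in_uniq // => Q Q' QL Q'L e; apply/eqP; apply: contraT => QQ'.
have [_ [f fQ gf]] := repP Q; have [_ [f' fQ' gf']] := repP Q'; rewrite -e in gf'.
have ff' := bqf_equiv_trans (bqf_equiv_sym gf) gf'.
have vQ : val Q != val Q' by apply: contra QQ' => /eqP /val_inj ->.
case E : (val (Q - Q')) => [[x y]|]; last first.
  by case/eqP: QQ'; apply/eqP; rewrite -subr_eq0; apply/eqP/val_inj.
have [h1 h2] := hL Q Q' QL Q'L QQ' x y E.
have := class_kernel ms fd (valP Q) (valP Q') vQ fQ fQ' ff' E.
by case; rewrite leNgt ?h1 ?h2.
Qed.

(** * The lattice of points and its Gram matrix *)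

Section Count.
Variables (R : realType) (a4 a6 : int) (r : nat) (P : 'I_r -> ecpt).
Hypothesis disc0 : ec_disc a4 a6 != 0.
Hypothesis oP : forall i, on_curve a4 a6 (P i).
Local Notation E := (ept disc0).

Definition gen (i : 'I_r) : E := exist _ (P i) (oP i).
Definition comb (m : 'rV[int]_r) : E := \sum_i gen i *~ m 0 i.
Definition gram : 'M[R]_r := \matrix_(i < r, j < r) height_pairing R a4 (P i) (P j).

Lemma gramE i j : gram i j = polar (@canonh R a4 a6 disc0) (gen i) (gen j).
Proof. by rewrite mxE. Qed.

Lemma gram_sym : gram^T = gram.
Proof. by apply/matrixP => i j; rewrite mxE !gramE polarC. Qed.

Lemma canonh_comb m : canonh R (comb m) = qf gram (map_mx intr m).
Proof.
rewrite qf_sum (quad_sum (@canonh_para R a4 a6 disc0)).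
by apply: eq_bigr => i _; apply: eq_bigr => j _; rewrite gramE !mxE.
Qed.

Lemma gram_psd x : 0 <= qf gram x.
Proof. by apply: (qf_psd gram_sym) => m; rewrite -canonh_comb canonh_ge0. Qed.

Lemma dP_ge0 : 0 <= dP R a4 P.
Proof.
exact: bigmax_ge_id.
Qed.

Lemma gram_cube (z : 'rV[R]_r) : (forall i, `|z 0 i| <= 2^-1) -> qf gram z <= dP R a4 P / 8.
Proof.
apply: (qf_cube gram_sym gram_psd) => x hx.
(* A vertex of the cube is half of a combination with signs, so its value is a quarter of a
   canonical height that is at most d(P)/2. The elements 1 and 2 of 'I_3 encode the signs 1 and
   -1. *)
pose s : {ffun 'I_r -> 'I_3} := [ffun i => if x 0 i == 2^-1 then 1 else 2].
pose m : 'rV[int]_r := \row_i sign3 (s i).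
have xE : x = 2^-1 *: map_mx intr m.
  apply/rowP => i; rewrite !mxE ffunE /sign3.
  have n2 : (- 2^-1 == 2^-1 :> R) = false by apply/negbTE; rewrite lt_eqF //; lra.
  by case: (hx i) => ->; rewrite ?eqxx ?n2 /= ?mulr1 ?mulrN1.
rewrite xE (qfZ gram_sym) -canonh_comb.
have : 2 * canonh R (comb m) <= dP R a4 P.
  apply: le_trans (le_bigmax _ _ s); rewrite /canonh /comb -ept_lincomb.
  by rewrite le_eqVlt; apply/orP; left; apply/eqP; do 3! f_equal; apply/funext => i; rewrite mxE.
by rewrite (_ : 2^-1 ^+ 2 = 4^-1 :> R); [lra|field].
Qed.

Hypothesis indep : lin_indep a4 P.

Lemma comb_eq0 m : comb m = 0 -> m = 0.
Proof.
move=> h; apply/rowP => i; rewrite [RHS]mxE; apply: (indep (n := fun i => m 0 i)).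
by have := ept_lincomb (fun i => m 0 i) gen; rewrite -/(comb m) h.
Qed.

Lemma combB m m' : comb (m - m') = comb m - comb m'.
Proof. by rewrite /comb -sumrB; apply: eq_bigr => i _; rewrite !mxE mulrzBr. Qed.

(** Multiplying by k k' kills both torsion parts and leaves a relation between the generators. *)
Lemma comb_torsion_inj m m' (g g' : E) : (exists2 k, (0 < k)%N & g *+ k = 0) ->
  (exists2 k, (0 < k)%N & g' *+ k = 0) -> comb m + g = comb m' + g' -> m = m' /\ g = g'.
Proof.
move=> [k k0 gk] [k' k'0 gk'] e.
have e1 : comb (m - m') = g' - g.
  by rewrite combB; apply/eqP; rewrite subr_eq addrAC eq_sym subr_eq addrC -e addrC.
have combMn n : comb ((m - m') *+ n) = comb (m - m') *+ n.
  rewrite /comb -sumrMnl; apply: eq_bigr => i _; rewrite mulmxnE.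
  by rewrite -mulr_natr mulrzA natz -pmulrn.
have : comb ((m - m') *+ (k * k')) = 0.
  by rewrite combMn e1 mulrnBl [g *+ _]mulrnA gk mul0rn [(k * k')%N]mulnC mulrnA gk' mul0rn subrr.
move/comb_eq0 => h.
have kk : (k * k' == 0)%N = false by rewrite muln_eq0 !gtn_eqF.
have mm : m = m'.
  apply/eqP; rewrite -subr_eq0; apply/eqP/rowP => i; rewrite [RHS]mxE.
  have : ((m - m') *+ (k * k')) 0 i = 0 by rewrite h mxE.
  by rewrite mulmxnE => /eqP; rewrite mulrn_eq0 kk => /eqP.
by split=> //; move: e; rewrite mm => /addrI.
Qed.
End Count.

Lemma torsion_ept (a4 a6 : int) (disc0 : ec_disc a4 a6 != 0) (g : ept disc0) :
  is_torsion a4 (val g) -> exists2 k : nat, (0 < k)%N & g *+ k = 0.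
Proof. by move=> [k [k0 hk]]; exists k => //; apply: val_inj; rewrite /= -hk -eptMn. Qed.

Lemma torsion_lift (a4 a6 : int) (disc0 : ec_disc a4 a6 != 0) (G : seq ecpt) : torsion_subgroup a4 a6 G ->
  exists G' : seq (ept disc0), [/\ uniq G', size G' = size G &
    forall g, g \in G' -> exists2 k : nat, (0 < k)%N & g *+ k = 0].
Proof.
move=> [uG _ hG _ _]; exists (pmap insub G); split.
- exact: pmap_sub_uniq.
- rewrite size_pmap_sub; apply/eqP; rewrite -all_count; apply/allP => g gG.
  by have [] := hG g gG.
- by move=> g; rewrite mem_pmap_sub => gG; apply: torsion_ept; have [] := hG _ gG.
Qed.

Lemma canonh_sub_le (R : realType) (a4 a6 : int) (disc0 : ec_disc a4 a6 != 0) (T : R) (Q Q' : ept disc0) :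
  canonh R Q <= T -> canonh R Q' <= T -> canonh R (Q - Q') <= 4 * T.
Proof.
by move=> h1 h2; have := canonh_para R Q Q'; have := canonh_ge0 R (Q + Q'); lra.
Qed.

Lemma ball_count (R : realType) (a4 a6 : int) (r : nat) (P : 'I_r -> ecpt)
  (G : seq ecpt) (eps : R) (u v : int) (h : nat) (S : seq 'rV[int]_r) (disc0 : ec_disc a4 a6 != 0)
  (oP : forall i, on_curve a4 a6 (P i)) :
  lin_indep a4 P -> torsion_subgroup a4 a6 G ->
  0 < eps < 2^-1 -> map_suitable a4 a6 u v -> bound_suitable a4 a6 P eps u v ->
  fundamental_disc (- DE a4 a6 u v) -> is_class_number (- DE a4 a6 u v) h ->
  uniq S -> (forall m, m \in S -> qf (gram R a4 P) (map_mx intr m) <= TE a4 a6 u v eps) ->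
  (size G * size S <= h)%N.
Proof.
move=> indep tG /andP[e0 e1] ms bs fd cn uS hS.
have [G' [uG' <- hG']] := torsion_lift disc0 tG.
pose L : seq (ept disc0) := [seq comb disc0 oP m + g | g <- G', m <- S].
have sL : size L = (size G' * size S)%N by rewrite /L size_allpairs.
rewrite -sL; have d0 := dE_gt0 ms; have [u0 v0 lo up] := bs.
have D0 := dP_ge0 R a4 P.
apply: (class_count (disc0 := disc0) ms fd cn).
  apply: allpairs_uniq => // -[g m] [g' m'] /allpairsP[[g1 m1] /= [g1G m1S [-> ->]]] /allpairsP[[g2 m2] /= [g2G m2S [-> ->]]] /= e.
  by have [-> ->] := comb_torsion_inj indep (hG' _ g1G) (hG' _ g2G) e.
have hc Q : Q \in L -> canonh R Q <= TE a4 a6 u v eps.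
  move=> /allpairsP[[g m] /= [gG mS ->]]; have [k k0 gk] := hG' _ gG.
  by rewrite (canonh_torsion R _ k0 gk) canonh_comb hS.
move=> Q Q' QL Q'L QQ' x y E.
have h4 := canonh_sub_le (hc Q QL) (hc Q' Q'L).
have hw := hW_le_canonh R (Q - Q').
set d : R := (dE a4 a6 u v)%:~R; set m : R := (u * v + v ^+ 2)%:~R.
have dp : 0 < d by rewrite ltr0z.
have mp : 0 < m by rewrite ltr0z addr_gt0 ?mulr_gt0 ?exprn_gt0.
have p0 : 0 < powR d (1 - eps) by exact: powR_gt0.
have HX : ((Num.max `|numq x| (denq x))%:~R : R) <= powR d (1 - eps) / m.
  have tx := TE_exp eps u0 v0 d0.
  have max0 : 0 < (Num.max `|numq x| (denq x))%:~R :> R.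
    by rewrite ltr0z lt_max denq_gt0 orbT.
  rewrite -ler_ln ?posrE ?divr_gt0 //.
  have -> : (Num.max `|numq x| (denq x))%:~R = Num.max `|numq x|%:~R (denq x)%:~R :> R.
    by case: (leP `|numq x| (denq x)) => hh; [rewrite max_r ?ler_int|rewrite max_l ?ler_int ?(ltW hh)].
  have : ln (Num.max `|numq x|%:~R (denq x)%:~R) = hW R (Q - Q') by rewrite /hW E.
  move=> ->; rewrite -tx; move: hw h4; lra.
(* The upper half of bound-suitability yields the threshold v^2, the lower half the threshold d. *)
have lt1 : powR d (1 - eps) / m < (v ^+ 2)%:~R by apply: dE_powR_lt up.
have lt2 : powR d (1 - eps) < d by apply: dE_gt1 lo.
split.
  rewrite -(ltr_int R); apply: le_lt_trans lt1; apply: le_trans HX.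
  by rewrite ler_int le_max lexx orbT.
rewrite -(ltr_int R); apply: le_lt_trans lt2.
rewrite intrM (_ : v * (u + v) = u * v + v ^+ 2); last by ring.
by rewrite -/m mulrC -ler_pdivlMr.
Qed.

Theorem theorem3p3 (R : realType) (a4 a6 : int) (r : nat) (P : 'I_r -> ecpt)
  (G : seq ecpt) (eps : R) (u v : int) (h : nat) :
  ec_disc a4 a6 != 0 ->
  (0 < r)%N ->
  (forall i, on_curve a4 a6 (P i)) ->
  lin_indep a4 P ->
  torsion_subgroup a4 a6 G ->
  0 < eps < 2^-1 ->
  map_suitable a4 a6 u v ->
  bound_suitable a4 a6 P eps u v ->
  - DE a4 a6 u v < 0 ->
  fundamental_disc (- DE a4 a6 u v) ->
  is_class_number (- DE a4 a6 u v) h ->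
  cG R a4 P G * (powR (TE a4 a6 u v eps) (r%:R / 2)
                 - r%:R * Num.sqrt (dP R a4 P)
                   * powR (TE a4 a6 u v eps) ((r%:R - 1) / 2))
    <= h%:R.
Proof.
move=> disc0 r0 oP indep tG he ms bs _ fd cn.
set T := TE a4 a6 u v eps; set D := dP R a4 P.
have D0 : 0 <= D by exact: dP_ge0.
have /andP[e0 e1] := he; have [u0 v0 lo _] := bs.
have T4 : D / 4 < T by apply: TE_gt lo => //; exact: dE_gt0 ms.
have T0 : 0 < T by apply: le_lt_trans T4; rewrite divr_ge0.
rewrite /cG /regulator -/(gram R a4 P); set A := gram R a4 P.
(* A determinant that is at most 0 has square root 0, whose inverse is 0 by convention, and the
   left-hand side vanishes. Otherwise the semidefinite Gram form is nondegenerate, hence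
   definite. *)
have [dA|dA] := lerP (\det A) 0.
  by rewrite (ler0_sqrtr dA) invr0 mulr0 !mul0r.
have pA : posdef A.
  by apply: psd_posdef; [exact: (gram_sym R disc0 oP)|move=> x; exact: (gram_psd disc0 oP)|rewrite gt_eqF].
pose rho := Num.sqrt (D / 8).
have rho0 : 0 <= rho by exact: sqrtr_ge0.
have rho2 : rho ^+ 2 = D / 8 by rewrite sqr_sqrtr // divr_ge0.
have rhoT : rho <= Num.sqrt T by rewrite ler_wsqrtr //; lra.
have rhoD : rho <= Num.sqrt D by rewrite ler_wsqrtr //; lra.
have rr : 0 <= rho <= Num.sqrt T by rewrite rho0.
have [S [uS hS nS]] : exists S : seq 'rV[int]_r, [/\ uniq S, forall m, m \in S -> qf A (map_mx intr m) <= T &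
    Omega R r * (Num.sqrt T - rho) ^+ r <= Num.sqrt (\det A) * (size S)%:R].
  apply: (lattice_count pA (ltW T0) rr) => z hz.
  by rewrite rho2; exact: (gram_cube disc0 oP hz).
have cnt := ball_count disc0 oP indep tG he ms bs fd cn uS hS.
have sA0 : 0 < Num.sqrt (\det A) by rewrite sqrtr_gt0.
have O0 := Omega_ge0 R r.
have sT : powR T (r%:R / 2) = Num.sqrt T ^+ r.
  by rewrite -powR_mulrn ?sqrtr_ge0 // -powR12_sqrt ?(ltW T0) // -powRrM mulrC.
have sT' : powR T ((r%:R - 1) / 2) = Num.sqrt T ^+ r.-1.
  rewrite -powR_mulrn ?sqrtr_ge0 // -powR12_sqrt ?(ltW T0) // -powRrM mulrC.
  by rewrite -subn1 natrB.
rewrite sT sT'; set B := _ - _.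
(* In the linear term of Bernoulli's inequality rho = sqrt(d(P)/8) is replaced by the larger
   sqrt(d(P)). *)
have hB : B <= (Num.sqrt T - rho) ^+ r.
  have := bernoulli_sub r.-1 rr; rewrite prednK // => hb; apply: le_trans hb.
  rewrite /B lerD2l lerN2 ler_wpM2r ?exprn_ge0 ?sqrtr_ge0 //.
  by rewrite ler_wpM2l.
apply: le_trans (_ : (size G)%:R * (size S)%:R <= _); last by rewrite -natrM ler_nat.
set W := Omega R r in O0 nS *.
rewrite -(mulrA _ W) -(mulrA _ _ (W * B)); apply: ler_wpM2l => //.
by rewrite ler_pdivrMl //; apply: le_trans nS; exact: (ler_wpM2l O0 hB).
Qed.
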